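(* Let $n\ge 2$ be an integer and let $f(s)=s^p-s^q$ for $s\ge 0$, where $p>q>0$. For $n>2$ put $$P(q):=\frac{2(q+1)+\sqrt{(n+2)(q+1)(n+2-(n-2)q)}}{n}.$$ Consider the conditions: (i) $n>2$, $0<q\le\frac{4}{n-2}$ and $q<p\le\frac{n+2}{n-2}$; (ii) $n>2$, $\frac{4}{n-2}<q<\frac{4+\sqrt{2n(n+2)}}{2(n-2)}$ and $q<p\le P(q)$; (iii) $n=2$ and $0<q<p$. If one of (i)--(iii) is satisfied, then for every $a\in(0,\infty)$ the problem $$u''(r)+\frac{n-1}{r}u'(r)+f(u(r))=0,\quad r\in(a,\infty),\qquad u(a)=0,\quad \lim_{r\to\infty}u(r)=0,$$ has at most one positive solution. Moreover, if $p>1$ and one of (i)--(iii) is satisfied, then for every $a$ and $b$ with $0<a<b<\infty$ the problem $$u''(r)+\frac{n-1}{r}u'(r)+f(u(r))=0,\quad r\in(a,b),\qquad u(a)=u(b)=0,$$ has at most one positive solution.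
   Context: A positive solution is a classical solution ($C^2$ in the open interval and $C^1$ up to the finite endpoints) of the problem with $u>0$ in the open interval. *)

(* Defs.v *)
From Stdlib Require Import Reals.
From Coquelicot Require Import Coquelicot.
Open Scope R_scope.

(** Stdlib's [Rpower] gives [Rpower 0 p = 1], whereas [0 ^ p = 0] is needed
    for [p > 0].  Bases [s < 0] never occur and get the value [0]. *)
Definition rpow (s p : R) : R := if Rlt_dec 0 s then Rpower s p else 0.

Definition nonlin (p q s : R) : R := rpow s p - rpow s q.

Definition P (n : nat) (q : R) : R :=
  (2 * (q + 1)
   + sqrt ((INR n + 2) * (q + 1) * (INR n + 2 - (INR n - 2) * q))) / INR n.

Definition cond_i (n : nat) (p q : R) : Prop :=
  (2 < n)%nat /\ 0 < q <= 4 / (INR n - 2) /\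
  q < p <= (INR n + 2) / (INR n - 2).

Definition cond_ii (n : nat) (p q : R) : Prop :=
  (2 < n)%nat /\
  4 / (INR n - 2) < q
    < (4 + sqrt (2 * INR n * (INR n + 2))) / (2 * (INR n - 2)) /\
  q < p <= P n q.

Definition cond_iii (n : nat) (p q : R) : Prop := n = 2%nat /\ 0 < q < p.

Definition open_itv (a : R) (b : Rbar) (r : R) : Prop :=
  a < r /\ Rbar_lt r b.

(** [[a, b]] when [b] is finite, [[a, +oo)] when [b = p_infty]. *)
Definition closed_itv (a : R) (b : Rbar) (r : R) : Prop :=
  a <= r /\ Rbar_le r b.

(** Derivative relative to the set [D]: one-sided at an endpoint of an
    interval, so that values of [u] outside [D] are irrelevant. *)
Definition is_derive_within (D : R -> Prop) (u : R -> R) (r l : R) : Prop :=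
  filterlim (fun s => (u s - u r) / (s - r))
    (within D (locally' r)) (locally l).

Definition C1_on (D : R -> Prop) (u : R -> R) : Prop :=
  exists du : R -> R, forall r, D r ->
    is_derive_within D u r (du r) /\
    filterlim du (within D (locally r)) (locally (du r)).

Definition C2_on_open (D : R -> Prop) (u : R -> R) : Prop :=
  forall r, D r ->
    ex_derive u r /\ ex_derive (Derive u) r /\ continuous (Derive_n u 2) r.

Definition positive_classical_solution
    (n : nat) (f : R -> R) (a : R) (b : Rbar) (u : R -> R) : Prop :=
  C2_on_open (open_itv a b) u /\
  C1_on (closed_itv a b) u /\
  (forall r, open_itv a b r -> 0 < u r) /\
  (forall r, open_itv a b r ->
     Derive_n u 2 r + (INR n - 1) / r * Derive u r + f (u r) = 0).

Definition exterior_solution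
    (n : nat) (f : R -> R) (a : R) (u : R -> R) : Prop :=
  positive_classical_solution n f a p_infty u /\
  u a = 0 /\ is_lim u p_infty 0.

Definition annulus_solution
    (n : nat) (f : R -> R) (a b : R) (u : R -> R) : Prop :=
  positive_classical_solution n f a b u /\ u a = 0 /\ u b = 0.

(** At most one function on [D] satisfies [Sol]; functions on [D] are
    represented by total functions, hence the comparison on [D] only. *)
Definition at_most_one_on (D : R -> Prop) (Sol : (R -> R) -> Prop) : Prop :=
  forall u v, Sol u -> Sol v -> forall r, D r -> u r = v r.

(* Main.v *)
(** Fix two solutions with [u1'(a) < u2'(a)] and describe each by its rising and
    its falling branch, with the height [s = u] as the independent variable;
    [F] is the primitive of [f], with positive zero [beta].

    On the rising branches [r^(2(n-1)) (u'^2 + 2 F)] below [beta] and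
    [(r^(n-1) u')^2] above it keep [u1' < u2'], whence [max u1 < max u2].  Across
    the maximum the conditions (i)-(iii) enter, in the form
    [(F / f)' >= (n - 2) / (2 n)]: they make the Pohozaev functional [J] monotone.
    If [T] is the quotient of the two fluxes [r^(n-1) u'], then in [J1 - T J2] the
    terms with [F / f] cancel and the derivative is [- T' J2]; this gives
    [|u1'| < |u2'|] on the falling branches down to [beta].  Below [beta] the
    functional [r sqrt (u'^2 + 2 F)] carries this on and shows that its value for
    [u2] exceeds the one for [u1] by a fixed amount.

    On an exterior domain the last statement bounds [r |u2'|] from below, so [u2]
    would diverge logarithmically.  On an annulus it leaves only the case
    [u1 < u2].  If [q <= 1], then [f(s)/s] is increasing and the Wronskian of [u1]
    and [u2] gives a contradiction.  If [q > 1], comparing Wronskians on the rising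
    branches shows that the maximum of [u2] is not to the right of that of [u1],
    and a phase plane comparison in Emden-Fowler variables centred at [b] shows
    that it is. *)

Require Import Defs.
From Stdlib Require Import Reals Lra Lia Psatz ClassicalEpsilon.
From Coquelicot Require Import Coquelicot.
Open Scope R_scope.
Set Bullet Behavior "Strict Subproofs".

(** * Continuity, monotonicity and inverse functions *)

(** At equal height two branches share the value [f s], so in differences of slopes or fluxes it
    cancels or enters with a known sign, and only radii and slopes have to be ordered. The price is
    that the slope vanishes at a maximum, where the equation in [s] becomes singular, and that the
    two maxima lie at different heights; the order must be carried across by a functional that stays
    continuous there, which is what [pohozaev] provides. Refuting [v1 a < v2 a] in both orders
    leaves equal initial slopes. For [q < 1] the initial value problem is not Lipschitz at [u = 0];
    the height as variable removes this obstacle too, since [f s] becomes a coefficient common to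
    both solutions. Every maximum lies above [beta] because the energy decreases and cannot become
    negative; this is also why a solution has a single critical point. The constants in (i)-(iii)
    come from a quadratic form: multiplied by [f^2], the inequality for [F / f] is a form in [s^p]
    and [s^q], and the conditions say when its coefficients or its discriminant have the right
    sign. *)

Lemma cont_plus (f g : R -> R) x :
  continuous f x -> continuous g x -> continuous (fun y => f y + g y) x.
Proof. exact (@continuous_plus _ R_AbsRing R_NormedModule f g x). Qed.

Lemma cont_minus (f g : R -> R) x :
  continuous f x -> continuous g x -> continuous (fun y => f y - g y) x.
Proof. exact (@continuous_minus _ R_AbsRing R_NormedModule f g x). Qed.

Lemma cont_opp (f : R -> R) x : continuous f x -> continuous (fun y => - f y) x.
Proof. exact (@continuous_opp _ R_AbsRing R_NormedModule f x). Qed.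

Lemma cont_mult (f g : R -> R) x :
  continuous f x -> continuous g x -> continuous (fun y => f y * g y) x.
Proof. exact (@continuous_mult _ R_AbsRing f g x). Qed.

Lemma cont_inv (f : R -> R) x :
  continuous f x -> f x <> 0 -> continuous (fun y => / f y) x.
Proof.
  intros Hf H0. apply continuity_pt_filterlim.
  apply (continuity_pt_inv f); [ now apply continuity_pt_filterlim | exact H0 ].
Qed.

Lemma cont_pow (f : R -> R) n x :
  continuous f x -> continuous (fun y => f y ^ n) x.
Proof.
  intros Hf; induction n as [|n IH]; simpl.
  - apply continuous_const.
  - now apply cont_mult.
Qed.

Lemma cont_sqrt (f : R -> R) x :
  continuous f x -> continuous (fun y => sqrt (f y)) x.
Proof. intros Hf. apply (continuous_comp f sqrt); [ exact Hf | apply continuous_sqrt ]. Qed.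

Lemma cont_derive (f : R -> R) (x l : R) : is_derive f x l -> continuous f x.
Proof. intros H. apply (ex_derive_continuous f x). now exists l. Qed.

Ltac ctn :=
  lazymatch goal with
  | |- continuous (fun _ => ?c) _ => apply continuous_const
  | |- continuous (fun x => x) _ => apply continuous_id
  | |- continuous (fun x => _ + _) _ => apply cont_plus; ctn
  | |- continuous (fun x => _ - _) _ => apply cont_minus; ctn
  | |- continuous (fun x => - _) _ => apply cont_opp; ctn
  | |- continuous (fun x => _ * _) _ => apply cont_mult; ctn
  | |- continuous (fun x => _ / _) _ => unfold Rdiv; apply cont_mult; ctn
  | |- continuous (fun x => / _) _ => apply cont_inv; [ ctn | ]
  | |- continuous (fun x => _ ^ _) _ => apply cont_pow; ctn
  | |- continuous (fun x => sqrt _) _ => apply cont_sqrt; ctn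
  | |- _ => try eassumption
  end.

Lemma derive_val (f : R -> R) (x l l' : R) : is_derive f x l -> l = l' -> is_derive f x l'.
Proof. now intros H <-. Qed.

Ltac derive_atoms :=
  repeat match goal with
  | |- context [Derive ?g ?x] =>
      match goal with
      | H : is_derive _ x ?l |- _ => rewrite (is_derive_unique g x l H)
      end
  end.


Lemma mean_value (g g' : R -> R) x0 x1 :
  x0 < x1 -> (forall x, x0 <= x <= x1 -> continuous g x) ->
  (forall x, x0 < x < x1 -> is_derive g x (g' x)) ->
  exists c, x0 < c < x1 /\ g x1 - g x0 = g' c * (x1 - x0).
Proof.
  intros Hlt Hc Hd.
  assert (pr1 : forall c, x0 < c < x1 -> derivable_pt g c).
  { intros c H. exists (g' c). apply is_derive_Reals. auto. }
  destruct (MVT g id x0 x1 pr1 (fun c _ => derivable_pt_id c) Hlt) as [c [P E]].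
  - intros c H. apply continuity_pt_filterlim. now apply Hc.
  - intros c H. apply derivable_continuous_pt, derivable_pt_id.
  - exists c; split; [ exact P | ].
    assert (E1 : derive_pt g c (pr1 c P) = g' c).
    { apply derive_pt_eq, is_derive_Reals. auto. }
    assert (E2 : derive_pt id c (derivable_pt_id c) = 1).
    { apply derive_pt_eq, derivable_pt_lim_id. }
    rewrite E1, E2 in E. unfold id in E. lra.
Qed.

Lemma le_of_deriv (g g' : R -> R) x0 x1 :
  x0 <= x1 -> (forall x, x0 <= x <= x1 -> continuous g x) ->
  (forall x, x0 < x < x1 -> is_derive g x (g' x)) ->
  (forall x, x0 < x < x1 -> 0 <= g' x) -> g x0 <= g x1.
Proof.
  intros Hle Hc Hd Hp. destruct (Req_dec x0 x1) as [->|Hne]; [ lra | ].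
  destruct (mean_value g g' x0 x1) as [c [P E]]; auto; [ lra | ].
  specialize (Hp c P). nra.
Qed.

Lemma lt_of_deriv (g g' : R -> R) x0 x1 :
  x0 < x1 -> (forall x, x0 <= x <= x1 -> continuous g x) ->
  (forall x, x0 < x < x1 -> is_derive g x (g' x)) ->
  (forall x, x0 < x < x1 -> 0 < g' x) -> g x0 < g x1.
Proof.
  intros Hlt Hc Hd Hp.
  destruct (mean_value g g' x0 x1) as [c [P E]]; auto.
  specialize (Hp c P). nra.
Qed.

Lemma continuous_pos_locally (h : R -> R) x :
  continuous h x -> 0 < h x ->
  exists e, 0 < e /\ forall y, Rabs (y - x) < e -> 0 < h y.
Proof.
  intros Hc Hp. apply filterlim_locally with (eps := mkposreal _ Hp) in Hc.
  destruct Hc as [e He]. exists e; split; [ apply cond_pos | ].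
  intros y Hy. specialize (He y Hy).
  change (Rabs (h y - h x) < h x) in He. apply Rabs_def2 in He. lra.
Qed.

(** Strict inequalities are later proved by refuting a first point of equality. If positivity
    failed, the supremum of the points up to which [h] is positive would be such a point, by
    continuity. *)
Lemma first_crossing (h : R -> R) x0 x1 :
  (forall x, x0 <= x < x1 -> continuous h x) -> 0 < h x0 ->
  (forall y, x0 < y < x1 -> h y = 0 -> (forall x, x0 <= x < y -> 0 < h x) -> False) ->
  forall x, x0 <= x < x1 -> 0 < h x.
Proof.
  intros Hc H0 Hcross z Hz. destruct (Rlt_le_dec 0 (h z)) as [|Hn]; [ assumption | exfalso ].
  set (E := fun x => x0 <= x <= z /\ forall y, x0 <= y <= x -> 0 < h y).
  destruct (completeness E) as [m [Hub Hlub]].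
  - exists z. intros x [Hx _]; lra.
  - exists x0. split; [ lra | ]. intros y Hy. now replace y with x0 by lra.
  - assert (Hm0 : x0 <= m).
    { apply Hub. split; [ lra | ]. intros y Hy. now replace y with x0 by lra. }
    assert (Hmz : m <= z) by (apply Hlub; intros x [Hx _]; lra).
    assert (Hbelow : forall x, x0 <= x < m -> 0 < h x).
    { intros x Hx. apply NNPP. intros Hnot.
      assert (m <= x); [ | lra ]. apply Hlub. intros e [He1 He2].
      destruct (Rle_lt_dec e x); [ assumption | exfalso ].
      apply Hnot, He2; lra. }
    destruct (Rlt_le_dec 0 (h m)) as [Hpos|Hneg].
    + destruct (continuous_pos_locally h m) as [e [He Hloc]];
        [ apply Hc; lra | exact Hpos | ].
      assert (m <> z) by (intros ->; lra).
      set (m' := Rmin z (m + e / 2)).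
      assert (m < m' <= m + e / 2 /\ m' <= z).
      { unfold m'. generalize (Rmin_l z (m + e/2)) (Rmin_r z (m + e/2)).
        intros; repeat split; try lra. apply Rmin_glb_lt; lra. }
      assert (m' <= m); [ | lra ]. apply Hub. split; [ lra | ].
      intros y Hy. destruct (Rlt_le_dec y m); [ apply Hbelow; lra | ].
      apply Hloc. apply Rabs_def1; lra.
    + assert (Hmne : m <> x0) by (intros ->; lra).
      apply (Hcross m); [ lra | | exact Hbelow ].
      destruct (Req_dec (h m) 0) as [|Hm]; [ assumption | exfalso ].
      destruct (continuous_pos_locally (fun x => - h x) m) as [e [He Hloc]].
      * apply cont_opp, Hc; lra.
      * lra.
      * set (y := Rmax x0 (m - e / 2)).
        assert (x0 <= y < m /\ m - e/2 <= y).
        { unfold y. generalize (Rmax_l x0 (m - e/2)) (Rmax_r x0 (m - e/2)).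
          intros; repeat split; try lra. apply Rmax_lub_lt; lra. }
        specialize (Hbelow y ltac:(lra)).
        assert (0 < - h y) by (apply Hloc, Rabs_def1; lra). lra.
Qed.

Lemma continuous_reflect (h : R -> R) x :
  continuous h (- x) -> continuous (fun y => h (- y)) x.
Proof.
  intros H. apply (continuous_comp Ropp h); [ | exact H ].
  apply cont_opp, continuous_id.
Qed.

Lemma first_crossing_left (h : R -> R) x0 x1 :
  (forall x, x0 < x <= x1 -> continuous h x) -> 0 < h x1 ->
  (forall y, x0 < y < x1 -> h y = 0 -> (forall x, y < x <= x1 -> 0 < h x) -> False) ->
  forall x, x0 < x <= x1 -> 0 < h x.
Proof.
  intros Hc H1 Hcross x Hx.
  replace x with (- (- x)) by ring.
  apply (first_crossing (fun y => h (- y)) (- x1) (- x0)).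
  - intros y Hy. apply continuous_reflect, Hc. lra.
  - now rewrite Ropp_involutive.
  - intros y Hy H0 Hpos. apply (Hcross (- y)); [ lra | exact H0 | ].
    intros z Hz. replace z with (- (- z)) by ring. apply Hpos. lra.
  - lra.
Qed.

Lemma derive_pos_right (h : R -> R) (x l : R) :
  is_derive h x l -> 0 < l ->
  exists e, 0 < e /\ (forall y, x < y < x + e -> h x < h y) /\
            (forall y, x - e < y < x -> h y < h x).
Proof.
  intros Hd Hl. apply is_derive_Reals in Hd.
  destruct (Hd l Hl) as [e He]. exists e. split; [ apply cond_pos | ].
  assert (K : forall y, Rabs (y - x) < e -> y <> x -> 0 < (h y - h x) / (y - x)).
  { intros y Hy Hne. specialize (He (y - x) ltac:(lra) Hy).
    replace (x + (y - x)) with y in He by ring. apply Rabs_def2 in He. lra. }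
  split; intros y Hy.
  - assert (0 < (h y - h x) / (y - x)) by (apply K; [ apply Rabs_def1; lra | lra ]).
    assert (h y - h x = (h y - h x) / (y - x) * (y - x)) by (field; lra). nra.
  - assert (0 < (h y - h x) / (y - x)) by (apply K; [ apply Rabs_def1; lra | lra ]).
    assert (h y - h x = (h y - h x) / (y - x) * (y - x)) by (field; lra). nra.
Qed.

Lemma derive_nonneg_at_zero (h : R -> R) (y x1 l : R) :
  y < x1 -> h y = 0 -> (forall x, y < x < x1 -> 0 < h x) -> is_derive h y l -> 0 <= l.
Proof.
  intros Hlt H0 Hp Hd. destruct (Rle_lt_dec 0 l) as [|Hl]; [ assumption | exfalso ].
  destruct (derive_pos_right (fun x => - h x) y (- l)) as [e [He [Hr _]]].
  - apply (is_derive_opp h y l Hd).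
  - lra.
  - set (z := Rmin (y + e / 2) ((y + x1) / 2)).
    assert (y < z < y + e /\ z < x1).
    { unfold z. generalize (Rmin_l (y + e/2) ((y + x1)/2)) (Rmin_r (y + e/2) ((y + x1)/2)).
      intros; repeat split; try lra. apply Rmin_glb_lt; lra. }
    specialize (Hr z ltac:(lra)). specialize (Hp z ltac:(lra)). simpl in Hr. lra.
Qed.

(** At a zero the derivative is negative, so [g] can pass zero only downwards; starting at a zero is
    allowed. *)
Lemma stays_negative (g g' : R -> R) x0 x1 :
  (forall x, x0 <= x < x1 -> is_derive g x (g' x)) ->
  (forall x, x0 <= x < x1 -> g x = 0 -> g' x < 0) ->
  g x0 <= 0 -> forall x, x0 < x < x1 -> g x < 0.
Proof.
  intros Hd Hz H0.
  assert (Hgo : forall y, x0 <= y < x1 -> g y < 0 -> forall x, y <= x < x1 -> g x < 0).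
  { intros y Hy Hgy x Hx.
    assert (0 < - g x); [ | lra ].
    apply (first_crossing (fun x => - g x) y x1).
    - intros w Hw. apply cont_opp, (cont_derive g w (g' w)), Hd. lra.
    - lra.
    - intros w Hw Hgw Hpos.
      assert (Hgw0 : g w = 0) by lra. specialize (Hz w ltac:(lra) Hgw0).
      destruct (derive_pos_right (fun x => - g x) w (- g' w)) as [e [He [_ Hl]]].
      + apply (is_derive_opp g w (g' w)), Hd. lra.
      + lra.
      + set (v := Rmax (w - e / 2) y).
        assert (w - e < v < w /\ y <= v).
        { unfold v. generalize (Rmax_l (w - e/2) y) (Rmax_r (w - e/2) y).
          intros; repeat split; try lra. apply Rmax_lub_lt; lra. }
        specialize (Hl v ltac:(lra)). specialize (Hpos v ltac:(lra)). simpl in *. lra.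
    - exact Hx. }
  intros x Hx. destruct (Req_dec (g x0) 0) as [E|E].
  - specialize (Hz x0 ltac:(lra) E).
    destruct (derive_pos_right (fun x => - g x) x0 (- g' x0)) as [e [He [Hr _]]].
    + apply (is_derive_opp g x0 (g' x0)), Hd. lra.
    + lra.
    + set (y := Rmin (x0 + e / 2) x).
      assert (x0 < y < x0 + e /\ y <= x).
      { unfold y. generalize (Rmin_l (x0 + e/2) x) (Rmin_r (x0 + e/2) x).
        intros; repeat split; try lra. apply Rmin_glb_lt; lra. }
      specialize (Hr y ltac:(lra)). simpl in Hr.
      apply (Hgo y); lra.
  - apply (Hgo x0); lra.
Qed.

(** Meant for a squared distance [N], for which the conclusion forces coincidence:
    [exp (- C * x) * N x] is nonincreasing. *)
Lemma gronwall (N N' : R -> R) C x0 x1 :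
  x0 <= x1 -> (forall x, x0 <= x <= x1 -> continuous N x) ->
  (forall x, x0 < x < x1 -> is_derive N x (N' x)) ->
  (forall x, x0 < x < x1 -> N' x <= C * N x) -> N x0 = 0 -> N x1 <= 0.
Proof.
  intros Hle Hc Hd Hb H0.
  assert (Hexp : forall x, is_derive (fun x => exp (- C * x)) x (- C * exp (- C * x))).
  { intros x. auto_derive; [ trivial | ring ]. }
  assert (K : - (exp (- C * x0) * N x0) <= - (exp (- C * x1) * N x1)).
  { apply (le_of_deriv (fun x => - (exp (- C * x) * N x))
             (fun x => exp (- C * x) * (C * N x - N' x)) x0 x1 Hle).
    - intros x Hx. apply cont_opp, cont_mult; [ | auto ].
      apply (cont_derive _ _ _ (Hexp x)).
    - intros x Hx. specialize (Hd x Hx).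
      auto_derive; [ now exists (N' x) | ]. derive_atoms. ring.
    - intros x Hx. apply Rmult_le_pos; [ left; apply exp_pos | ].
      specialize (Hb x Hx). lra. }
  rewrite H0 in K. generalize (exp_pos (- C * x1)). nra.
Qed.

Lemma gronwall_left (N N' : R -> R) C x0 x1 :
  x0 <= x1 -> (forall x, x0 <= x <= x1 -> continuous N x) ->
  (forall x, x0 < x < x1 -> is_derive N x (N' x)) ->
  (forall x, x0 < x < x1 -> - N' x <= C * N x) -> N x1 = 0 -> N x0 <= 0.
Proof.
  intros Hle Hc Hd Hb H0.
  replace x0 with (- (- x0)) by ring.
  apply (gronwall (fun x => N (- x)) (fun x => - N' (- x)) C (- x1) (- x0)).
  - lra.
  - intros x Hx. apply continuous_reflect, Hc. lra.
  - intros x Hx. specialize (Hd (- x) ltac:(lra)).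
    auto_derive; [ now exists (N' (- x)) | ]. derive_atoms. ring.
  - intros x Hx. apply Hb. lra.
  - now rewrite Ropp_involutive.
Qed.

(** [epsilon] leaves [k] arbitrary off the range of [h], so everything is stated at points [h x]; by
    the intermediate value theorem the range contains a neighbourhood of each of them. *)
Lemma inverse_of_increasing (h : R -> R) :
  (forall x, continuous h x) -> (forall x y, x < y -> h x < h y) ->
  exists k : R -> R,
    (forall x, k (h x) = x) /\ (forall x, continuous k (h x)) /\
    (forall x l : R, is_derive h x l -> l <> 0 -> is_derive k (h x) (/ l)).
Proof.
  intros Hc Hm.
  set (k := fun s => epsilon (inhabits 0) (fun x => h x = s)).
  assert (Hhk : forall x, h (k (h x)) = h x).
  { intros x. apply (epsilon_spec (inhabits 0) (fun y => h y = h x)). now exists x. }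
  assert (Hkh : forall x, k (h x) = x).
  { intros x. destruct (Rtotal_order (k (h x)) x) as [H|[H|H]]; [ | exact H | ];
      apply Hm in H; rewrite Hhk in H; lra. }
  assert (Hcont : forall x e, 0 < e -> exists d, 0 < d /\ forall s, Rabs (s - h x) < d ->
            h (k s) = s /\ Rabs (k s - x) < e).
  { intros x e He.
    assert (H1 := Hm (x - e / 2) x ltac:(lra)). assert (H2 := Hm x (x + e / 2) ltac:(lra)).
    exists (Rmin (h x - h (x - e/2)) (h (x + e/2) - h x)). split; [ apply Rmin_glb_lt; lra | ].
    intros s Hs.
    assert (H3 := Rmin_l (h x - h (x - e/2)) (h (x + e/2) - h x)).
    assert (H4 := Rmin_r (h x - h (x - e/2)) (h (x + e/2) - h x)).
    apply Rabs_def2 in Hs.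
    destruct (IVT_gen h (x - e/2) (x + e/2) s) as [y [Hy Ey]].
    - intros z. apply continuity_pt_filterlim, Hc.
    - rewrite Rmin_left, Rmax_right; lra.
    - rewrite Rmin_left, Rmax_right in Hy by lra. rewrite <- Ey, Hkh.
      split; [ reflexivity | apply Rabs_def1; lra ]. }
  exists k. split; [ exact Hkh | split ].
  - intros x. apply filterlim_locally. intros eps.
    destruct (Hcont x eps (cond_pos eps)) as [d [Hd H]].
    exists (mkposreal d Hd). intros s Hs. rewrite Hkh. apply (H s Hs).
  - intros x l Hl Hl0. apply is_derive_Reals. apply is_derive_Reals in Hl.
    intros e He.
    assert (Hal : 0 < Rabs l) by now apply Rabs_pos_lt.
    (* The first bound keeps the difference quotient [Q] of size at least [Rabs l / 2]; with it the
       second makes [/ Q] differ from [/ l] by less than [e]. *)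
    set (e1 := Rmin (Rabs l / 2) (e * (Rabs l * Rabs l) / 4)).
    assert (He1 : 0 < e1).
    { apply Rmin_glb_lt; [ lra | ]. apply Rmult_lt_0_compat; [ | lra ].
      apply Rmult_lt_0_compat; [ lra | nra ]. }
    assert (He1a := Rmin_l (Rabs l / 2) (e * (Rabs l * Rabs l) / 4)). fold e1 in He1a.
    assert (He1b := Rmin_r (Rabs l / 2) (e * (Rabs l * Rabs l) / 4)). fold e1 in He1b.
    destruct (Hl e1 He1) as [d1 Hd1].
    destruct (Hcont x d1 (cond_pos d1)) as [d [Hd H]].
    exists (mkposreal d Hd). intros t Ht0 Ht. simpl in Ht.
    destruct (H (h x + t)) as [Ek Hk].
    { now replace (h x + t - h x) with t by ring. }
    set (y := k (h x + t)) in *. rewrite Hkh.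
    assert (Hyx : y - x <> 0).
    { intros E. replace y with x in Ek by lra. lra. }
    specialize (Hd1 (y - x) Hyx Hk). replace (x + (y - x)) with y in Hd1 by ring.
    rewrite Ek in Hd1. replace (h x + t - h x) with t in Hd1 by ring.
    set (Q := t / (y - x)) in *.
    assert (HQ : Rabs l / 2 < Rabs Q).
    { generalize (Rabs_triang (Q) (l - Q)). replace (Q + (l - Q)) with l by ring.
      rewrite (Rabs_minus_sym l Q). lra. }
    assert (HQ0 : Q <> 0) by (intros E; rewrite E, Rabs_R0 in HQ; lra).
    replace ((y - x) / t - / l) with ((l - Q) / (Q * l)).
    2:{ unfold Q. field. repeat split; try assumption. }
    unfold Rdiv. rewrite Rabs_mult, Rabs_inv, Rabs_mult, Rabs_minus_sym.
    apply Rmult_lt_reg_r with (Rabs Q * Rabs l); [ nra | ].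
    rewrite Rmult_assoc, Rinv_l, Rmult_1_r by nra. nra.
Qed.

Lemma inverse_of_decreasing (h : R -> R) :
  (forall x, continuous h x) -> (forall x y, x < y -> h y < h x) ->
  exists k : R -> R,
    (forall x, k (h x) = x) /\ (forall x, continuous k (h x)) /\
    (forall x l : R, is_derive h x l -> l <> 0 -> is_derive k (h x) (/ l)).
Proof.
  intros Hc Hm.
  destruct (inverse_of_increasing (fun x => - h x)) as [k [H1 [H2 H3]]].
  - intros x. now apply cont_opp.
  - intros x y H. apply Hm in H. lra.
  - exists (fun s => k (- s)). split; [ exact H1 | split ].
    + intros x. now apply continuous_reflect.
    + intros x l Hl Hl0. specialize (H3 x (- l) (is_derive_opp h x l Hl) ltac:(lra)).
      simpl in H3.
      auto_derive; [ now exists (/ - l) | ]. derive_atoms. field. exact Hl0.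
Qed.

(** * The nonlinearity *)

Lemma rpow_eq s e : 0 < s -> rpow s e = exp (e * ln s).
Proof. intros Hs. unfold rpow. destruct (Rlt_dec 0 s); [ reflexivity | lra ]. Qed.

Lemma rpow_neg s e : s <= 0 -> rpow s e = 0.
Proof. intros Hs. unfold rpow. destruct (Rlt_dec 0 s); [ lra | reflexivity ]. Qed.

Lemma rpow_pos s e : 0 < s -> 0 < rpow s e.
Proof. intros Hs. rewrite rpow_eq by exact Hs. apply exp_pos. Qed.

Lemma rpow_nonneg s e : 0 <= rpow s e.
Proof.
  destruct (Rlt_le_dec 0 s).
  - left. now apply rpow_pos.
  - rewrite rpow_neg; lra.
Qed.

Lemma rpow_1_l e : rpow 1 e = 1.
Proof. rewrite rpow_eq by lra. now rewrite ln_1, Rmult_0_r, exp_0. Qed.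

Lemma rpow_1_r s : 0 < s -> rpow s 1 = s.
Proof. intros Hs. rewrite rpow_eq, Rmult_1_l by exact Hs. now apply exp_ln. Qed.

Lemma rpow_plus s e e' : 0 < s -> rpow s (e + e') = rpow s e * rpow s e'.
Proof. intros Hs. rewrite !rpow_eq, <- exp_plus by exact Hs. f_equal. ring. Qed.

Lemma rpow_mult s e e' : 0 < s -> rpow (rpow s e) e' = rpow s (e * e').
Proof.
  intros Hs. rewrite (rpow_eq (rpow s e)), !rpow_eq by (try apply rpow_pos; exact Hs).
  rewrite ln_exp. f_equal. ring.
Qed.

Lemma rpow_mult_l s t e : 0 < s -> 0 < t -> rpow (s * t) e = rpow s e * rpow t e.
Proof.
  intros Hs Ht. rewrite !rpow_eq, ln_mult, <- exp_plus by nra. f_equal. ring.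
Qed.

Lemma rpow_lt s t e : 0 <= s -> s < t -> 0 < e -> rpow s e < rpow t e.
Proof.
  intros Hs Ht He. destruct (Req_dec s 0) as [->|].
  - rewrite (rpow_neg 0) by lra. apply rpow_pos; lra.
  - rewrite !rpow_eq by lra. apply exp_increasing, Rmult_lt_compat_l; [ exact He | ].
    apply ln_increasing; lra.
Qed.

Lemma rpow_le s t e : 0 <= s -> s <= t -> 0 <= e -> rpow s e <= rpow t e.
Proof.
  intros Hs Hst He. destruct (Req_dec s 0) as [->|].
  - rewrite (rpow_neg 0) by lra. apply rpow_nonneg.
  - rewrite !rpow_eq by lra. destruct (Req_dec s t) as [->|]; [ lra | ].
    assert (ln s < ln t) by (apply ln_increasing; lra).
    destruct (Req_dec (e * ln s) (e * ln t)) as [->|]; [ lra | ].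
    left. apply exp_increasing. nra.
Qed.

Lemma rpow_derive s e : 0 < s -> is_derive (fun x => rpow x e) s (e * rpow s (e - 1)).
Proof.
  intros Hs.
  apply (is_derive_ext_loc (fun x => exp (e * ln x))).
  - exists (mkposreal s Hs). intros y Hy. change (Rabs (y - s) < s) in Hy.
    apply Rabs_def2 in Hy. rewrite rpow_eq; [ reflexivity | lra ].
  - auto_derive; [ exact Hs | ].
    rewrite rpow_eq by exact Hs. replace ((e - 1) * ln s) with (e * ln s - ln s) by ring.
    unfold Rminus at 1. rewrite exp_plus, exp_Ropp, exp_ln by exact Hs. field. lra.
Qed.

Lemma rpow_continuous s e : 0 < e -> continuous (fun x => rpow x e) s.
Proof.
  intros He. destruct (Rlt_le_dec 0 s) as [Hs|Hs].
  - apply (cont_derive _ _ _ (rpow_derive s e Hs)).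
  - apply filterlim_locally. intros eps.
    assert (Hd : 0 < rpow eps (/ e)) by apply rpow_pos, cond_pos.
    exists (mkposreal _ Hd). intros y Hy. change (Rabs (y - s) < rpow eps (/ e)) in Hy.
    change (Rabs (rpow y e - rpow s e) < eps). rewrite (rpow_neg s) by exact Hs.
    rewrite Rminus_0_r, Rabs_right by (apply Rle_ge, rpow_nonneg).
    destruct (Rlt_le_dec 0 y) as [Hy0|Hy0].
    + apply Rabs_def2 in Hy.
      replace (pos eps) with (rpow (rpow eps (/ e)) e).
      * apply rpow_lt; lra.
      * rewrite rpow_mult by apply cond_pos. rewrite Rinv_l by lra.
        apply rpow_1_r, cond_pos.
    + rewrite rpow_neg by exact Hy0. apply cond_pos.
Qed.

Definition prim (p q s : R) : R := rpow s (p + 1) / (p + 1) - rpow s (q + 1) / (q + 1).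

(** The positive root of [s^(p-q) = (p+1)/(q+1)], the equation that remains when [s^(q+1)] is split
    off from [prim]. *)
Definition zero_of_prim (p q : R) : R := rpow ((p + 1) / (q + 1)) (/ (p - q)).

Section Nonlinearity.
Context (p q : R) (hq : 0 < q) (hpq : q < p).

Lemma nonlin_continuous s : continuous (nonlin p q) s.
Proof. unfold nonlin. apply cont_minus; apply rpow_continuous; lra. Qed.

Lemma prim_continuous s : continuous (prim p q) s.
Proof.
  unfold prim, Rdiv.
  apply cont_minus; apply cont_mult; try apply continuous_const; apply rpow_continuous; lra.
Qed.

Lemma prim_derive s : 0 < s -> is_derive (prim p q) s (nonlin p q s).
Proof.
  intros Hs. unfold prim, nonlin.
  assert (H1 := rpow_derive s (p + 1) Hs). assert (H2 := rpow_derive s (q + 1) Hs).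
  replace (p + 1 - 1) with p in H1 by ring. replace (q + 1 - 1) with q in H2 by ring.
  auto_derive.
  - split; [ eexists; exact H1 | split; [ eexists; exact H2 | trivial ] ].
  - derive_atoms. field. lra.
Qed.

Lemma prim_0 : prim p q 0 = 0.
Proof. unfold prim. rewrite !rpow_neg by lra. field. lra. Qed.

Lemma nonlin_pos s : 1 < s -> 0 < nonlin p q s.
Proof.
  intros Hs. unfold nonlin. replace p with (q + (p - q)) by ring.
  rewrite rpow_plus by lra.
  assert (H1 := rpow_pos s q ltac:(lra)).
  assert (H2 := rpow_lt 1 s (p - q) ltac:(lra) ltac:(lra) ltac:(lra)).
  rewrite rpow_1_l in H2. nra.
Qed.

Lemma prim_factor s : 0 < s ->
  prim p q s = rpow s (q + 1) * (rpow s (p - q) - (p + 1) / (q + 1)) / (p + 1).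
Proof.
  intros Hs. unfold prim. replace (p + 1) with ((q + 1) + (p - q)) at 1 by ring.
  rewrite rpow_plus by exact Hs. field. lra.
Qed.

Local Notation beta := (zero_of_prim p q).

Lemma ratio_gt_1 : 1 < (p + 1) / (q + 1).
Proof. apply Rmult_lt_reg_r with (q + 1); [ lra | ]. unfold Rdiv. rewrite Rmult_assoc, Rinv_l; lra. Qed.

Lemma beta_gt_1 : 1 < beta.
Proof.
  unfold zero_of_prim.
  assert (H := rpow_lt 1 ((p + 1) / (q + 1)) (/ (p - q))). rewrite rpow_1_l in H.
  apply H; [ lra | apply ratio_gt_1 | apply Rinv_0_lt_compat; lra ].
Qed.

Lemma rpow_beta : rpow beta (p - q) = (p + 1) / (q + 1).
Proof.
  generalize ratio_gt_1; intros H.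
  unfold zero_of_prim. rewrite rpow_mult by lra. rewrite Rinv_l by lra. apply rpow_1_r. lra.
Qed.

Lemma prim_le_0 s : 0 <= s <= beta -> prim p q s <= 0.
Proof.
  intros Hs. destruct (Req_dec s 0) as [->|]; [ rewrite prim_0; lra | ].
  rewrite prim_factor by lra.
  assert (H1 := rpow_pos s (q + 1) ltac:(lra)).
  assert (H2 := rpow_le s beta (p - q) ltac:(lra) ltac:(lra) ltac:(lra)).
  rewrite rpow_beta in H2. assert (0 < / (p + 1)) by (apply Rinv_0_lt_compat; lra).
  unfold Rdiv at 1. assert (0 < rpow s (q + 1) * / (p + 1)) by nra. nra.
Qed.

Lemma prim_neg s : 0 < s < beta -> prim p q s < 0.
Proof.
  intros Hs. rewrite prim_factor by lra.
  assert (H1 := rpow_pos s (q + 1) ltac:(lra)).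
  assert (H2 := rpow_lt s beta (p - q) ltac:(lra) ltac:(lra) ltac:(lra)).
  rewrite rpow_beta in H2. assert (0 < / (p + 1)) by (apply Rinv_0_lt_compat; lra).
  unfold Rdiv at 1. assert (0 < rpow s (q + 1) * / (p + 1)) by nra. nra.
Qed.

Lemma prim_pos s : beta < s -> 0 < prim p q s.
Proof.
  intros Hs. assert (Hb := beta_gt_1). rewrite prim_factor by lra.
  assert (H1 := rpow_pos s (q + 1) ltac:(lra)).
  assert (H2 := rpow_lt beta s (p - q) ltac:(lra) ltac:(lra) ltac:(lra)).
  rewrite rpow_beta in H2. assert (0 < / (p + 1)) by (apply Rinv_0_lt_compat; lra).
  unfold Rdiv at 1. assert (0 < rpow s (q + 1) * / (p + 1)) by nra. nra.
Qed.

Lemma prim_beta : prim p q beta = 0.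
Proof.
  assert (Hb := beta_gt_1). rewrite prim_factor, rpow_beta by lra. field. lra.
Qed.

End Nonlinearity.

(** * The structural inequality and the exponent conditions *)

Definition dnonlin (p q s : R) : R := p * rpow s (p - 1) - q * rpow s (q - 1).

Lemma nonlin_derive p q s : 0 < s -> is_derive (nonlin p q) s (dnonlin p q s).
Proof.
  intros Hs. unfold nonlin, dnonlin.
  assert (H1 := rpow_derive s p Hs). assert (H2 := rpow_derive s q Hs).
  auto_derive.
  - split; [ eexists; exact H1 | split; [ eexists; exact H2 | trivial ] ].
  - derive_atoms. ring.
Qed.

(** The inequality [(F / f)' >= (n - 2) / (2 n)] cleared of denominators. *)
Definition subcritical (p q N : R) : Prop :=
  forall s, 0 < s ->
  0 <= 2 * N * (nonlin p q s ^ 2 - prim p q s * dnonlin p q s) - (N - 2) * nonlin p q s ^ 2.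

Lemma quadratic_form_nonneg A B C X Y :
  0 <= A -> 0 <= C -> (0 <= B \/ B ^ 2 <= 4 * A * C) -> 0 < X -> 0 < Y ->
  0 <= A * X ^ 2 + B * (X * Y) + C * Y ^ 2.
Proof.
  intros HA HC [HB|HB] HX HY.
  - assert (0 <= A * X ^ 2) by (apply Rmult_le_pos; nra).
    assert (0 <= C * Y ^ 2) by (apply Rmult_le_pos; nra).
    assert (0 <= B * (X * Y)) by (apply Rmult_le_pos; nra). lra.
  - destruct (Req_dec A 0) as [->|HA0].
    + assert (B = 0) by nra. subst. nra.
    + apply Rmult_le_reg_l with (4 * A); [ lra | ].
      assert (0 <= (2 * A * X + B * Y) ^ 2) by apply pow2_ge_0.
      assert (0 <= (4 * A * C - B ^ 2) * Y ^ 2) by (apply Rmult_le_pos; [ lra | apply pow2_ge_0 ]).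
      nra.
Qed.

(** The two alternatives in the last hypothesis are [A + C >= 1 / (x y)] and
    [B^2 <= 4 A C] for the quadratic form [A, B, C] in [s^p], [s^q]. *)
Lemma subcritical_of_quadratic p q N x y :
  0 < q -> q < p -> 2 <= N -> x = p + 1 -> y = q + 1 ->
  0 <= 2 * N - (N - 2) * x -> 0 <= 2 * N - (N - 2) * y ->
  (N * (x + y - 1) >= (N - 2) * x * y \/
   N * (x + y - 1) ^ 2 <= 2 * (N + 2) * x * y) ->
  subcritical p q N.
Proof.
  intros hq hpq hN -> -> hx hy hcond s Hs.
  set (x := p + 1) in *. set (y := q + 1) in *.
  set (nu := (N - 2) / (2 * N)).
  set (A := / x - nu). set (C := / y - nu). set (D := (x - y) ^ 2 / (x * y)).
  set (B := D - (A + C)).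
  assert (Hx : 0 < x) by (unfold x; lra). assert (Hy : 0 < y) by (unfold y; lra).
  assert (Hxy : 0 < x * y) by nra.
  assert (HA : 0 <= A).
  { unfold A, nu. replace (/ x - (N - 2) / (2 * N)) with ((2 * N - (N - 2) * x) * / (2 * N * x))
      by (field; lra). apply Rmult_le_pos; [ exact hx | ].
    left. apply Rinv_0_lt_compat. nra. }
  assert (HC : 0 <= C).
  { unfold C, nu. replace (/ y - (N - 2) / (2 * N)) with ((2 * N - (N - 2) * y) * / (2 * N * y))
      by (field; lra). apply Rmult_le_pos; [ exact hy | ].
    left. apply Rinv_0_lt_compat. nra. }
  assert (HD : 0 < D).
  { unfold D. apply Rdiv_lt_0_compat; [ | exact Hxy ].
    assert (0 < x - y) by (unfold x, y; lra). nra. }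
  (* This uses [(A - C)^2 = D / (x y)]. *)
  assert (Hdisc : B ^ 2 - 4 * A * C = D * (D - 2 * (A + C) + / (x * y))).
  { unfold B, D, A, C. field. lra. }
  assert (HBC : 0 <= B \/ B ^ 2 <= 4 * A * C).
  { destruct (Rle_lt_dec 0 B) as [|HB]; [ now left | right ].
    assert (D - 2 * (A + C) + / (x * y) <= 0); [ | nra ].
    destruct hcond as [h|h].
    - assert (/ (x * y) <= A + C).
      { apply Rminus_le_0. unfold A, C, nu.
        replace (/ x - (N - 2) / (2 * N) + (/ y - (N - 2) / (2 * N)) - / (x * y))
          with ((N * (x + y - 1) - (N - 2) * x * y) * / (N * (x * y))) by (field; lra).
        apply Rmult_le_pos; [ lra | left; apply Rinv_0_lt_compat; nra ]. }
      unfold B in HB. lra.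
    - unfold D, A, C, nu.
      replace ((x - y) ^ 2 / (x * y) -
         2 * (/ x - (N - 2) / (2 * N) + (/ y - (N - 2) / (2 * N))) + / (x * y))
        with (- ((2 * (N + 2) * x * y - N * (x + y - 1) ^ 2) * / (N * (x * y)))) by (field; lra).
      apply Ropp_le_cancel. rewrite Ropp_0, Ropp_involutive.
      apply Rmult_le_pos; [ lra | left; apply Rinv_0_lt_compat; nra ]. }
  assert (HQ := quadratic_form_nonneg A B C (rpow s p) (rpow s q) HA HC HBC
                  (rpow_pos s p Hs) (rpow_pos s q Hs)).
  apply (Rmult_le_compat_l (2 * N)) in HQ; [ | lra ]. rewrite Rmult_0_r in HQ.
  unfold nonlin, prim, dnonlin. fold x y.
  assert (E1 : rpow s x = rpow s p * s).
  { unfold x. rewrite rpow_plus, rpow_1_r by exact Hs. ring. }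
  assert (E2 : rpow s y = rpow s q * s).
  { unfold y. rewrite rpow_plus, rpow_1_r by exact Hs. ring. }
  assert (E3 : rpow s (p - 1) = rpow s p / s).
  { replace (rpow s p) with (rpow s (p - 1) * s); [ field; lra | ].
    rewrite <- (rpow_1_r s Hs) at 2. rewrite <- rpow_plus by exact Hs. f_equal. ring. }
  assert (E4 : rpow s (q - 1) = rpow s q / s).
  { replace (rpow s q) with (rpow s (q - 1) * s); [ field; lra | ].
    rewrite <- (rpow_1_r s Hs) at 2. rewrite <- rpow_plus by exact Hs. f_equal. ring. }
  rewrite E1, E2, E3, E4. eapply Rle_trans; [ exact HQ | right ].
  unfold B, D, A, C, nu, x, y. field. lra.
Qed.

(** Put [x = p + 1], [y = q + 1]. Condition (i) gives the first alternative of
    [subcritical_of_quadratic]: it is linear in [p], and equality holds at the corner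
    [p = (n+2)/(n-2)], [q = 4/(n-2)]. Condition (ii) gives the second: equality there is a quadratic
    equation for [p] with larger root [P n q]. For [n = 2] the first alternative is just
    [x + y >= 1]. *)
Lemma cond_subcritical n p q : (2 <= n)%nat -> 0 < q -> q < p ->
  (cond_i n p q \/ cond_ii n p q \/ cond_iii n p q) -> subcritical p q (INR n).
Proof.
  intros hn hq hpq hcond.
  assert (hN : 2 <= INR n) by (change 2 with (INR 2); now apply le_INR).
  set (N := INR n) in *.
  destruct hcond as [h|[h|h]].
  - destruct h as [h2 [[_ h3] [_ h4]]].
    assert (h5 : 2 < N) by (unfold N; change 2 with (INR 2); now apply lt_INR).
    fold N in h3, h4.
    assert (h3' : q * (N - 2) <= 4).
    { apply (Rmult_le_compat_r (N - 2)) in h3; [ | lra ].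
      unfold Rdiv in h3. rewrite Rmult_assoc, Rinv_l in h3; lra. }
    assert (h4' : p * (N - 2) <= N + 2).
    { apply (Rmult_le_compat_r (N - 2)) in h4; [ | lra ].
      unfold Rdiv in h4. rewrite Rmult_assoc, Rinv_l in h4; lra. }
    apply (subcritical_of_quadratic p q N (p + 1) (q + 1)); try lra; try nra.
  - destruct h as [h2 [[h3 h3b] [_ h4]]].
    assert (h5 : 2 < N) by (unfold N; change 2 with (INR 2); now apply lt_INR).
    unfold P in h4. fold N in h3, h3b, h4.
    assert (h3' : 4 < q * (N - 2)).
    { apply (Rmult_lt_compat_r (N - 2)) in h3; [ | lra ].
      unfold Rdiv in h3. rewrite Rmult_assoc, Rinv_l in h3; lra. }
    (* The upper bound on [q] in (ii) is the solution of [P(q) = q]. What is drawn from it is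
       [q (N - 2) < N + 2], which makes the radicand [S] nonnegative. *)
    assert (hs : sqrt (2 * N * (N + 2)) <= 2 * N).
    { apply Rsqr_incr_0; [ | apply sqrt_pos | lra ].
      rewrite Rsqr_sqrt by nra. unfold Rsqr. nra. }
    assert (h3b' : q * (N - 2) < N + 2).
    { apply (Rmult_lt_compat_r (2 * (N - 2))) in h3b; [ | lra ].
      unfold Rdiv in h3b. rewrite Rmult_assoc, Rinv_l in h3b; nra. }
    set (S := (N + 2) * (q + 1) * (N + 2 - (N - 2) * q)) in *.
    assert (HS : 0 <= S) by (unfold S; apply Rmult_le_pos; nra).
    assert (h4' : N * p - 2 * (q + 1) <= sqrt S).
    { apply (Rmult_le_compat_l N) in h4; [ | lra ].
      replace (N * ((2 * (q + 1) + sqrt S) / N)) with (2 * (q + 1) + sqrt S) in h4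
        by (field; lra). lra. }
    assert (h6 : 0 < N * p - 2 * (q + 1)) by nra.
    assert (h7 : (N * p - 2 * (q + 1)) ^ 2 <= S).
    { rewrite <- (pow2_sqrt S HS). apply pow_incr. lra. }
    assert (h8 : N * (p + 1 + (q + 1) - 1) ^ 2 <= 2 * (N + 2) * (p + 1) * (q + 1)).
    { apply Rmult_le_reg_l with N; [ lra | ]. unfold S in h7. nra. }
    apply (subcritical_of_quadratic p q N (p + 1) (q + 1)); try lra; try nra.
    (* It remains to see that [p] is at most the critical exponent. By the identity below the
       product of the two factors is a square plus a term that is nonnegative by the discriminant
       condition, and the factor with [y] is positive. *)
    clear - hq hpq h3b' h8 h5. set (x := p + 1) in *. set (y := q + 1) in *.
    assert (Hx : 0 < x) by (unfold x; lra). assert (Hy : 0 < y) by (unfold y; lra).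
    assert (Hc : 0 < 2 * N - (N - 2) * y) by (unfold y; lra).
    assert (E : x * y * (2 * N - (N - 2) * y) * (2 * N - (N - 2) * x)
       = (N * (1 - x - y) + (N - 2) * x * y) ^ 2
         + N * (2 * (N + 2) * x * y - N * (x + y - 1) ^ 2)) by ring.
    assert (0 <= (N * (1 - x - y) + (N - 2) * x * y) ^ 2) by apply pow2_ge_0.
    assert (0 <= N * (2 * (N + 2) * x * y - N * (x + y - 1) ^ 2))
      by (apply Rmult_le_pos; lra).
    apply Rmult_le_reg_l with (x * y * (2 * N - (N - 2) * y)); [ | lra ].
    apply Rmult_lt_0_compat; [ nra | exact Hc ].
  - destruct h as [h _]. unfold N. rewrite h. change (INR 2) with 2.
    apply (subcritical_of_quadratic p q 2 (p + 1) (q + 1)); try lra.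
Qed.

(** * Energy and the maximum of a solution *)

Lemma is_derive_within_quotient (D : R -> Prop) u (r l : R) :
  is_derive_within D u r l -> forall e, 0 < e ->
  exists d, 0 < d /\ forall s, Rabs (s - r) < d -> s <> r -> D s ->
    Rabs ((u s - u r) / (s - r) - l) < e.
Proof.
  intros H e He. apply filterlim_locally with (eps := mkposreal e He) in H.
  destruct H as [d Hd]. exists d; split; [ apply cond_pos | ].
  intros s H1 H2 H3. exact (Hd s H1 H2 H3).
Qed.

Lemma is_derive_within_continuous (D : R -> Prop) u (r l : R) :
  is_derive_within D u r l -> filterlim u (within D (locally r)) (locally (u r)).
Proof.
  intros H. apply filterlim_locally. intros eps.
  destruct (is_derive_within_quotient D u r l H 1 Rlt_0_1) as [d [Hd Hq]].
  assert (Hl : 0 < Rabs l + 1) by (generalize (Rabs_pos l); lra).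
  assert (Hd' : 0 < Rmin d (eps / (Rabs l + 1))).
  { apply Rmin_glb_lt; [ exact Hd | ]. apply Rdiv_lt_0_compat; [ apply cond_pos | exact Hl ]. }
  exists (mkposreal _ Hd'). intros s Hs HD.
  change (Rabs (s - r) < Rmin d (eps / (Rabs l + 1))) in Hs.
  change (Rabs (u s - u r) < eps).
  destruct (Req_dec s r) as [->|Hne].
  { rewrite Rminus_diag, Rabs_R0. apply cond_pos. }
  assert (H1 := Rmin_l d (eps / (Rabs l + 1))). assert (H2 := Rmin_r d (eps / (Rabs l + 1))).
  specialize (Hq s ltac:(lra) Hne HD).
  set (Q := (u s - u r) / (s - r)) in *.
  assert (E : u s - u r = Q * (s - r)) by (unfold Q; field; lra).
  rewrite E, Rabs_mult.
  assert (HQ : Rabs Q < Rabs l + 1).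
  { generalize (Rabs_triang (Q - l) l). replace (Q - l + l) with Q by ring. lra. }
  assert (H3 : Rabs (s - r) < eps / (Rabs l + 1)) by lra.
  apply Rle_lt_trans with ((Rabs l + 1) * Rabs (s - r)).
  - apply Rmult_le_compat_r; [ apply Rabs_pos | lra ].
  - apply (Rmult_lt_compat_l (Rabs l + 1)) in H3; [ | exact Hl ].
    replace ((Rabs l + 1) * (eps / (Rabs l + 1))) with (pos eps) in H3 by (field; lra). lra.
Qed.

Lemma cont_Rmax (f g : R -> R) x :
  continuous f x -> continuous g x -> continuous (fun y => Rmax (f y) (g y)) x.
Proof.
  intros Hf Hg.
  apply (continuous_ext (fun y => (f y + g y + Rabs (f y - g y)) / 2)).
  - intros y. unfold Rmax. destruct (Rle_dec (f y) (g y)).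
    + rewrite Rabs_left1; lra.
    + rewrite Rabs_right; lra.
  - ctn; auto. apply (continuous_comp (fun y => f y - g y) Rabs).
    + ctn; auto.
    + apply continuous_Rabs.
Qed.

Lemma cont_Rmin (f g : R -> R) x :
  continuous f x -> continuous g x -> continuous (fun y => Rmin (f y) (g y)) x.
Proof.
  intros Hf Hg.
  apply (continuous_ext (fun y => - Rmax (- f y) (- g y))).
  - intros y. unfold Rmin, Rmax.
    destruct (Rle_dec (f y) (g y)), (Rle_dec (- f y) (- g y)); lra.
  - apply cont_opp, cont_Rmax; now apply cont_opp.
Qed.

(** Projection onto the closed interval; composing with it turns one-sided regularity at the
    endpoints into continuity on the line. *)
Definition clamp (a : R) (b : Rbar) (x : R) : R :=
  match b with Finite b => Rmax a (Rmin x b) | _ => Rmax a x end.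

Lemma clamp_continuous (a : R) (b : Rbar) (x : R) : continuous (clamp a b) x.
Proof.
  destruct b as [b| |].
  - apply (cont_Rmax (fun _ => a) (fun y => Rmin y b)); [ apply continuous_const | ].
    apply (cont_Rmin (fun y => y) (fun _ => b)); [ apply continuous_id | apply continuous_const ].
  - apply (cont_Rmax (fun _ => a) (fun y => y)); [ apply continuous_const | apply continuous_id ].
  - apply (cont_Rmax (fun _ => a) (fun y => y)); [ apply continuous_const | apply continuous_id ].
Qed.

Lemma clamp_in (a : R) (b : Rbar) (x : R) : Rbar_lt a b -> closed_itv a b (clamp a b x).
Proof.
  destruct b as [b| |]; simpl; intros H; split; simpl; try trivial; try apply Rmax_l.
  - apply Rmax_lub; [ lra | apply Rmin_r ].
Qed.

Lemma clamp_id (a : R) (b : Rbar) (x : R) : closed_itv a b x -> clamp a b x = x.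
Proof.
  destruct b as [b| |]; simpl; intros [H1 H2]; simpl in H2; try contradiction.
  - rewrite Rmin_left, Rmax_right; lra.
  - rewrite Rmax_right; lra.
Qed.

Lemma clamp_below (a : R) (b : Rbar) (x : R) : x <= a -> Rbar_lt a b -> clamp a b x = a.
Proof.
  destruct b as [b| |]; simpl; intros H1 H2; try contradiction.
  - rewrite Rmin_left, Rmax_left; lra.
  - rewrite Rmax_left; lra.
Qed.

Lemma open_itv_locally (a : R) (b : Rbar) (x : R) : open_itv a b x -> locally x (open_itv a b).
Proof.
  intros [H1 H2]. destruct b as [b| |]; simpl in H2; try contradiction.
  - assert (Hd : 0 < Rmin (x - a) (b - x)) by (apply Rmin_glb_lt; lra).
    exists (mkposreal _ Hd). intros y Hy.
    change (Rabs (y - x) < Rmin (x - a) (b - x)) in Hy.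
    generalize (Rmin_l (x - a) (b - x)) (Rmin_r (x - a) (b - x)).
    apply Rabs_def2 in Hy. split; simpl; lra.
  - assert (Hd : 0 < x - a) by lra.
    exists (mkposreal _ Hd). intros y Hy. change (Rabs (y - x) < x - a) in Hy.
    apply Rabs_def2 in Hy. split; simpl; [ lra | trivial ].
Qed.

Lemma open_itv_closed (a : R) (b : Rbar) (x : R) : open_itv a b x -> closed_itv a b x.
Proof.
  intros [H1 H2]. split; [ lra | ]. destruct b as [b| |]; simpl in *; try lra; trivial.
Qed.

Section Solutions.
Context (k : nat) (p q : R) (hq : 0 < q) (hpq : q < p).

Local Notation d := (INR k + 1).
Local Notation f := (nonlin p q).
Local Notation F := (prim p q).
Local Notation beta := (zero_of_prim p q).

(** A solution extended to a continuous function on the whole line, with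
    [v] extending its derivative. *)
Record extended_solution (a : R) (b : Rbar) (u v : R -> R) : Prop := {
  es_a : 0 < a;
  es_ab : Rbar_lt a b;
  es_cu : forall x, continuous u x;
  es_cv : forall x, continuous v x;
  es_left : forall x, x <= a -> u x = 0;
  es_right : match b with
             | Finite b => forall x, b <= x -> u x = 0
             | p_infty => is_lim u p_infty 0
             | m_infty => False
             end;
  es_pos : forall x, open_itv a b x -> 0 < u x;
  es_du : forall x, open_itv a b x -> is_derive u x (v x);
  es_dv : forall x, open_itv a b x -> is_derive v x (- (d / x) * v x - f (u x))
}.

(** Here [n = k + 2], so that [d = n - 1]. Both [w] and the derivative supplied by [C1_on] are
    composed with [clamp]; at interior points the relative derivative is the ordinary one, because
    the interval is a neighbourhood of them. *)
Lemma extend_solution (a : R) (b : Rbar) (w : R -> R) :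
  0 < a -> Rbar_lt a b ->
  positive_classical_solution (S (S k)) f a b w -> w a = 0 ->
  match b with
  | Finite b => w b = 0
  | p_infty => is_lim w p_infty 0
  | m_infty => False
  end ->
  exists u v, extended_solution a b u v /\ forall x, closed_itv a b x -> u x = w x.
Proof.
  intros Ha Hab [HC2 [[dw HC1] [Hpos Hode]]] Hwa Hwb.
  set (D := closed_itv a b) in *.
  assert (Hcl : forall g : R -> R, (forall x, D x -> filterlim g (within D (locally x)) (locally (g x)))
                 -> forall x, continuous (fun y => g (clamp a b y)) x).
  { intros g Hg x. unfold continuous.
    apply (filterlim_comp _ _ _ (clamp a b) g (locally x) (within D (locally (clamp a b x)))).
    - intros Q HQ. unfold filtermap.
      apply (filter_imp (fun y => D (clamp a b y) -> Q (clamp a b y))).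
      + intros y Hy. apply Hy. now apply clamp_in.
      + apply (clamp_continuous a b x (fun z => D z -> Q z) HQ).
    - apply Hg. now apply clamp_in. }
  assert (Hdw : forall x, open_itv a b x -> is_derive w x (dw x)).
  { intros x Hx. apply is_derive_Reals. intros e He.
    destruct (HC1 x (open_itv_closed a b x Hx)) as [H1 _].
    destruct (is_derive_within_quotient D w x (dw x) H1 e He) as [d1 [Hd1 Hq1]].
    destruct (open_itv_locally a b x Hx) as [d2 Hd2].
    assert (Hd : 0 < Rmin d1 d2) by (apply Rmin_glb_lt; [ exact Hd1 | apply cond_pos ]).
    exists (mkposreal _ Hd). intros h Hh0 Hh. simpl in Hh.
    assert (Hm1 := Rmin_l d1 d2). assert (Hm2 := Rmin_r d1 d2).
    specialize (Hq1 (x + h)). replace (x + h - x) with h in Hq1 by ring.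
    apply Hq1; [ lra | lra | ]. apply open_itv_closed, Hd2.
    change (Rabs (x + h - x) < d2). replace (x + h - x) with h by ring. lra. }
  exists (fun x => w (clamp a b x)), (fun x => dw (clamp a b x)).
  assert (Hloc : forall g : R -> R, forall x, open_itv a b x ->
            locally x (fun y => g y = g (clamp a b y))).
  { intros g x Hx. apply (filter_imp (open_itv a b)).
    - intros y Hy. now rewrite clamp_id by now apply open_itv_closed.
    - now apply open_itv_locally. }
  split; [ split | ].
  - exact Ha.
  - exact Hab.
  - apply Hcl. intros x Hx. apply (is_derive_within_continuous D w x (dw x)), HC1, Hx.
  - apply Hcl. intros x Hx. apply HC1, Hx.
  - intros x Hx. now rewrite clamp_below.
  - destruct b as [b| |]; [ | | exact Hwb ].
    + intros x Hx. simpl in Hab. simpl. rewrite Rmin_right, Rmax_right; lra.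
    + apply (is_lim_ext_loc w); [ | exact Hwb ].
      exists a. intros y Hy. simpl. now rewrite Rmax_right by lra.
  - intros x Hx. rewrite clamp_id by now apply open_itv_closed. auto.
  - intros x Hx. rewrite clamp_id by now apply open_itv_closed.
    apply (is_derive_ext_loc w); auto.
  - intros x Hx. rewrite clamp_id by now apply open_itv_closed.
    apply (is_derive_ext_loc (Derive w)).
    + apply (filter_imp (open_itv a b)); [ | now apply open_itv_locally ].
      intros y Hy. rewrite clamp_id by now apply open_itv_closed.
      now apply is_derive_unique, Hdw.
    + apply (derive_val _ _ (Derive_n w 2 x)).
      * apply (Derive_correct (Derive w)). apply (HC2 x Hx).
      * specialize (Hode x Hx). rewrite (is_derive_unique _ _ _ (Hdw x Hx)) in Hode.
        rewrite !S_INR in Hode. replace (INR k + 1 + 1 - 1) with d in Hode by ring. lra.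
  - intros x Hx. now rewrite clamp_id.
Qed.

Section OneSolution.
Context (a : R) (b : Rbar) (u v : R -> R) (sol : extended_solution a b u v).

Let d_pos : 0 < d.
Proof. generalize (pos_INR k). lra. Qed.

Lemma u_at_a : u a = 0.
Proof. apply (es_left _ _ _ _ sol). lra. Qed.

Lemma energy_derive x : open_itv a b x ->
  is_derive (fun x => v x ^ 2 + 2 * F (u x)) x (- (2 * d / x) * v x ^ 2).
Proof.
  intros Hx. assert (H1 := es_du _ _ _ _ sol x Hx). assert (H2 := es_dv _ _ _ _ sol x Hx).
  assert (H3 := prim_derive p q hq hpq (u x) (es_pos _ _ _ _ sol x Hx)).
  assert (Ha := es_a _ _ _ _ sol). destruct Hx as [Hx _].
  auto_derive.
  - repeat split; eexists; eassumption.
  - derive_atoms. field. lra.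
Qed.

Lemma energy_continuous x : continuous (fun x => v x ^ 2 + 2 * F (u x)) x.
Proof.
  ctn; [ apply (es_cv _ _ _ _ sol) | ].
  apply (continuous_comp u F); [ apply (es_cu _ _ _ _ sol) | now apply prim_continuous ].
Qed.

Lemma energy_decreasing x y : a <= x -> x <= y -> Rbar_le y b ->
  v y ^ 2 + 2 * F (u y) <= v x ^ 2 + 2 * F (u x).
Proof.
  intros Hx Hxy Hy. apply Ropp_le_cancel.
  assert (Hin : forall z, x < z < y -> open_itv a b z).
  { intros z Hz. split; [ lra | ]. destruct b as [b'| |]; simpl in *; try lra; trivial. }
  assert (Ha := es_a _ _ _ _ sol).
  apply (le_of_deriv (fun x => - (v x ^ 2 + 2 * F (u x))) (fun x => 2 * d / x * v x ^ 2) x y Hxy).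
  - intros z _. apply cont_opp, energy_continuous.
  - intros z Hz. apply (derive_val _ _ (- (- (2 * d / z) * v z ^ 2))).
    + apply (is_derive_opp (fun x => v x ^ 2 + 2 * F (u x))). apply energy_derive, Hin, Hz.
    + ring.
  - intros z Hz. apply Rmult_le_pos; [ | apply pow2_ge_0 ].
    apply Rlt_le, Rdiv_lt_0_compat; lra.
Qed.

(** A common form of the boundary condition at a finite [b] and at infinity. *)
Lemma small_value_beyond x e : open_itv a b x -> 0 < e ->
  exists y, x < y /\ Rbar_le y b /\ Rabs (u y) < e.
Proof.
  intros [Hx1 Hx2] He. assert (Hr := es_right _ _ _ _ sol).
  destruct b as [b'| |]; [ | | contradiction ].
  - exists b'. repeat split; [ exact Hx2 | simpl; lra | ].
    rewrite Hr, Rabs_R0; lra.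
  - apply filterlim_locally with (eps := mkposreal e He) in Hr.
    destruct Hr as [A HA]. exists (Rmax (x + 1) (A + 1)).
    assert (H1 := Rmax_l (x + 1) (A + 1)). assert (H2 := Rmax_r (x + 1) (A + 1)).
    repeat split; [ lra | ]. specialize (HA (Rmax (x + 1) (A + 1)) ltac:(lra)).
    change (Rabs (u (Rmax (x + 1) (A + 1)) - 0) < e) in HA. now rewrite Rminus_0_r in HA.
Qed.

(** The energy decreases, and at later points where [u] is small it is at least [2 * F (u y)], which
    is close to [F 0 = 0]. *)
Lemma energy_nonneg x : open_itv a b x -> 0 <= v x ^ 2 + 2 * F (u x).
Proof.
  intros Hx. apply le_epsilon. intros e He.
  assert (Hc := prim_continuous p q hq hpq 0).
  assert (He2 : 0 < e / 2) by lra.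
  apply filterlim_locally with (eps := mkposreal _ He2) in Hc. destruct Hc as [e' He'].
  destruct (small_value_beyond x e' Hx (cond_pos e')) as [y [H1 [H2 H3]]].
  assert (H4 : Rabs (F (u y) - F 0) < e / 2).
  { apply He'. change (Rabs (u y - 0) < e'). now rewrite Rminus_0_r. }
  rewrite prim_0 in H4 by assumption. rewrite Rminus_0_r in H4. apply Rabs_def2 in H4.
  destruct Hx as [Hx _].
  assert (H5 := energy_decreasing x y ltac:(lra) ltac:(lra) H2).
  generalize (pow2_ge_0 (v y)). lra.
Qed.

(** If the energy reached 0 it would stay 0, so its derivative and hence [v] would vanish on an
    interval. Then [f] and [F] would both vanish at the value of [u] there, but they have no common
    positive zero. *)
Lemma energy_pos x : open_itv a b x -> 0 < v x ^ 2 + 2 * F (u x).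
Proof.
  intros Hx. destruct (Rlt_le_dec 0 (v x ^ 2 + 2 * F (u x))) as [|Hn]; [ assumption | exfalso ].
  assert (Ha := es_a _ _ _ _ sol).
  assert (Hzero : forall y, x < y -> open_itv a b y -> v y ^ 2 + 2 * F (u y) = 0).
  { intros y Hxy Hy. apply Rle_antisym.
    - apply Rle_trans with (2 := Hn). destruct Hx as [Hx _].
      apply energy_decreasing; [ lra | lra | apply (open_itv_closed _ _ _ Hy) ].
    - now apply energy_nonneg. }
  assert (Hy : exists y, x < y /\ open_itv a b y).
  { destruct (open_itv_locally a b x Hx) as [e He].
    exists (x + e / 2). assert (He0 := cond_pos e). split; [ lra | ]. apply He.
    change (Rabs (x + e / 2 - x) < e). rewrite Rabs_right; lra. }
  destruct Hy as [y [Hxy Hy]].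
  assert (Hyloc : locally y (fun z => x < z /\ open_itv a b z)).
  { apply filter_and; [ apply (open_gt x y Hxy) | now apply open_itv_locally ]. }
  assert (Hv : locally y (fun z => v z = 0)).
  { generalize (locally_locally _ _ Hyloc). apply filter_imp. intros z Hz.
    assert (Hz0 := locally_singleton _ _ Hz). destruct Hz0 as [Hz1 Hz2].
    assert (H1 := energy_derive z Hz2).
    assert (H2 : is_derive (fun x => v x ^ 2 + 2 * F (u x)) z 0).
    { apply (is_derive_ext_loc (fun _ => 0)); [ | apply (is_derive_const 0 z) ].
      revert Hz. apply filter_imp. intros w [Hw1 Hw2]. symmetry. now apply Hzero. }
    apply is_derive_unique in H1. apply is_derive_unique in H2. rewrite H2 in H1.
    destruct Hz2 as [Hz2 _].
    assert (0 < 2 * d / z) by (apply Rdiv_lt_0_compat; lra).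
    assert (v z ^ 2 = 0) by nra. nra. }
  assert (H1 := es_dv _ _ _ _ sol y Hy).
  assert (H2 : is_derive v y 0).
  { apply (is_derive_ext_loc (fun _ => 0)); [ | apply (is_derive_const 0 y) ].
    revert Hv. apply filter_imp. now intros. }
  apply locally_singleton in Hv.
  apply is_derive_unique in H1. apply is_derive_unique in H2. rewrite H2, Hv in H1.
  assert (HF : F (u y) = 0) by (specialize (Hzero y Hxy Hy); rewrite Hv in Hzero; lra).
  assert (Hu := es_pos _ _ _ _ sol y Hy). assert (Hb := beta_gt_1 p q hq hpq).
  destruct (Rtotal_order (u y) beta) as [H|[H|H]].
  - assert (F (u y) < 0) by (apply prim_neg; auto). lra.
  - assert (0 < f (u y)) by (apply nonlin_pos; lra). lra.
  - assert (0 < F (u y)) by (apply prim_pos; auto). lra.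
Qed.

Lemma critical_above_beta x : open_itv a b x -> v x = 0 -> beta < u x.
Proof.
  intros Hx Hv. assert (He := energy_pos x Hx). rewrite Hv in He.
  destruct (Rlt_le_dec beta (u x)) as [|H]; [ assumption | exfalso ].
  assert (F (u x) <= 0).
  { apply prim_le_0; auto. split; [ | exact H ]. left. now apply (es_pos _ _ _ _ sol). }
  lra.
Qed.

(** The mean value theorem gives points with [v > 0] and, later, [v < 0]. At a critical point
    [u > beta > 1], so [v' = - f u < 0]: [v] can change sign only from plus to minus, hence only
    once. *)
Lemma exists_maximum : exists m, open_itv a b m /\ v m = 0 /\
  (forall x, a < x < m -> 0 < v x) /\ (forall x, m < x -> Rbar_lt x b -> v x < 0).
Proof.
  assert (Hab := es_ab _ _ _ _ sol).
  assert (Hx0 : exists x, open_itv a b x).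
  { destruct b as [b'| |]; simpl in Hab; [ | | contradiction ].
    - exists ((a + b') / 2). split; simpl; lra.
    - exists (a + 1). split; simpl; [ lra | trivial ]. }
  destruct Hx0 as [x0 Hx0].
  assert (Hu0 := es_pos _ _ _ _ sol x0 Hx0).
  destruct (small_value_beyond x0 (u x0) Hx0 Hu0) as [y [Hy1 [Hy2 Hy3]]].
  assert (Hin : forall x, a < x < y -> open_itv a b x).
  { intros x Hx. split; [ lra | ]. destruct b as [b'| |]; simpl in *; try lra; trivial. }
  assert (Hx0a : a < x0) by apply Hx0.
  destruct (mean_value u v a x0) as [c1 [Hc1 E1]]; [ exact Hx0a | | | ].
  { intros x _. apply (es_cu _ _ _ _ sol). }
  { intros x Hx. apply (es_du _ _ _ _ sol), Hin. lra. }
  destruct (mean_value u v x0 y) as [c2 [Hc2 E2]]; [ exact Hy1 | | | ].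
  { intros x _. apply (es_cu _ _ _ _ sol). }
  { intros x Hx. apply (es_du _ _ _ _ sol), Hin. lra. }
  rewrite u_at_a in E1.
  assert (Hv1 : 0 < v c1) by nra.
  assert (Hv2 : v c2 < 0) by (apply Rabs_def2 in Hy3; nra).
  destruct (IVT_gen v c1 c2 0) as [m [Hm Em]].
  { intros x. apply continuity_pt_filterlim, (es_cv _ _ _ _ sol). }
  { rewrite Rmin_right, Rmax_left; lra. }
  rewrite Rmin_left, Rmax_right in Hm by lra.
  assert (Hom : open_itv a b m) by (apply Hin; lra).
  assert (Hstay : forall x z, a < x -> v x <= 0 -> x < z -> Rbar_lt z b -> v z < 0).
  { intros x z Hx Hvx Hxz Hz.
    assert (Hin' : forall w, x <= w <= z -> open_itv a b w).
    { intros w Hw. split; [ lra | ]. destruct b as [b'| |]; simpl in *; try lra; trivial. }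
    (* [stays_negative] concludes on an open interval, so the right end is pushed slightly beyond
       [z]. *)
    destruct (open_itv_locally a b z (Hin' z ltac:(lra))) as [e He].
    assert (He0 := cond_pos e).
    apply (stays_negative v (fun x => - (d / x) * v x - f (u x)) x (z + e / 2)).
    - intros w Hw. apply (es_dv _ _ _ _ sol).
      destruct (Rle_lt_dec w z); [ apply Hin'; lra | ].
      apply He. change (Rabs (w - z) < e). rewrite Rabs_right; lra.
    - intros w Hw Hv0.
      assert (Hw' : open_itv a b w).
      { destruct (Rle_lt_dec w z); [ apply Hin'; lra | ].
        apply He. change (Rabs (w - z) < e). rewrite Rabs_right; lra. }
      assert (H1 := critical_above_beta w Hw' Hv0). assert (Hb := beta_gt_1 p q hq hpq).
      assert (0 < f (u w)) by (apply nonlin_pos; lra). rewrite Hv0. lra.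
    - exact Hvx.
    - lra. }
  exists m. repeat split; try apply Hom; auto.
  - intros x Hx. destruct (Rlt_le_dec 0 (v x)) as [|H]; [ assumption | exfalso ].
    assert (v m < 0); [ | lra ]. apply (Hstay x m); try lra. apply Hom.
  - intros x Hx Hxb. apply (Hstay m x); [ apply Hom | lra | exact Hx | exact Hxb ].
Qed.

End OneSolution.
End Solutions.

(** * Branches *)

Lemma lt_of_deriv_loc (g g' : R -> R) x0 x1 :
  x0 < x1 -> (forall x, continuous g x) ->
  (forall x, x0 < x < x1 -> is_derive g x (g' x)) ->
  (forall x, x0 < x < x1 -> 0 < g' x) ->
  forall x y, x0 <= x -> x < y -> y <= x1 -> g x < g y.
Proof.
  intros H Hc Hd Hp x y Hx Hxy Hy.
  apply (lt_of_deriv g g' x y); auto; intros z Hz; [ apply Hd | apply Hp ]; lra.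
Qed.

Lemma increasing_inverse (u v : R -> R) a m :
  a < m -> (forall x, continuous u x) -> (forall x, x <= a -> u x = 0) ->
  (forall x, a < x < m -> is_derive u x (v x)) ->
  (forall x, a < x < m -> 0 < v x) ->
  exists r : R -> R,
    (forall x, a <= x <= m -> r (u x) = x) /\
    (forall s, 0 <= s <= u m -> a <= r s <= m /\ u (r s) = s /\ continuous r s) /\
    (forall s, 0 < s < u m -> a < r s < m /\ is_derive r s (/ v (r s))).
Proof.
  intros Ham Hc Ha Hd Hv.
  assert (Hmono := lt_of_deriv_loc u v a m Ham Hc Hd Hv).
  assert (Hua : u a = 0) by (apply Ha; lra).
  (* The arc of [u] over [[a, m]] is continued by lines of slope 1 on both sides, to obtain a
     strictly increasing function on the whole line. *)
  set (h := fun x => u (Rmin x m) + Rmax (x - m) 0 + Rmin (x - a) 0).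
  assert (H1 : forall x, x <= a -> h x = x - a).
  { intros x Hx. unfold h. rewrite Rmin_left, Rmax_right, Rmin_left, Ha by lra. ring. }
  assert (H2 : forall x, a <= x <= m -> h x = u x).
  { intros x Hx. unfold h. rewrite Rmin_left, Rmax_right, Rmin_right by lra. ring. }
  assert (H3 : forall x, m <= x -> h x = u m + (x - m)).
  { intros x Hx. unfold h. rewrite Rmin_right, Rmax_left, Rmin_right by lra. ring. }
  assert (Hch : forall x, continuous h x).
  { intros x. unfold h. apply cont_plus; [ apply cont_plus | ].
    - apply (continuous_comp (fun x => Rmin x m) u); [ | apply Hc ].
      apply (cont_Rmin (fun x => x) (fun _ => m)); [ apply continuous_id | apply continuous_const ].
    - apply (cont_Rmax (fun x => x - m) (fun _ => 0)); ctn.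
    - apply (cont_Rmin (fun x => x - a) (fun _ => 0)); ctn. }
  assert (Hmh : forall x y, x < y -> h x < h y).
  { intros x y Hxy.
    destruct (Rle_lt_dec x a) as [Hx|Hx]; destruct (Rle_lt_dec y a) as [Hy|Hy].
    - rewrite !H1; lra.
    - rewrite (H1 x) by lra. destruct (Rle_lt_dec y m) as [Hy'|Hy'].
      + rewrite H2 by lra. assert (u a < u y) by (apply Hmono; lra). lra.
      + rewrite H3 by lra. assert (u a < u m) by (apply Hmono; lra). lra.
    - lra.
    - destruct (Rle_lt_dec y m) as [Hy'|Hy'].
      + rewrite !H2 by lra. apply Hmono; lra.
      + rewrite (H3 y) by lra. destruct (Rle_lt_dec x m) as [Hx'|Hx'].
        * rewrite H2 by lra. destruct (Req_dec x m) as [->|]; [ lra | ].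
          assert (u x < u m) by (apply Hmono; lra). lra.
        * rewrite H3; lra. }
  destruct (inverse_of_increasing h Hch Hmh) as [r [R1 [R2 R3]]].
  exists r.
  assert (Hru : forall x, a <= x <= m -> r (u x) = x).
  { intros x Hx. rewrite <- (H2 x Hx). apply R1. }
  assert (Hex : forall s, 0 <= s <= u m -> exists x, a <= x <= m /\ u x = s).
  { intros s Hs. destruct (IVT_gen u a m s) as [x [Hx Ex]].
    - intros z. apply continuity_pt_filterlim, Hc.
    - rewrite Rmin_left, Rmax_right; lra.
    - rewrite Rmin_left, Rmax_right in Hx by lra. now exists x. }
  split; [ exact Hru | split ].
  - intros s Hs. destruct (Hex s Hs) as [x [Hx <-]]. rewrite Hru by exact Hx.
    split; [ exact Hx | split; [ reflexivity | ] ]. rewrite <- (H2 x Hx). apply R2.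
  - intros s Hs. destruct (Hex s ltac:(lra)) as [x [Hx <-]].
    assert (Hx' : a < x < m).
    { destruct (Req_dec a x) as [<-|]; [ lra | ]. destruct (Req_dec m x) as [<-|]; lra. }
    rewrite Hru by exact Hx. split; [ exact Hx' | ]. rewrite <- (H2 x Hx).
    apply R3; [ | specialize (Hv x Hx'); lra ].
    apply (is_derive_ext_loc u); [ | now apply Hd ].
    apply (filter_imp (open_itv a m)).
    + intros y [Hy1 Hy2]. simpl in Hy2. rewrite H2; [ reflexivity | lra ].
    + apply open_itv_locally. split; simpl; lra.
Qed.

Lemma decreasing_inverse (u v : R -> R) (m : R) (b : Rbar) :
  Rbar_lt m b -> (forall x, continuous u x) ->
  match b with
  | Finite b => forall x, b <= x -> u x = 0
  | p_infty => is_lim u p_infty 0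
  | m_infty => False
  end ->
  (forall x, open_itv m b x -> 0 < u x) ->
  (forall x, open_itv m b x -> is_derive u x (v x)) ->
  (forall x, open_itv m b x -> v x < 0) ->
  exists r : R -> R,
    (forall x, m <= x -> Rbar_lt x b -> r (u x) = x) /\
    (forall s, 0 < s <= u m -> m <= r s /\ Rbar_lt (r s) b /\ u (r s) = s /\ continuous r s) /\
    (forall s, 0 < s < u m -> m < r s /\ is_derive r s (/ v (r s))) /\
    (match b with Finite b => r 0 = b /\ continuous r 0 | _ => True end).
Proof.
  intros Hmb Hc Hright Hpos Hd Hv.
  assert (Hin : forall y, m <= y -> Rbar_le y b -> forall x, m < x < y -> open_itv m b x).
  { intros y Hy1 Hy2 x Hx. split; [ lra | ]. destruct b; simpl in *; try lra; trivial. }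
  assert (Hmono : forall x y, m <= x -> x < y -> Rbar_le y b -> u y < u x).
  { intros x y Hx Hxy Hy. assert (- u x < - u y); [ | lra ].
    apply (lt_of_deriv (fun x => - u x) (fun x => - v x)).
    - exact Hxy.
    - intros z _. now apply cont_opp.
    - intros z Hz. apply (is_derive_opp u z (v z)), Hd, (Hin y); auto; lra.
    - intros z Hz. assert (v z < 0); [ | lra ]. apply Hv, (Hin y); auto; lra. }
  assert (Hnn : forall x, m < x -> Rbar_le x b -> 0 <= u x).
  { intros x Hx Hxb. destruct b as [b'| |]; simpl in *.
    - destruct (Rle_lt_dec b' x); [ rewrite Hright; lra | ].
      left. apply Hpos. split; simpl; lra.
    - left. apply Hpos. split; simpl; auto.
    - contradiction. }
  (* For finite [b] the arc is continued beyond [b] by a line of slope -1. For [b = p_infty] nothing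
     is added on the right and the range omits 0, which is why the height 0 is treated separately in
     the conclusion. *)
  set (tail := fun x => match b with Finite b => Rmin (b - x) 0 | _ => 0 end).
  set (h := fun x => u (Rmax x m) + Rmax (m - x) 0 + tail x).
  assert (T0 : forall x : R, Rbar_le x b -> tail x = 0).
  { intros x Hx. unfold tail. destruct b as [b'| |]; simpl in *; auto.
    rewrite Rmin_right; lra. }
  assert (H1 : forall x, x <= m -> h x = u m + (m - x)).
  { intros x Hx. unfold h. rewrite T0, Rmax_right, Rmax_left by
      (first [ lra | destruct b; simpl in *; try lra; trivial ]). ring. }
  assert (H2 : forall x, m <= x -> Rbar_le x b -> h x = u x).
  { intros x Hx Hxb. unfold h. rewrite T0, Rmax_left, Rmax_right by (trivial; lra). ring. }
  assert (H3 : forall x : R, Rbar_lt b x -> exists b' : R, b = b' /\ m < b' /\ h x = b' - x).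
  { intros x Hx. unfold h, tail. destruct b as [b'| |]; simpl in *; try contradiction.
    exists b'. split; [ reflexivity | split; [ lra | ] ].
    rewrite Rmax_left, Rmax_right, Rmin_left, Hright by lra. ring. }
  assert (Hch : forall x, continuous h x).
  { intros x. unfold h. apply cont_plus; [ apply cont_plus | ].
    - apply (continuous_comp (fun x => Rmax x m) u); [ | apply Hc ].
      apply (cont_Rmax (fun x => x) (fun _ => m)); [ apply continuous_id | apply continuous_const ].
    - apply (cont_Rmax (fun x => m - x) (fun _ => 0)); ctn.
    - unfold tail. destruct b as [b'| |]; [ | ctn | ctn ].
      apply (cont_Rmin (fun x => b' - x) (fun _ => 0)); ctn. }
  assert (Hle : forall x : R, Rbar_le x b \/ Rbar_lt b x).
  { intros x. destruct (Rbar_le_lt_dec x b); auto. }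
  assert (Hum : forall x, m < x -> Rbar_le x b -> u x < u m).
  { intros x Hx Hxb. apply Hmono; auto; lra. }
  assert (Hmh : forall x y, x < y -> h y < h x).
  { intros x y Hxy.
    destruct (Rle_lt_dec x m) as [Hx|Hx]; destruct (Rle_lt_dec y m) as [Hy|Hy].
    - rewrite !H1; lra.
    - rewrite (H1 x) by lra. destruct (Hle y) as [Hy'|Hy'].
      + rewrite H2 by (trivial; lra). specialize (Hum y Hy Hy'). lra.
      + destruct (H3 y Hy') as [b' [-> [Hb' ->]]]. simpl in Hy'.
        assert (u b' < u m) by (apply Hum; [ exact Hb' | simpl; lra ]).
        rewrite (Hright b') in H by lra. lra.
    - lra.
    - destruct (Hle y) as [Hy'|Hy'].
      + assert (Hxb : Rbar_le x b) by (destruct b; simpl in *; try lra; trivial).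
        rewrite !H2 by (trivial; lra). apply Hmono; auto; lra.
      + destruct (H3 y Hy') as [b' [Eb [Hb' ->]]]. subst b. simpl in Hy'.
        destruct (Hle x) as [Hx'|Hx'].
        * rewrite H2 by (trivial; lra). specialize (Hnn x Hx Hx'). lra.
        * destruct (H3 x Hx') as [b'' [Eb [Hb'' ->]]]. injection Eb as ->. lra. }
  destruct (inverse_of_decreasing h Hch Hmh) as [r [R1 [R2 R3]]].
  exists r.
  assert (Hru : forall x, m <= x -> Rbar_lt x b -> r (u x) = x).
  { intros x Hx Hxb. rewrite <- (H2 x Hx); [ apply R1 | now apply Rbar_lt_le ]. }
  assert (Hex : forall s, 0 < s <= u m -> exists x, m <= x /\ Rbar_lt x b /\ u x = s).
  { intros s Hs.
    assert (Hy : exists y, m < y /\ Rbar_le y b /\ u y < s).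
    { destruct b as [b'| |]; [ | | contradiction ].
      - exists b'. repeat split; simpl; [ exact Hmb | lra | rewrite Hright; lra ].
      - apply filterlim_locally with (eps := mkposreal s (proj1 Hs)) in Hright.
        destruct Hright as [A HA]. exists (Rmax (m + 1) (A + 1)).
        assert (G1 := Rmax_l (m + 1) (A + 1)). assert (G2 := Rmax_r (m + 1) (A + 1)).
        repeat split; [ lra | ]. specialize (HA (Rmax (m + 1) (A + 1)) ltac:(lra)).
        change (Rabs (u (Rmax (m + 1) (A + 1)) - 0) < s) in HA.
        apply Rabs_def2 in HA. lra. }
    destruct Hy as [y [Hy1 [Hy2 Hy3]]].
    destruct (IVT_gen u m y s) as [x [Hx Ex]].
    - intros z. apply continuity_pt_filterlim, Hc.
    - rewrite Rmin_right, Rmax_left; lra.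
    - rewrite Rmin_left, Rmax_right in Hx by lra. exists x. repeat split; try lra.
      assert (x <> y) by (intros ->; lra).
      destruct b; simpl in *; try lra; trivial. }
  split; [ exact Hru | split; [ | split ] ].
  - intros s Hs. destruct (Hex s Hs) as [x [Hx [Hxb <-]]]. rewrite Hru by assumption.
    split; [ exact Hx | split; [ exact Hxb | split; [ reflexivity | ] ] ].
    rewrite <- (H2 x Hx) by now apply Rbar_lt_le. apply R2.
  - intros s Hs. destruct (Hex s ltac:(lra)) as [x [Hx [Hxb <-]]].
    assert (Hx' : m < x) by (destruct (Req_dec m x) as [<-|]; lra).
    rewrite Hru by assumption. split; [ exact Hx' | ].
    rewrite <- (H2 x Hx) by now apply Rbar_lt_le.
    assert (Hox : open_itv m b x) by now split.
    apply R3; [ | specialize (Hv x Hox); lra ].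
    apply (is_derive_ext_loc u); [ | now apply Hd ].
    apply (filter_imp (open_itv m b)); [ | now apply open_itv_locally ].
    intros y [Hy1 Hy2]. rewrite H2; [ reflexivity | lra | now apply Rbar_lt_le ].
  - destruct b as [b'| |]; trivial. simpl in Hmb.
    assert (Eb : h b' = 0) by (rewrite H2; [ apply Hright | | simpl ]; lra).
    rewrite <- Eb. split; [ apply R1 | apply R2 ].
Qed.

Section Branches.
Context (k : nat) (p q : R) (hq : 0 < q) (hpq : q < p).

Local Notation d := (INR k + 1).
Local Notation f := (nonlin p q).
Local Notation F := (prim p q).
Local Notation beta := (zero_of_prim p q).

(** A monotone piece of the graph of a solution, with the height [s = u]
    as the independent variable: [r] is the radius and [V] the slope, of sign
    [sg], at height [s]; the maximum is at height [M]. *)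
Record branch (sg M : R) (r V : R -> R) : Prop := {
  br_r : forall s, 0 < s <= M -> 0 < r s;
  br_V : forall s, 0 < s < M -> 0 < sg * V s;
  br_dr : forall s, 0 < s < M -> is_derive r s (/ V s);
  br_dV : forall s, 0 < s < M -> is_derive V s (- (d / r s) - f s / V s);
  br_energy : forall s, 0 < s <= M -> 0 < V s ^ 2 + 2 * F s;
  br_cr : forall s, 0 < s <= M -> continuous r s;
  br_cV : forall s, 0 < s <= M -> continuous V s;
  br_top : V M = 0;
  br_beta : beta < M
}.

(** [r] and [t] are the inverses of [u] to the left and to the right of its maximum [m]. The rising
    one extends to height 0, where it equals [a]; the falling one does so only for finite [b]. *)
Record profile (a : R) (b : Rbar) (u v : R -> R) (m : R) (r t : R -> R) : Prop := {
  pf_m : open_itv a b m;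
  pf_vm : v m = 0;
  pf_rise : branch 1 (u m) r (fun s => v (r s));
  pf_fall : branch (-1) (u m) t (fun s => v (t s));
  pf_r_top : r (u m) = m;
  pf_t_top : t (u m) = m;
  pf_r_0 : r 0 = a;
  pf_cr_0 : continuous r 0;
  pf_va : 0 < v a;
  pf_t_0 : match b with Finite b => t 0 = b /\ continuous t 0 | _ => True end;
  pf_r_u : forall x, a <= x <= m -> r (u x) = x;
  pf_u_r : forall s, 0 <= s <= u m -> a <= r s <= m /\ u (r s) = s;
  pf_t_u : forall x, m <= x -> Rbar_lt x b -> t (u x) = x;
  pf_u_t : forall s, 0 < s <= u m -> m <= t s /\ Rbar_lt (t s) b /\ u (t s) = s;
  pf_v_pos : forall x, a < x < m -> 0 < v x;
  pf_v_neg : forall x, m < x -> Rbar_lt x b -> v x < 0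
}.

Lemma branch_dV (r v : R -> R) (s l : R) :
  l <> 0 -> 0 < r s -> is_derive r s (/ v (r s)) -> v (r s) = l ->
  is_derive v (r s) (- (d / r s) * l - f s) ->
  is_derive (fun s => v (r s)) s (- (d / r s) - f s / l).
Proof.
  intros Hl Hr Hdr Hv Hdv.
  apply (derive_val _ _ (/ v (r s) * (- (d / r s) * l - f s))).
  - now apply (is_derive_comp v r s).
  - rewrite Hv. field. lra.
Qed.

Lemma exists_profile a b u v :
  extended_solution k p q a b u v -> exists m r t, profile a b u v m r t.
Proof.
  intros sol.
  destruct (exists_maximum k p q hq hpq a b u v sol) as [m [Hm [Hvm [Hvp Hvn]]]].
  assert (Ha := es_a _ _ _ _ _ _ _ sol).
  assert (Hbeta := critical_above_beta k p q hq hpq a b u v sol m Hm Hvm).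
  assert (Hcu := es_cu _ _ _ _ _ _ _ sol). assert (Hcv := es_cv _ _ _ _ _ _ _ sol).
  destruct Hm as [Ham Hmb].
  assert (Hin1 : forall x, a < x <= m -> open_itv a b x).
  { intros x Hx. split; [ lra | ]. destruct b; simpl in *; try lra; trivial. }
  assert (Hin2 : forall x, m <= x -> Rbar_lt x b -> open_itv a b x).
  { intros x Hx Hxb. split; [ lra | exact Hxb ]. }
  destruct (increasing_inverse u v a m) as [r [r1 [r2 r3]]]; auto.
  { apply (es_left _ _ _ _ _ _ _ sol). }
  { intros x Hx. apply (es_du _ _ _ _ _ _ _ sol), Hin1. lra. }
  destruct (decreasing_inverse u v m b) as [t [t1 [t2 [t3 t4]]]]; auto.
  { apply (es_right _ _ _ _ _ _ _ sol). }
  { intros x Hx. apply (es_pos _ _ _ _ _ _ _ sol). split; [ | apply Hx ].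
    destruct Hx; lra. }
  { intros x Hx. apply (es_du _ _ _ _ _ _ _ sol). split; [ | apply Hx ].
    destruct Hx; lra. }
  { intros x [Hx1 Hx2]. auto. }
  assert (Hb1 := beta_gt_1 p q hq hpq).
  assert (Hua : u a = 0) by (apply (es_left _ _ _ _ _ _ _ sol); lra).
  assert (Hra : r 0 = a) by (rewrite <- Hua; apply r1; lra).
  exists m, r, t. split.
  - now split.
  - exact Hvm.
  - split.
    + intros s Hs. destruct (r2 s ltac:(lra)). lra.
    + intros s Hs. rewrite Rmult_1_l. apply Hvp, r3, Hs.
    + intros s Hs. now apply r3.
    + intros s Hs. destruct (r3 s Hs) as [H1 H2].
      assert (H3 := Hvp _ H1). apply branch_dV; auto; try lra.
      assert (H4 := es_dv _ _ _ _ _ _ _ sol (r s) ltac:(apply Hin1; lra)).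
      destruct (r2 s ltac:(lra)) as [_ [E _]]. now rewrite E in H4.
    + intros s Hs. destruct (r2 s ltac:(lra)) as [H1 [H2 _]].
      assert (H3 := energy_pos k p q hq hpq a b u v sol (r s)).
      rewrite H2 in H3. apply H3, Hin1. split; [ | lra ].
      destruct (Req_dec a (r s)) as [E|]; [ rewrite <- E in H2; lra | lra ].
    + intros s Hs. apply r2. lra.
    + intros s Hs. apply (continuous_comp r v); [ apply r2; lra | apply Hcv ].
    + rewrite r1; lra.
    + exact Hbeta.
  - split.
    + intros s Hs. destruct (t2 s ltac:(lra)). lra.
    + intros s Hs. assert (v (t s) < 0); [ | lra ].
      apply Hvn; [ apply t3, Hs | apply t2; lra ].
    + intros s Hs. now apply t3.
    + intros s Hs. destruct (t3 s Hs) as [H1 H2].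
      destruct (t2 s ltac:(lra)) as [_ [Htb [E _]]].
      assert (H3 := Hvn _ H1 Htb). apply branch_dV; auto; try lra.
      assert (H4 := es_dv _ _ _ _ _ _ _ sol (t s) ltac:(apply Hin2; auto; lra)).
      now rewrite E in H4.
    + intros s Hs. destruct (t2 s ltac:(lra)) as [H1 [H2 [E _]]].
      assert (H3 := energy_pos k p q hq hpq a b u v sol (t s)).
      rewrite E in H3. apply H3, Hin2; auto.
    + intros s Hs. apply t2. lra.
    + intros s Hs. apply (continuous_comp t v); [ apply t2; lra | apply Hcv ].
    + rewrite t1; auto; lra.
    + exact Hbeta.
  - apply r1; lra.
  - apply t1; auto; lra.
  - exact Hra.
  - apply r2. lra.
  (* A Hopf lemma at [a] that also covers [q < 1]: as [F 0 = 0], the energy at [a] is [v a ^ 2], and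
     it is at least the positive energy at [m]. The sign follows by continuity. *)
  - assert (H1 : 0 < v m ^ 2 + 2 * F (u m)).
    { apply (energy_pos k p q hq hpq a b u v sol). now split. }
    assert (H2 := energy_decreasing k p q hq hpq a b u v sol a m ltac:(lra) ltac:(lra) ltac:(now apply Rbar_lt_le)).
    rewrite Hua, prim_0 in H2 by assumption.
    destruct (Rlt_le_dec 0 (v a)) as [|Hn]; [ assumption | exfalso ].
    assert (Hn' : 0 < - v a) by nra.
    destruct (continuous_pos_locally (fun x => - v x) a) as [e [He Hloc]].
    + apply cont_opp, Hcv.
    + exact Hn'.
    + set (y := Rmin (a + e / 2) ((a + m) / 2)).
      assert (a < y < a + e /\ y < m).
      { unfold y. generalize (Rmin_l (a + e/2) ((a + m)/2)) (Rmin_r (a + e/2) ((a + m)/2)).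
        intros; repeat split; try lra. apply Rmin_glb_lt; lra. }
      assert (0 < - v y) by (apply Hloc, Rabs_def1; lra).
      assert (0 < v y) by (apply Hvp; lra). lra.
  - exact t4.
  - exact r1.
  - intros s Hs. destruct (r2 s Hs) as [H1 [H2 _]]. now split.
  - exact t1.
  - intros s Hs. destruct (t2 s Hs) as [H1 [H2 [H3 _]]]. now repeat split.
  - exact Hvp.
  - exact Hvn.
Qed.

End Branches.

(** * Rising branches *)

Lemma d_const (c x : R) : is_derive (fun _ : R => c) x 0.
Proof. exact (is_derive_const c x). Qed.
Lemma d_id (x : R) : is_derive (fun y : R => y) x 1.
Proof. exact (is_derive_id x). Qed.
Lemma d_plus (f g : R -> R) (x l l' : R) :
  is_derive f x l -> is_derive g x l' -> is_derive (fun y => f y + g y) x (l + l').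
Proof. exact (is_derive_plus f g x l l'). Qed.
Lemma d_minus (f g : R -> R) (x l l' : R) :
  is_derive f x l -> is_derive g x l' -> is_derive (fun y => f y - g y) x (l - l').
Proof. exact (is_derive_minus f g x l l'). Qed.
Lemma d_opp (f : R -> R) (x l : R) :
  is_derive f x l -> is_derive (fun y => - f y) x (- l).
Proof. exact (is_derive_opp f x l). Qed.
Lemma d_mult (f g : R -> R) (x l l' : R) :
  is_derive f x l -> is_derive g x l' -> is_derive (fun y => f y * g y) x (l * g x + f x * l').
Proof. intros Hf Hg. exact (is_derive_mult f g x l l' Hf Hg Rmult_comm). Qed.
Lemma d_inv (f : R -> R) (x l : R) :
  f x <> 0 -> is_derive f x l -> is_derive (fun y => / f y) x (- l / f x ^ 2).
Proof. intros H Hf. exact (is_derive_inv f x l Hf H). Qed.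
Lemma d_pow (f : R -> R) (n : nat) (x l : R) :
  is_derive f x l -> is_derive (fun y => f y ^ n) x (INR n * l * f x ^ pred n).
Proof. exact (is_derive_pow f n x l). Qed.

Ltac dv :=
  first [ eassumption |
  lazymatch goal with
  | |- is_derive (fun _ => ?c) _ _ => apply d_const
  | |- is_derive (fun x => x) _ _ => apply d_id
  | |- is_derive (fun x => _ + _) _ _ => eapply d_plus; dv
  | |- is_derive (fun x => _ - _) _ _ => eapply d_minus; dv
  | |- is_derive (fun x => - _) _ _ => eapply d_opp; dv
  | |- is_derive (fun x => _ * _) _ _ => eapply d_mult; dv
  | |- is_derive (fun x => _ / _) _ _ => unfold Rdiv; eapply d_mult; dv
  | |- is_derive (fun x => / _) _ _ => eapply d_inv; [ | dv ]
  | |- is_derive (fun x => _ ^ _) _ _ => eapply d_pow; dv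
  | |- _ => idtac
  end ].

Section Comparison.
Context (k : nat) (p q : R) (hq : 0 < q) (hpq : q < p).

Local Notation d := (INR k + 1).
Local Notation f := (nonlin p q).
Local Notation F := (prim p q).
Local Notation beta := (zero_of_prim p q).
Local Notation wt x := (x ^ S k).

Lemma wt_pos x : 0 < x -> 0 < wt x.
Proof. apply pow_lt. Qed.

Lemma wt_lt x y : 0 < x -> x < y -> wt x < wt y.
Proof.
  intros Hx Hy. simpl. assert (H := pow_incr x y k ltac:(lra)).
  assert (0 < x ^ k) by now apply pow_lt. nra.
Qed.

Lemma wt_le x y : 0 < x -> x <= y -> wt x <= wt y.
Proof. intros Hx Hy. apply pow_incr. lra. Qed.

Lemma d_ge_1 : 1 <= d.
Proof. generalize (pos_INR k). lra. Qed.

Lemma wt_derive (r : R -> R) (s l : R) : r s <> 0 -> is_derive r s l ->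
  is_derive (fun s => wt (r s)) s (d * wt (r s) * l / r s).
Proof.
  intros H0 Hr. apply (derive_val _ _ _ _ (d_pow r (S k) s l Hr)).
  rewrite S_INR. simpl pred. simpl pow. field. exact H0.
Qed.

Section OneBranch.
Context (sg M : R) (r V : R -> R) (br : branch k p q sg M r V).

Lemma branch_V_nz s : 0 < s < M -> V s <> 0.
Proof. intros Hs E. assert (H := br_V _ _ _ _ _ _ _ br s Hs). rewrite E in H. lra. Qed.

Lemma branch_wt_derive s : 0 < s < M ->
  is_derive (fun s => wt (r s)) s (d * wt (r s) / (r s * V s)).
Proof.
  intros Hs. assert (Hr := br_r _ _ _ _ _ _ _ br s ltac:(lra)). assert (HV := branch_V_nz s Hs).
  eapply derive_val.
  - apply wt_derive; [ lra | apply (br_dr _ _ _ _ _ _ _ br s Hs) ].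
  - field. lra.
Qed.

(** The weight [r^(2(n-1))] is the one that cancels the terms in [V^2], so on a rising branch the
    rate has the sign of [F]. *)
Lemma weighted_energy_derive s : 0 < s < M ->
  is_derive (fun s => wt (r s) ^ 2 * (V s ^ 2 + 2 * F s)) s
    (4 * d * F s * (wt (r s) ^ 2 / (r s * V s))).
Proof.
  intros Hs. assert (Hr := br_r _ _ _ _ _ _ _ br s ltac:(lra)). assert (HV := branch_V_nz s Hs).
  assert (H1 := branch_wt_derive s Hs). assert (H2 := br_dV _ _ _ _ _ _ _ br s Hs).
  assert (H3 := prim_derive p q hq hpq s (proj1 Hs)).
  eapply derive_val; [ dv | ]. simpl pred. simpl (INR 2).
  cbv beta. generalize (wt (r s)); intros w. field. lra.
Qed.

Lemma flux_derive s : 0 < s < M ->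
  is_derive (fun s => wt (r s) * V s) s (- (wt (r s) * f s / V s)).
Proof.
  intros Hs. assert (Hr := br_r _ _ _ _ _ _ _ br s ltac:(lra)). assert (HV := branch_V_nz s Hs).
  assert (H1 := branch_wt_derive s Hs). assert (H2 := br_dV _ _ _ _ _ _ _ br s Hs).
  eapply derive_val; [ dv | ]. cbv beta. generalize (wt (r s)); intros w. field. lra.
Qed.

(** Squaring removes the slope from the rate: only the radius and [f s] are left. *)
Lemma flux_sq_derive s : 0 < s < M ->
  is_derive (fun s => (wt (r s) * V s) ^ 2) s (- (2 * wt (r s) ^ 2 * f s)).
Proof.
  intros Hs. assert (HV := branch_V_nz s Hs).
  assert (H1 := flux_derive s Hs).
  eapply derive_val; [ dv | ]. simpl pred. simpl (INR 2).
  cbv beta. generalize (wt (r s)); intros w. field. exact HV.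
Qed.

End OneBranch.

Section Rising.
Context (a M1 M2 : R) (r1 V1 r2 V2 : R -> R).
Context (br1 : branch k p q 1 M1 r1 V1) (br2 : branch k p q 1 M2 r2 V2).
Context (Ha : 0 < a) (Hr1 : r1 0 = a) (Hr2 : r2 0 = a).
Context (cr1 : continuous r1 0) (cr2 : continuous r2 0).
Context (cV1 : continuous V1 0) (cV2 : continuous V2 0).
Context (HV0 : 0 < V1 0) (HV : V1 0 < V2 0).

Let cr1' s : 0 <= s <= M1 -> continuous r1 s.
Proof.
  intros Hs. destruct (Req_dec s 0) as [->|]; [ exact cr1 | ].
  apply (br_cr _ _ _ _ _ _ _ br1). lra.
Qed.
Let cr2' s : 0 <= s <= M2 -> continuous r2 s.
Proof.
  intros Hs. destruct (Req_dec s 0) as [->|]; [ exact cr2 | ].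
  apply (br_cr _ _ _ _ _ _ _ br2). lra.
Qed.
Let cV1' s : 0 <= s <= M1 -> continuous V1 s.
Proof.
  intros Hs. destruct (Req_dec s 0) as [->|]; [ exact cV1 | ].
  apply (br_cV _ _ _ _ _ _ _ br1). lra.
Qed.
Let cV2' s : 0 <= s <= M2 -> continuous V2 s.
Proof.
  intros Hs. destruct (Req_dec s 0) as [->|]; [ exact cV2 | ].
  apply (br_cV _ _ _ _ _ _ _ br2). lra.
Qed.

Lemma rising_r y : 0 < y <= M1 -> y <= M2 ->
  (forall x, 0 <= x < y -> V1 x < V2 x) -> r2 y < r1 y.
Proof.
  intros Hy1 Hy2 HVy.
  assert (r1 0 - r2 0 < r1 y - r2 y); [ | lra ].
  apply (lt_of_deriv (fun s => r1 s - r2 s) (fun s => / V1 s - / V2 s)); [ lra | | | ].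
  - intros x Hx. ctn; [ apply cr1' | apply cr2' ]; lra.
  - intros x Hx. apply d_minus; [ apply (br_dr _ _ _ _ _ _ _ br1) | apply (br_dr _ _ _ _ _ _ _ br2) ]; lra.
  - intros x Hx. assert (H1 := br_V _ _ _ _ _ _ _ br1 x ltac:(lra)).
    specialize (HVy x ltac:(lra)).
    assert (/ V2 x < / V1 x) by (apply Rinv_lt_contravar; nra). lra.
Qed.

(** At height 0 radius and potential agree, so the steeper branch has the larger weighted energy.
    Below [beta] both decrease since [F <= 0], but the second branch has smaller radius and larger
    slope, hence smaller [r^(2n-3) / V], and loses less. *)
Lemma rising_weighted_energy y : 0 < y <= M1 -> y <= M2 -> y <= beta ->
  (forall x, 0 <= x < y -> V1 x < V2 x) ->
  wt (r1 y) ^ 2 * (V1 y ^ 2 + 2 * F y) < wt (r2 y) ^ 2 * (V2 y ^ 2 + 2 * F y).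
Proof.
  intros Hy1 Hy2 Hyb HVy.
  set (L1 := fun s => wt (r1 s) ^ 2 * (V1 s ^ 2 + 2 * F s)).
  set (L2 := fun s => wt (r2 s) ^ 2 * (V2 s ^ 2 + 2 * F s)).
  assert (H0 : L1 0 < L2 0).
  { unfold L1, L2. rewrite Hr1, Hr2, prim_0 by assumption.
    assert (0 < wt a) by now apply wt_pos.
    apply Rmult_lt_compat_l; [ nra | ]. nra. }
  assert (H1 : L2 0 - L1 0 <= L2 y - L1 y).
  { apply (le_of_deriv (fun s => L2 s - L1 s)
      (fun s => 4 * d * F s * (wt (r2 s) ^ 2 / (r2 s * V2 s))
                - 4 * d * F s * (wt (r1 s) ^ 2 / (r1 s * V1 s)))); [ lra | | | ].
    - intros x Hx. unfold L1, L2.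
      assert (continuous F x) by now apply prim_continuous.
      ctn; first [ apply cr1' | apply cr2' | apply cV1' | apply cV2' ]; lra.
    - intros x Hx. apply d_minus; [ apply (weighted_energy_derive _ _ _ _ br2)
        | apply (weighted_energy_derive _ _ _ _ br1) ]; lra.
    - intros x Hx.
      assert (Hr : r2 x < r1 x) by (apply rising_r; try lra; intros; apply HVy; lra).
      assert (Hp := br_r _ _ _ _ _ _ _ br2 x ltac:(lra)).
      assert (HV1 := br_V _ _ _ _ _ _ _ br1 x ltac:(lra)).
      specialize (HVy x ltac:(lra)).
      assert (HF : F x <= 0) by (apply prim_le_0; auto; lra).
      assert (Hd := d_ge_1).
      assert (H2 : wt (r2 x) ^ 2 / (r2 x * V2 x) <= wt (r1 x) ^ 2 / (r1 x * V1 x)).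
      { assert (H3 : wt (r2 x) * r2 x ^ k <= wt (r1 x) * r1 x ^ k).
        { apply Rmult_le_compat.
          - left. now apply wt_pos.
          - left. now apply pow_lt.
          - apply wt_le; lra.
          - apply pow_incr. lra. }
        replace (wt (r2 x) ^ 2 / (r2 x * V2 x)) with (wt (r2 x) * r2 x ^ k / V2 x)
          by (simpl; field; lra).
        replace (wt (r1 x) ^ 2 / (r1 x * V1 x)) with (wt (r1 x) * r1 x ^ k / V1 x)
          by (simpl; field; lra).
        assert (0 < wt (r2 x) * r2 x ^ k).
        { apply Rmult_lt_0_compat; [ now apply wt_pos | now apply pow_lt ]. }
        unfold Rdiv. apply Rmult_le_compat; try lra.
        - left. apply Rinv_0_lt_compat. lra.
        - apply Rinv_le_contravar; lra. }
      assert (d * F x <= 0) by nra. nra. }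
  unfold L1, L2 in *. lra.
Qed.

(** At [beta] the weighted energy is the squared flux, because [F beta = 0]. Above it [f > 0], and
    the squared flux of the branch with smaller radius decreases more slowly. *)
Lemma rising_flux y : beta <= y <= M1 -> y <= M2 ->
  (forall x, 0 <= x < y -> V1 x < V2 x) ->
  0 < (wt (r2 beta) * V2 beta) ^ 2 - (wt (r1 beta) * V1 beta) ^ 2
    <= (wt (r2 y) * V2 y) ^ 2 - (wt (r1 y) * V1 y) ^ 2.
Proof.
  intros Hy1 Hy2 HVy. assert (Hb := beta_gt_1 p q hq hpq). split.
  - assert (H := rising_weighted_energy beta ltac:(lra) ltac:(lra) ltac:(lra)).
    rewrite prim_beta in H by assumption.
    specialize (H ltac:(intros; apply HVy; lra)). rewrite !Rpow_mult_distr. lra.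
  - apply (le_of_deriv (fun y => (wt (r2 y) * V2 y) ^ 2 - (wt (r1 y) * V1 y) ^ 2)
      (fun s => - (2 * wt (r2 s) ^ 2 * f s) - - (2 * wt (r1 s) ^ 2 * f s))); [ lra | | | ].
    + intros x Hx. ctn; first [ apply cr1' | apply cr2' | apply cV1' | apply cV2' ]; lra.
    + intros x Hx. apply d_minus; [ apply (flux_sq_derive _ _ _ _ br2)
        | apply (flux_sq_derive _ _ _ _ br1) ]; lra.
    + intros x Hx.
      assert (Hr : r2 x < r1 x) by (apply rising_r; try lra; intros; apply HVy; lra).
      assert (Hp := br_r _ _ _ _ _ _ _ br2 x ltac:(lra)).
      assert (Hf : 0 < f x) by (apply nonlin_pos; lra).
      assert (Hw := wt_lt _ _ Hp Hr). assert (Hw0 := wt_pos _ Hp).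
      assert (wt (r2 x) ^ 2 <= wt (r1 x) ^ 2) by (apply pow_incr; lra). nra.
Qed.

(** At a first height of equal slopes the second radius is smaller, so its weighted energy (below
    [beta]) or squared flux (above) is at most that of the first branch, contrary to the two
    previous lemmas. *)
Lemma rising_slopes y : 0 <= y < Rmin M1 M2 -> V1 y < V2 y.
Proof.
  intros Hy. assert (Hm1 := Rmin_l M1 M2). assert (Hm2 := Rmin_r M1 M2).
  assert (0 < V2 y - V1 y); [ | lra ].
  apply (first_crossing (fun s => V2 s - V1 s) 0 (Rmin M1 M2)); [ | lra | | exact Hy ].
  - intros x Hx. ctn; [ apply cV2' | apply cV1' ]; lra.
  - intros x Hx E Hpos.
    assert (HVx : forall z, 0 <= z < x -> V1 z < V2 z).
    { intros z Hz. specialize (Hpos z Hz). simpl in Hpos. lra. }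
    assert (Hr := rising_r x ltac:(lra) ltac:(lra) HVx).
    assert (Hp := br_r _ _ _ _ _ _ _ br2 x ltac:(lra)).
    assert (Hw := wt_lt _ _ Hp Hr). assert (Hw0 := wt_pos _ Hp).
    assert (wt (r2 x) ^ 2 <= wt (r1 x) ^ 2) by (apply pow_incr; lra).
    destruct (Rle_lt_dec x beta) as [Hb|Hb].
    + assert (H1 := rising_weighted_energy x ltac:(lra) ltac:(lra) Hb HVx).
      assert (He := br_energy _ _ _ _ _ _ _ br2 x ltac:(lra)).
      replace (V1 x) with (V2 x) in H1 by lra. nra.
    + assert (H1 := rising_flux x ltac:(lra) ltac:(lra) HVx).
      replace (V1 x) with (V2 x) in H1 by lra.
      rewrite !(Rpow_mult_distr _ (V2 x)) in H1.
      assert (0 <= V2 x ^ 2) by apply pow2_ge_0. nra.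
Qed.

Lemma rising_comparison :
  M1 < M2 /\ (forall s, 0 <= s < M1 -> V1 s < V2 s) /\
  (forall s, 0 < s <= M1 -> r2 s < r1 s) /\
  wt (r1 beta) * V1 beta < wt (r2 beta) * V2 beta.
Proof.
  assert (Hb := beta_gt_1 p q hq hpq).
  assert (Hb1 := br_beta _ _ _ _ _ _ _ br1). assert (Hb2 := br_beta _ _ _ _ _ _ _ br2).
  assert (HM : M1 < M2).
  { destruct (Rlt_le_dec M1 M2) as [|HM]; [ assumption | exfalso ].
    (* At its own top the flux of the second branch is 0 and cannot dominate. *)
    assert (H := rising_flux M2 ltac:(lra) ltac:(lra)).
    specialize (H ltac:(intros x Hx; apply rising_slopes; rewrite Rmin_right; lra)).
    rewrite (br_top _ _ _ _ _ _ _ br2) in H.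
    assert (0 <= (wt (r1 M2) * V1 M2) ^ 2) by apply pow2_ge_0.
    rewrite Rmult_0_r in H. lra. }
  assert (HVs : forall s, 0 <= s < M1 -> V1 s < V2 s).
  { intros s Hs. apply rising_slopes. rewrite Rmin_left; lra. }
  split; [ exact HM | split; [ exact HVs | split ] ].
  - intros s Hs. apply rising_r; try lra. intros x Hx. apply HVs. lra.
  - assert (H := rising_flux beta ltac:(lra) ltac:(lra) ltac:(intros; apply HVs; lra)).
    assert (0 < wt (r2 beta) * V2 beta).
    { apply Rmult_lt_0_compat.
      - apply wt_pos, (br_r _ _ _ _ _ _ _ br2). lra.
      - rewrite <- (Rmult_1_l (V2 beta)). apply (br_V _ _ _ _ _ _ _ br2). lra. }
    nra.
Qed.

End Rising.
End Comparison.

(** * The maximum and the falling branches *)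

Section Top.
Context (k : nat) (p q : R) (hq : 0 < q) (hpq : q < p).
Context (hsub : subcritical p q (INR k + 2)).

Local Notation d := (INR k + 1).
Local Notation f := (nonlin p q).
Local Notation F := (prim p q).
Local Notation beta := (zero_of_prim p q).
Local Notation wt x := (x ^ S k).
Local Notation branch := (branch k p q).

Definition radial_energy (r V : R -> R) (s : R) : R :=
  r s * wt (r s) * (V s ^ 2 + 2 * F s).

(** The Pohozaev functional [r^n (u'^2 + 2 F) + 2 n r^(n-1) u' F / f]. *)
Definition pohozaev (r V : R -> R) (s : R) : R :=
  radial_energy r V s + 2 * (INR k + 2) * (wt (r s) * V s) * (F s / f s).

Section OneBranch.
Context (sg M : R) (r V : R -> R) (br : branch sg M r V).

Lemma radial_energy_derive s : 0 < s < M ->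
  is_derive (radial_energy r V) s
    (wt (r s) * V s * (- INR k + 2 * (INR k + 2) * F s / V s ^ 2)).
Proof.
  intros Hs. assert (Hr := br_r _ _ _ _ _ _ _ br s ltac:(lra)).
  assert (HV := branch_V_nz _ _ _ _ _ _ _ br s Hs).
  assert (H1 := branch_wt_derive _ _ _ _ _ _ _ br s Hs).
  assert (H2 := br_dV _ _ _ _ _ _ _ br s Hs). assert (H2' := br_dr _ _ _ _ _ _ _ br s Hs).
  assert (H3 := prim_derive p q hq hpq s (proj1 Hs)).
  unfold radial_energy.
  eapply derive_val; [ dv | ]. simpl pred. simpl (INR 2). cbv beta.
  generalize (wt (r s)); intros w. field. lra.
Qed.

(** The added term is chosen so that differentiating its flux cancels the term [2 n F / V^2] in the
    rate of [radial_energy]; what remains is the flux times [2 n (F / f)' - (n - 2)]. The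
    restriction [s > 1] keeps [f] positive. *)
Lemma pohozaev_derive s : 1 < s < M ->
  is_derive (pohozaev r V) s
    (wt (r s) * V s *
     ((2 * (INR k + 2) * (f s ^ 2 - F s * dnonlin p q s) - (INR k + 2 - 2) * f s ^ 2) / f s ^ 2)).
Proof.
  intros Hs. assert (Hs' : 0 < s < M) by lra.
  assert (HV := branch_V_nz _ _ _ _ _ _ _ br s Hs').
  assert (H1 := radial_energy_derive s Hs').
  assert (H2 := flux_derive _ _ _ _ _ _ _ br s Hs').
  assert (H3 := prim_derive p q hq hpq s (proj1 Hs')).
  assert (H4 := nonlin_derive p q s (proj1 Hs')).
  assert (Hf : 0 < f s) by (apply nonlin_pos; lra).
  unfold pohozaev.
  eapply derive_val; [ apply d_plus; [ exact H1 | ];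
    apply (d_mult (fun s => 2 * (INR k + 2) * (wt (r s) * V s)) (fun s => F s / f s));
    [ apply (d_mult (fun _ => 2 * (INR k + 2))); [ apply d_const | exact H2 ]
    | unfold Rdiv; eapply d_mult; [ exact H3 | eapply d_inv; [ lra | exact H4 ] ] ] | ].
  cbv beta. generalize (wt (r s)); intros w. field. lra.
Qed.

Lemma radial_energy_continuous s : 0 < s <= M -> continuous (radial_energy r V) s.
Proof.
  intros Hs. unfold radial_energy.
  assert (H1 := br_cr _ _ _ _ _ _ _ br s Hs). assert (H2 := br_cV _ _ _ _ _ _ _ br s Hs).
  assert (H3 := prim_continuous p q hq hpq s).
  ctn.
Qed.

Lemma pohozaev_continuous s : 1 < s <= M -> continuous (pohozaev r V) s.
Proof.
  intros Hs.
  assert (H0 := radial_energy_continuous s ltac:(lra)).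
  assert (H1 := br_cr _ _ _ _ _ _ _ br s ltac:(lra)).
  assert (H2 := br_cV _ _ _ _ _ _ _ br s ltac:(lra)).
  assert (H3 := prim_continuous p q hq hpq s). assert (H4 := nonlin_continuous p q hq hpq s).
  assert (Hf : 0 < f s) by (apply nonlin_pos; lra).
  unfold pohozaev. apply cont_plus; [ exact H0 | ]. ctn. lra.
Qed.

(** The factor [sg] makes this one statement about the radius: on both branches [pohozaev] does not
    decrease as the radius grows. *)
Lemma pohozaev_monotone x y : 1 < x -> x <= y -> y <= M ->
  sg * pohozaev r V x <= sg * pohozaev r V y.
Proof.
  intros Hx Hxy Hy.
  apply (le_of_deriv (fun s => sg * pohozaev r V s) (fun s => sg * (wt (r s) * V s *
     ((2 * (INR k + 2) * (f s ^ 2 - F s * dnonlin p q s) - (INR k + 2 - 2) * f s ^ 2) / f s ^ 2))) x y Hxy).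
  - intros s Hs. apply cont_mult; [ apply continuous_const | apply pohozaev_continuous; lra ].
  - intros s Hs. eapply derive_val.
    + apply d_mult; [ apply d_const | apply pohozaev_derive; lra ].
    + cbv beta. ring.
  - intros s Hs. assert (HV := br_V _ _ _ _ _ _ _ br s ltac:(lra)).
    assert (Hr := wt_pos k _ (br_r _ _ _ _ _ _ _ br s ltac:(lra))).
    assert (Hf : 0 < f s) by (apply nonlin_pos; lra).
    replace (sg * (wt (r s) * V s * _)) with (wt (r s) * (sg * V s) *
     ((2 * (INR k + 2) * (f s ^ 2 - F s * dnonlin p q s) - (INR k + 2 - 2) * f s ^ 2) / f s ^ 2))
      by ring.
    apply Rmult_le_pos; [ nra | ]. apply Rmult_le_pos; [ apply hsub; lra | ].
    left. apply Rinv_0_lt_compat. nra.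
Qed.

Lemma pohozaev_top : pohozaev r V M = radial_energy r V M.
Proof. unfold pohozaev. rewrite (br_top _ _ _ _ _ _ _ br). ring. Qed.

End OneBranch.

(** * Comparison of the Pohozaev functionals of two branches *)

Section TwoBranches.
Context (sg M1 M2 : R) (r1 V1 r2 V2 : R -> R).
Context (br1 : branch sg M1 r1 V1) (br2 : branch sg M2 r2 V2) (HM : M1 < M2).

Local Notation T s := (wt (r1 s) * V1 s / (wt (r2 s) * V2 s)).

Let flux2_nz s : 0 < s < M2 -> wt (r2 s) * V2 s <> 0.
Proof.
  intros Hs. apply Rmult_integral_contrapositive_currified.
  - apply Rgt_not_eq, wt_pos, (br_r _ _ _ _ _ _ _ br2). lra.
  - apply (branch_V_nz _ _ _ _ _ _ _ br2 s Hs).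
Qed.

(** With [T] the quotient of the fluxes [r^(n-1) u'], the terms containing
    [F / f] cancel in [pohozaev_1 - T * pohozaev_2], whose derivative is
    [- T' * pohozaev_2]. *)
Lemma comparison_derive c s : 1 < s < M1 ->
  is_derive (fun s => radial_energy r1 V1 s - T s * (radial_energy r2 V2 s - c)) s
    (T s * f s * (/ V1 s ^ 2 - / V2 s ^ 2) * (pohozaev r2 V2 s - c)).
Proof.
  intros Hs.
  assert (H1 := radial_energy_derive _ _ _ _ br1 s ltac:(lra)).
  assert (H2 := radial_energy_derive _ _ _ _ br2 s ltac:(lra)).
  assert (H3 := flux_derive _ _ _ _ _ _ _ br1 s ltac:(lra)).
  assert (H4 := flux_derive _ _ _ _ _ _ _ br2 s ltac:(lra)).
  assert (Hz := flux2_nz s ltac:(lra)).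
  assert (HV1 := branch_V_nz _ _ _ _ _ _ _ br1 s ltac:(lra)).
  assert (HV2 := branch_V_nz _ _ _ _ _ _ _ br2 s ltac:(lra)).
  assert (Hf : 0 < f s) by (apply nonlin_pos; lra).
  assert (Hw2 := wt_pos k _ (br_r _ _ _ _ _ _ _ br2 s ltac:(lra))).
  eapply derive_val.
  - apply d_minus; [ exact H1 | ].
    apply (d_mult (fun s => T s) (fun s => radial_energy r2 V2 s - c)).
    + unfold Rdiv. apply d_mult; [ exact H3 | ]. apply d_inv; [ exact Hz | exact H4 ].
    + apply d_minus; [ exact H2 | apply d_const ].
  - cbv beta. unfold pohozaev. generalize (radial_energy r2 V2 s); intros e2.
    revert Hw2. generalize (wt (r1 s)) (wt (r2 s)); intros w1 w2 Hw2. field. repeat split; lra.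
Qed.

Lemma comparison_continuous c s : 0 < s <= M1 ->
  continuous (fun s => radial_energy r1 V1 s - T s * (radial_energy r2 V2 s - c)) s.
Proof.
  intros Hs.
  assert (H1 := radial_energy_continuous _ _ _ _ br1 s ltac:(lra)).
  assert (H2 := radial_energy_continuous _ _ _ _ br2 s ltac:(lra)).
  assert (H3 := br_cr _ _ _ _ _ _ _ br1 s ltac:(lra)).
  assert (H4 := br_cV _ _ _ _ _ _ _ br1 s ltac:(lra)).
  assert (H5 := br_cr _ _ _ _ _ _ _ br2 s ltac:(lra)).
  assert (H6 := br_cV _ _ _ _ _ _ _ br2 s ltac:(lra)).
  ctn. apply flux2_nz. lra.
Qed.

(** The sign [e] covers both branches: [e = 1] on the rising one, where
    [pohozaev_2 <= c], and [e = -1] on the falling one, where [c <= pohozaev_2]. *)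
Lemma comparison_monotone c e y : 1 < y < M1 ->
  (forall s, y < s < M1 -> V1 s ^ 2 < V2 s ^ 2) ->
  (forall s, y < s < M1 -> 0 <= e * (c - pohozaev r2 V2 s)) ->
  e * radial_energy r1 V1 M1
    <= e * (radial_energy r1 V1 y - T y * (radial_energy r2 V2 y - c)).
Proof.
  intros Hy HVs Hc.
  assert (H : - e * (radial_energy r1 V1 y - T y * (radial_energy r2 V2 y - c))
     <= - e * (radial_energy r1 V1 M1 - T M1 * (radial_energy r2 V2 M1 - c))).
  { apply (le_of_deriv (fun s => - e * (radial_energy r1 V1 s - T s * (radial_energy r2 V2 s - c)))
      (fun s => - e * (T s * f s * (/ V1 s ^ 2 - / V2 s ^ 2) * (pohozaev r2 V2 s - c)))).
    - lra.
    - intros s Hs. apply (cont_mult (fun _ => - e)); [ apply continuous_const | ].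
      apply comparison_continuous. lra.
    - intros s Hs. eapply derive_val.
      + apply (d_mult (fun _ => - e)); [ apply d_const | apply (comparison_derive c); lra ].
      + cbv beta. ring.
    - intros s Hs. specialize (HVs s Hs). specialize (Hc s Hs).
      assert (Hf : 0 < f s) by (apply nonlin_pos; lra).
      assert (HV1 := br_V _ _ _ _ _ _ _ br1 s ltac:(lra)).
      assert (HV2 := br_V _ _ _ _ _ _ _ br2 s ltac:(lra)).
      assert (HT : 0 < T s).
      { assert (Hw1 := wt_pos k _ (br_r _ _ _ _ _ _ _ br1 s ltac:(lra))).
        assert (Hw2 := wt_pos k _ (br_r _ _ _ _ _ _ _ br2 s ltac:(lra))).
        assert (sg <> 0) by (intros E; rewrite E in HV1; lra).
        assert (V2 s <> 0) by (intros E; rewrite E in HV2; lra).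
        replace (T s) with (wt (r1 s) * (sg * V1 s) / (wt (r2 s) * (sg * V2 s))).
        - apply Rdiv_lt_0_compat; apply Rmult_lt_0_compat; assumption.
        - revert Hw1 Hw2. generalize (wt (r1 s)) (wt (r2 s)). intros w1 w2 ? ?. field. lra. }
      assert (0 < V1 s ^ 2).
      { assert (V1 s <> 0) by (intros E; rewrite E in HV1; lra).
        rewrite <- Rsqr_pow2. now apply Rlt_0_sqr. }
      assert (/ V2 s ^ 2 < / V1 s ^ 2) by (apply Rinv_lt_contravar; nra).
      replace (- e * _) with (T s * f s * (/ V1 s ^ 2 - / V2 s ^ 2) * (e * (c - pohozaev r2 V2 s)))
        by ring.
      apply Rmult_le_pos; [ | exact Hc ]. apply Rmult_le_pos; [ | lra ].
      left. now apply Rmult_lt_0_compat. }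
  rewrite (br_top _ _ _ _ _ _ _ br1) in H.
  replace (wt (r1 M1) * 0 / (wt (r2 M1) * V2 M1)) with 0 in H by (unfold Rdiv; ring).
  lra.
Qed.

End TwoBranches.

Section RisingTop.
Context (M1 M2 : R) (r1 V1 r2 V2 : R -> R).
Context (br1 : branch 1 M1 r1 V1) (br2 : branch 1 M2 r2 V2).
Context (HM : M1 < M2) (HV : forall s, 0 <= s < M1 -> V1 s < V2 s)
  (Hr : forall s, 0 < s <= M1 -> r2 s < r1 s)
  (Hw : wt (r1 beta) * V1 beta < wt (r2 beta) * V2 beta).

(** The comparison runs from [M1] down to [beta] with [c = pohozaev r2 V2 M1], which bounds
    [pohozaev r2 V2] on that range. At [beta] the radial energies are [r^n V^2], and the order of
    [r V] makes [radial_energy r1 V1 - T * radial_energy r2 V2] negative. This leaves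
    [radial_energy r1 V1 M1 < T * c] with [T < 1]. *)
Lemma rising_pohozaev : 0 < radial_energy r1 V1 M1 < pohozaev r2 V2 M1.
Proof.
  assert (Hb := beta_gt_1 p q hq hpq). assert (Hb1 := br_beta _ _ _ _ _ _ _ br1).
  assert (H := comparison_monotone 1 M1 M2 r1 V1 r2 V2 br1 br2 HM (pohozaev r2 V2 M1) 1 beta ltac:(lra)).
  specialize (H ltac:(intros s Hs; assert (H1 := br_V _ _ _ _ _ _ _ br1 s ltac:(lra));
    specialize (HV s ltac:(lra)); nra)).
  specialize (H ltac:(intros s Hs; assert (H1 := pohozaev_monotone 1 M2 r2 V2 br2 s M1
     ltac:(lra) ltac:(lra) ltac:(lra)); lra)).
  assert (Hp1 := br_r _ _ _ _ _ _ _ br1 beta ltac:(lra)).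
  assert (Hp2 := br_r _ _ _ _ _ _ _ br2 beta ltac:(lra)).
  assert (HV1 := br_V _ _ _ _ _ _ _ br1 beta ltac:(lra)).
  assert (HV2 := br_V _ _ _ _ _ _ _ br2 beta ltac:(lra)).
  assert (Hrb := Hr beta ltac:(lra)).
  assert (Hw1 := wt_pos k _ Hp1). assert (Hw2 := wt_pos k _ Hp2).
  (* [r V] is the flux divided by [r^k]; the division preserves the order of the fluxes, since the
     second radius is smaller. *)
  assert (Hy : r1 beta * V1 beta < r2 beta * V2 beta).
  { destruct (Rlt_le_dec (r1 beta * V1 beta) (r2 beta * V2 beta)) as [|Hn]; [ assumption | exfalso ].
    assert (Hk := pow_incr (r2 beta) (r1 beta) k ltac:(lra)).
    assert (0 < r2 beta ^ k) by now apply pow_lt.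
    assert (wt (r2 beta) * V2 beta <= wt (r1 beta) * V1 beta); [ simpl | lra ].
    replace (r2 beta * r2 beta ^ k * V2 beta) with (r2 beta ^ k * (r2 beta * V2 beta)) by ring.
    replace (r1 beta * r1 beta ^ k * V1 beta) with (r1 beta ^ k * (r1 beta * V1 beta)) by ring.
    apply Rmult_le_compat; try lra. nra. }
  assert (Htop : 0 < radial_energy r1 V1 M1).
  { unfold radial_energy. rewrite (br_top _ _ _ _ _ _ _ br1).
    assert (Hp := br_r _ _ _ _ _ _ _ br1 M1 ltac:(lra)).
    assert (HwM := wt_pos k _ Hp). assert (HF := prim_pos p q hq hpq M1 Hb1).
    apply Rmult_lt_0_compat; nra. }
  split; [ exact Htop | ].
  set (T := wt (r1 beta) * V1 beta / (wt (r2 beta) * V2 beta)) in *.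
  assert (HT : 0 < T < 1).
  { split; unfold T.
    - apply Rdiv_lt_0_compat; nra.
    - apply Rmult_lt_reg_r with (wt (r2 beta) * V2 beta); [ nra | ].
      unfold Rdiv. rewrite Rmult_assoc, Rinv_l; nra. }
  assert (HX : radial_energy r1 V1 beta - T * radial_energy r2 V2 beta < 0).
  { unfold radial_energy, T. rewrite prim_beta by assumption.
    replace (_ - _) with (wt (r1 beta) * V1 beta * (r1 beta * V1 beta - r2 beta * V2 beta)).
    - assert (0 < wt (r1 beta) * V1 beta) by nra. nra.
    - revert Hw2. generalize (wt (r1 beta)) (wt (r2 beta)); intros w1 w2 Hw2. field. lra. }
  assert (H1 : radial_energy r1 V1 M1 < T * pohozaev r2 V2 M1) by lra.
  assert (0 < pohozaev r2 V2 M1) by nra. nra.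
Qed.

End RisingTop.

Section Falling.
Context (M1 M2 : R) (r1 V1 r2 V2 : R -> R).
Context (br1 : branch (-1) M1 r1 V1) (br2 : branch (-1) M2 r2 V2).
Context (HM : M1 < M2).
Context (Htop : 0 < radial_energy r1 V1 M1 < pohozaev r2 V2 M1).

Let Hneg1 s : 0 < s < M1 -> V1 s < 0.
Proof. intros Hs. assert (H := br_V _ _ _ _ _ _ _ br1 s Hs). lra. Qed.
Let Hneg2 s : 0 < s < M2 -> V2 s < 0.
Proof. intros Hs. assert (H := br_V _ _ _ _ _ _ _ br2 s Hs). lra. Qed.

Let comparison y : 1 < y < M1 -> (forall s, y < s < M1 -> V2 s < V1 s) ->
  radial_energy r1 V1 y - wt (r1 y) * V1 y / (wt (r2 y) * V2 y) *
    (radial_energy r2 V2 y - pohozaev r2 V2 M1) < pohozaev r2 V2 M1.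
Proof.
  intros Hy HV.
  assert (H := comparison_monotone (-1) M1 M2 r1 V1 r2 V2 br1 br2 HM (pohozaev r2 V2 M1) (-1) y Hy).
  specialize (H ltac:(intros s Hs; specialize (HV s Hs); specialize (Hneg1 s ltac:(lra)); nra)).
  specialize (H ltac:(intros s Hs; assert (H1 := pohozaev_monotone (-1) M2 r2 V2 br2 s M1
     ltac:(lra) ltac:(lra) ltac:(lra)); lra)).
  lra.
Qed.

(** At equal slopes the terms [f / V] cancel, so [V1 - V2] has derivative [d / r2 - d / r1]. It
    cannot be negative, because the difference is positive to the right. *)
Let crossing y x1 : 0 < y < M1 -> y < x1 <= M1 -> V1 y - V2 y = 0 ->
  (forall x, y < x <= x1 -> 0 < V1 x - V2 x) -> r2 y <= r1 y.
Proof.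
  intros Hy Hx1 E Hpos.
  assert (Hd : is_derive (fun s => V1 s - V2 s) y
     ((- (d / r1 y) - f y / V1 y) - (- (d / r2 y) - f y / V2 y))).
  { apply d_minus; [ apply (br_dV _ _ _ _ _ _ _ br1) | apply (br_dV _ _ _ _ _ _ _ br2) ]; lra. }
  apply (derive_nonneg_at_zero _ y x1) in Hd; [ | lra | exact E | ].
  - replace (V1 y) with (V2 y) in Hd by lra.
    assert (Hp1 := br_r _ _ _ _ _ _ _ br1 y ltac:(lra)).
    assert (Hp2 := br_r _ _ _ _ _ _ _ br2 y ltac:(lra)).
    assert (Hd1 := d_ge_1 k).
    assert (H : d / r1 y <= d / r2 y) by lra.
    apply (Rmult_le_compat_r (r1 y * r2 y)) in H; [ | nra ].
    replace (d / r1 y * (r1 y * r2 y)) with (d * r2 y) in H by (field; lra).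
    replace (d / r2 y * (r1 y * r2 y)) with (d * r1 y) in H by (field; lra).
    apply Rmult_le_reg_l with d; lra.
  - intros x Hx. apply Hpos. lra.
Qed.

(** Coming down from [M1], at the first height of equal slopes [crossing] gives [r2 <= r1], so the
    flux quotient satisfies [T >= 1]. The functional in [comparison] then equals a nonnegative term
    plus [T * J], hence is at least [J], a contradiction. *)
Lemma falling_above_beta y : beta <= y < M1 -> V2 y < V1 y.
Proof.
  intros Hy. assert (Hb := beta_gt_1 p q hq hpq).
  (* Carried down towards height 1, so that [beta] itself is covered. *)
  assert (Hnear : forall x, 1 < x <= M1 -> 0 < V1 x - V2 x).
  { apply (first_crossing_left (fun s => V1 s - V2 s)).
    - intros x Hx. apply cont_minus; [ apply (br_cV _ _ _ _ _ _ _ br1) | apply (br_cV _ _ _ _ _ _ _ br2) ]; lra.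
    - rewrite (br_top _ _ _ _ _ _ _ br1). assert (H := Hneg2 M1 ltac:(lra)). lra.
    - intros x Hx E Hpos.
      assert (Hr := crossing x M1 ltac:(lra) ltac:(lra) E Hpos).
      assert (H := comparison x Hx).
      specialize (H ltac:(intros s Hs; specialize (Hpos s ltac:(lra)); lra)).
      assert (Hp2 := br_r _ _ _ _ _ _ _ br2 x ltac:(lra)).
      assert (Hv := Hneg2 x ltac:(lra)).
      assert (He := br_energy _ _ _ _ _ _ _ br2 x ltac:(lra)).
      assert (Hw2 := wt_pos k _ Hp2). assert (Hw := wt_le k _ _ Hp2 Hr).
      replace (V1 x) with (V2 x) in H by lra.
      unfold radial_energy at 1 2 in H. replace (V1 x) with (V2 x) in H by lra.
      set (J := pohozaev r2 V2 M1) in *.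
      set (T := wt (r1 x) * V2 x / (wt (r2 x) * V2 x)) in *.
      assert (ET : T * wt (r2 x) = wt (r1 x)).
      { unfold T. revert Hw2. generalize (wt (r1 x)) (wt (r2 x)); intros w1 w2 Hw2. field. lra. }
      assert (HT : 1 <= T).
      { apply Rmult_le_reg_r with (wt (r2 x)); [ exact Hw2 | ]. rewrite ET. lra. }
      replace (_ - _) with (wt (r1 x) * (V2 x ^ 2 + 2 * F x) * (r1 x - r2 x) + T * J) in H
        by (rewrite <- ET; ring).
      assert (0 <= wt (r1 x) * (V2 x ^ 2 + 2 * F x) * (r1 x - r2 x)).
      { apply Rmult_le_pos; [ apply Rmult_le_pos | ]; lra. }
      nra. }
  specialize (Hnear y ltac:(lra)). lra.
Qed.

(** The start for the functional used below [beta]. If it failed, [|r2 V2| <= |r1 V1|] and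
    [|V2| > |V1|] would give [r2 <= r1], so the flux quotient would be at least 1, and the
    functional in [comparison] at least [J]. *)
Lemma falling_at_beta : r2 beta * V2 beta < r1 beta * V1 beta.
Proof.
  assert (Hb := beta_gt_1 p q hq hpq). assert (Hb1 := br_beta _ _ _ _ _ _ _ br1).
  destruct (Rlt_le_dec (r2 beta * V2 beta) (r1 beta * V1 beta)) as [|Hn]; [ assumption | exfalso ].
  assert (H := comparison beta ltac:(lra)).
  specialize (H ltac:(intros s Hs; apply falling_above_beta; lra)).
  assert (HV := falling_above_beta beta ltac:(lra)).
  assert (Hp1 := br_r _ _ _ _ _ _ _ br1 beta ltac:(lra)).
  assert (Hp2 := br_r _ _ _ _ _ _ _ br2 beta ltac:(lra)).
  assert (HV1 := Hneg1 beta ltac:(lra)). assert (HV2 := Hneg2 beta ltac:(lra)).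
  assert (Hw1 := wt_pos k _ Hp1). assert (Hw2 := wt_pos k _ Hp2).
  unfold radial_energy in H. rewrite prim_beta in H by assumption.
  set (J := pohozaev r2 V2 M1) in *.
  set (T := wt (r1 beta) * V1 beta / (wt (r2 beta) * V2 beta)) in *.
  assert (Hflux : wt (r1 beta) * V1 beta <= wt (r2 beta) * V2 beta).
  { assert (Hr : r2 beta <= r1 beta) by nra.
    assert (Hk := pow_incr (r2 beta) (r1 beta) k ltac:(lra)).
    assert (0 < r2 beta ^ k) by now apply pow_lt. simpl.
    replace (r2 beta * r2 beta ^ k * V2 beta) with (- (r2 beta ^ k * - (r2 beta * V2 beta))) by ring.
    replace (r1 beta * r1 beta ^ k * V1 beta) with (- (r1 beta ^ k * - (r1 beta * V1 beta))) by ring.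
    apply Ropp_le_contravar, Rmult_le_compat; try lra. nra. }
  assert (Hneg : wt (r2 beta) * V2 beta < 0) by nra.
  assert (HT : 1 <= T).
  { unfold T. replace (wt (r1 beta) * V1 beta / (wt (r2 beta) * V2 beta))
      with (- (wt (r1 beta) * V1 beta) / - (wt (r2 beta) * V2 beta)).
    - apply Rmult_le_reg_r with (- (wt (r2 beta) * V2 beta)); [ lra | ].
      unfold Rdiv. rewrite Rmult_assoc, Rinv_l; lra.
    - revert Hw2. generalize (wt (r1 beta)) (wt (r2 beta)); intros w1 w2 Hw2. field. lra. }
  replace (_ - _) with (wt (r1 beta) * V1 beta * (r1 beta * V1 beta - r2 beta * V2 beta) + T * J) in H.
  - assert (wt (r1 beta) * V1 beta < 0) by lra.
    assert (0 <= wt (r1 beta) * V1 beta * (r1 beta * V1 beta - r2 beta * V2 beta)) by nra. nra.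
  - unfold T. revert Hw2. generalize (wt (r1 beta)) (wt (r2 beta)); intros w1 w2 Hw2. field. lra.
Qed.

(** * The falling branches below [beta] *)

Definition scaled_speed (r V : R -> R) (s : R) : R := r s * sqrt (V s ^ 2 + 2 * F s).

(** The point of this functional is that its rate depends on [s] and [V] only,
    so that ordered slopes give ordered rates. *)
Lemma scaled_speed_derive sg M r V s : branch sg M r V -> 0 < s < M ->
  is_derive (scaled_speed r V) s
    ((- INR k * V s + 2 * F s / V s) / sqrt (V s ^ 2 + 2 * F s)).
Proof.
  intros br Hs. assert (Hr := br_r _ _ _ _ _ _ _ br s ltac:(lra)).
  assert (HV := branch_V_nz _ _ _ _ _ _ _ br s Hs).
  assert (He := br_energy _ _ _ _ _ _ _ br s ltac:(lra)).
  assert (H1 := br_dr _ _ _ _ _ _ _ br s Hs).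
  assert (H2 := br_dV _ _ _ _ _ _ _ br s Hs).
  assert (H3 := prim_derive p q hq hpq s (proj1 Hs)).
  assert (H4 : is_derive (fun s => V s ^ 2 + 2 * F s) s (- (2 * d * V s / r s))).
  { eapply derive_val; [ dv | ]. simpl pred. simpl (INR 2). cbv beta. field. lra. }
  assert (Hsq : 0 < sqrt (V s ^ 2 + 2 * F s)) by now apply sqrt_lt_R0.
  unfold scaled_speed.
  eapply derive_val.
  - apply d_mult; [ exact H1 | ].
    apply (is_derive_comp sqrt (fun s => V s ^ 2 + 2 * F s)); [ | exact H4 ].
    apply is_derive_Reals, derivable_pt_lim_sqrt. exact He.
  - change (scal (- (2 * d * V s / r s)) (/ (2 * sqrt (V s ^ 2 + 2 * F s))))
      with (- (2 * d * V s / r s) * (/ (2 * sqrt (V s ^ 2 + 2 * F s)))).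
    assert (E : sqrt (V s ^ 2 + 2 * F s) * sqrt (V s ^ 2 + 2 * F s) = V s ^ 2 + 2 * F s).
    { apply sqrt_sqrt. lra. }
    set (S := sqrt (V s ^ 2 + 2 * F s)) in *.
    replace (/ V s * S) with (S * S / (V s * S)) by (field; lra). rewrite E.
    field. lra.
Qed.

Lemma scaled_speed_continuous sg M r V s : branch sg M r V -> 0 < s <= M ->
  continuous (scaled_speed r V) s.
Proof.
  intros br Hs. unfold scaled_speed.
  assert (H1 := br_cr _ _ _ _ _ _ _ br s Hs). assert (H2 := br_cV _ _ _ _ _ _ _ br s Hs).
  assert (H3 := prim_continuous p q hq hpq s). ctn.
Qed.

(** With [c = - 2 F] the rate is [k |U| / sqrt (U^2 - c) + c / (|U| sqrt (U^2 - c))], and both terms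
    are nonincreasing in [|U|]. *)
Lemma scaled_speed_rate_le U1 U2 c : 0 <= c -> U2 < U1 < 0 -> c < U1 ^ 2 ->
  (- INR k * U2 + - c / U2) / sqrt (U2 ^ 2 + - c) <= (- INR k * U1 + - c / U1) / sqrt (U1 ^ 2 + - c).
Proof.
  intros Hc HU Hc1. assert (Hk := pos_INR k).
  assert (HU2 : U1 ^ 2 < U2 ^ 2) by nra.
  assert (H1 : 0 < sqrt (U1 ^ 2 + - c)) by (apply sqrt_lt_R0; lra).
  assert (H2 : sqrt (U1 ^ 2 + - c) <= sqrt (U2 ^ 2 + - c)) by (apply sqrt_le_1; lra).
  assert (E1 : sqrt (U1 ^ 2 + - c) ^ 2 = U1 ^ 2 + - c) by (apply pow2_sqrt; lra).
  assert (E2 : sqrt (U2 ^ 2 + - c) ^ 2 = U2 ^ 2 + - c) by (apply pow2_sqrt; lra).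
  set (S1 := sqrt (U1 ^ 2 + - c)) in *. set (S2 := sqrt (U2 ^ 2 + - c)) in *.
  assert (H3 : - U2 * S1 <= - U1 * S2).
  { apply Rsqr_incr_0; [ | nra | nra ]. unfold Rsqr.
    replace (- U2 * S1 * (- U2 * S1)) with (U2 ^ 2 * S1 ^ 2) by ring.
    replace (- U1 * S2 * (- U1 * S2)) with (U1 ^ 2 * S2 ^ 2) by ring.
    rewrite E1, E2. nra. }
  assert (H4 : - U2 / S2 <= - U1 / S1).
  { apply Rmult_le_reg_r with (S1 * S2); [ nra | ].
    replace (- U2 / S2 * (S1 * S2)) with (- U2 * S1) by (field; lra).
    replace (- U1 / S1 * (S1 * S2)) with (- U1 * S2) by (field; lra). exact H3. }
  assert (H5 : / (- U2 * S2) <= / (- U1 * S1)) by (apply Rinv_le_contravar; nra).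
  replace ((- INR k * U2 + - c / U2) / S2) with (INR k * (- U2 / S2) + c * / (- U2 * S2))
    by (field; lra).
  replace ((- INR k * U1 + - c / U1) / S1) with (INR k * (- U1 / S1) + c * / (- U1 * S1))
    by (field; lra).
  apply Rplus_le_compat; apply Rmult_le_compat_l; assumption.
Qed.

Let scaled_speed_gap y : 0 < y <= beta -> (forall x, y < x <= beta -> V2 x < V1 x) ->
  scaled_speed r1 V1 y - scaled_speed r2 V2 y <= scaled_speed r1 V1 beta - scaled_speed r2 V2 beta.
Proof.
  intros Hy HV. assert (Hb := beta_gt_1 p q hq hpq). assert (Hb1 := br_beta _ _ _ _ _ _ _ br1).
  apply (le_of_deriv (fun s => scaled_speed r1 V1 s - scaled_speed r2 V2 s)
    (fun s => (- INR k * V1 s + 2 * F s / V1 s) / sqrt (V1 s ^ 2 + 2 * F s)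
            - (- INR k * V2 s + 2 * F s / V2 s) / sqrt (V2 s ^ 2 + 2 * F s))); [ lra | | | ].
  - intros x Hx. apply cont_minus; [ apply (scaled_speed_continuous _ _ _ _ _ br1)
      | apply (scaled_speed_continuous _ _ _ _ _ br2) ]; lra.
  - intros x Hx. apply d_minus; [ apply (scaled_speed_derive _ _ _ _ _ br1)
      | apply (scaled_speed_derive _ _ _ _ _ br2) ]; lra.
  - intros x Hx.
    assert (HF : F x <= 0) by (apply prim_le_0; auto; lra).
    assert (He := br_energy _ _ _ _ _ _ _ br1 x ltac:(lra)).
    assert (H := scaled_speed_rate_le (V1 x) (V2 x) (- (2 * F x)) ltac:(lra)).
    specialize (H ltac:(split; [ apply HV; lra | apply Hneg1; lra ]) ltac:(lra)).
    rewrite Ropp_involutive in H. lra.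
Qed.

(** At a height of equal slopes below [beta], [crossing] gives [r2 <= r1] and so the scaled speed of
    the second branch is not larger, although as long as the slopes are ordered its lead is at least
    the one at [beta]. That lead is the constant [e]. *)
Lemma falling_comparison :
  (forall s, 0 < s < M1 -> V2 s < V1 s) /\
  exists e, 0 < e /\ forall s, 0 < s <= beta ->
    scaled_speed r1 V1 s + e <= scaled_speed r2 V2 s.
Proof.
  assert (Hb := beta_gt_1 p q hq hpq). assert (Hb1 := br_beta _ _ _ _ _ _ _ br1).
  assert (HVb := falling_above_beta beta ltac:(lra)).
  assert (Hgap : 0 < scaled_speed r2 V2 beta - scaled_speed r1 V1 beta).
  { assert (H := falling_at_beta). unfold scaled_speed. rewrite prim_beta by assumption.
    rewrite Rmult_0_r, !Rplus_0_r.
    assert (HV1 := Hneg1 beta ltac:(lra)). assert (HV2 := Hneg2 beta ltac:(lra)).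
    replace (V1 beta ^ 2) with ((- V1 beta) ^ 2) by ring.
    replace (V2 beta ^ 2) with ((- V2 beta) ^ 2) by ring.
    rewrite !sqrt_pow2 by lra. lra. }
  assert (Hbelow : forall x, 0 < x <= beta -> 0 < V1 x - V2 x).
  { apply (first_crossing_left (fun s => V1 s - V2 s)).
    - intros x Hx. apply cont_minus; [ apply (br_cV _ _ _ _ _ _ _ br1) | apply (br_cV _ _ _ _ _ _ _ br2) ]; lra.
    - lra.
    - intros x Hx E Hpos.
      assert (Hr := crossing x beta ltac:(lra) ltac:(lra) E Hpos).
      assert (H := scaled_speed_gap x ltac:(lra)).
      specialize (H ltac:(intros z Hz; specialize (Hpos z ltac:(lra)); lra)).
      assert (scaled_speed r2 V2 x <= scaled_speed r1 V1 x); [ | lra ].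
      unfold scaled_speed. replace (V1 x) with (V2 x) by lra.
      apply Rmult_le_compat_r; [ apply sqrt_pos | exact Hr ]. }
  split.
  - intros s Hs. destruct (Rle_lt_dec s beta) as [Hsb|Hsb].
    + specialize (Hbelow s ltac:(lra)). lra.
    + apply falling_above_beta. lra.
  - exists (scaled_speed r2 V2 beta - scaled_speed r1 V1 beta). split; [ exact Hgap | ].
    intros s Hs. assert (H := scaled_speed_gap s ltac:(lra)).
    specialize (H ltac:(intros z Hz; specialize (Hbelow z ltac:(lra)); lra)). lra.
Qed.

End Falling.
End Top.

(** * Comparison of two solutions *)

Lemma rpow_le_exp s e B : 0 < s -> Rabs (ln s) <= B -> rpow s e <= exp (Rabs e * B).
Proof.
  intros Hs HB. rewrite rpow_eq by exact Hs.
  assert (e * ln s <= Rabs e * B).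
  { apply Rle_trans with (Rabs (e * ln s)); [ apply Rle_abs | ].
    rewrite Rabs_mult. apply Rmult_le_compat_l; [ apply Rabs_pos | exact HB ]. }
  destruct (Req_dec (e * ln s) (Rabs e * B)) as [->|]; [ lra | left; apply exp_increasing; lra ].
Qed.

(** [lo > 0] keeps away from [s = 0], where [f'] is unbounded if [q < 1]. *)
Lemma nonlin_lipschitz p q lo hi : 0 < q -> q < p -> 0 < lo ->
  exists L, 0 <= L /\ forall s t, lo <= s <= hi -> lo <= t <= hi ->
    Rabs (nonlin p q s - nonlin p q t) <= L * Rabs (s - t).
Proof.
  intros hq hpq Hlo.
  (* A bound on [Rabs (ln s)] bounds the powers of [s] with exponents of either sign. *)
  set (B := Rabs (ln lo) + Rabs (ln hi)).
  set (L := p * exp (Rabs (p - 1) * B) + q * exp (Rabs (q - 1) * B)).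
  assert (HL : 0 <= L).
  { unfold L. generalize (exp_pos (Rabs (p - 1) * B)) (exp_pos (Rabs (q - 1) * B)). nra. }
  exists L. split; [ exact HL | ].
  assert (Hd : forall s, lo <= s <= hi -> Rabs (dnonlin p q s) <= L).
  { intros s Hs.
    assert (HB : Rabs (ln s) <= B).
    { assert (H1 : ln lo <= ln s) by (destruct (Req_dec lo s) as [->|]; [ lra | left; apply ln_increasing; lra ]).
      assert (H2 : ln s <= ln hi) by (destruct (Req_dec s hi) as [->|]; [ lra | left; apply ln_increasing; lra ]).
      unfold B. generalize (Rle_abs (ln hi)) (Rle_abs (- ln lo)). rewrite Rabs_Ropp.
      generalize (Rabs_pos (ln lo)) (Rabs_pos (ln hi)). intros. apply Rabs_le. lra. }
    assert (H1 := rpow_le_exp s (p - 1) B ltac:(lra) HB).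
    assert (H2 := rpow_le_exp s (q - 1) B ltac:(lra) HB).
    assert (H3 := rpow_pos s (p - 1) ltac:(lra)). assert (H4 := rpow_pos s (q - 1) ltac:(lra)).
    unfold dnonlin, L. apply Rabs_le. split; nra. }
  assert (Hlt : forall s t, lo <= s -> s < t -> t <= hi ->
    Rabs (nonlin p q s - nonlin p q t) <= L * Rabs (s - t)).
  { intros s t Hs Hst Ht.
    destruct (mean_value (nonlin p q) (dnonlin p q) s t Hst) as [c [Hc E]].
    - intros x _. now apply nonlin_continuous.
    - intros x Hx. apply nonlin_derive. lra.
    - rewrite (Rabs_minus_sym (nonlin p q s)), E, Rabs_mult, (Rabs_minus_sym s).
      apply Rmult_le_compat_r; [ apply Rabs_pos | apply Hd; lra ]. }
  intros s t Hs Ht. destruct (Rtotal_order s t) as [H|[->|H]].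
  - apply Hlt; lra.
  - rewrite !Rminus_diag, Rabs_R0. lra.
  - rewrite (Rabs_minus_sym (nonlin p q s)), (Rabs_minus_sym s). apply Hlt; lra.
Qed.

(** * Uniqueness for given initial slope, and the comparison of unequal slopes *)

Section Pair.
Context (k : nat) (p q : R) (hq : 0 < q) (hpq : q < p).

Local Notation d := (INR k + 1).
Local Notation f := (nonlin p q).
Local Notation F := (prim p q).
Local Notation beta := (zero_of_prim p q).

Context (a : R) (b : Rbar) (u1 v1 u2 v2 : R -> R).
Context (sol1 : extended_solution k p q a b u1 v1) (sol2 : extended_solution k p q a b u2 v2).
Context (m1 : R) (r1 t1 : R -> R) (pf1 : profile k p q a b u1 v1 m1 r1 t1).
Context (m2 : R) (r2 t2 : R -> R) (pf2 : profile k p q a b u2 v2 m2 r2 t2).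

Let Ha : 0 < a := es_a _ _ _ _ _ _ _ sol1.

(** In the height variable [f s] multiplies [/ V], which is Lipschitz as long as the slopes stay
    away from 0. In the rate of the squared distance it contributes [2 f (V1 - V2)^2 / (V1 V2)],
    which is nonpositive for [s <= 1]. *)
Lemma agree_near_start : v1 a = v2 a ->
  exists x0, a < x0 /\ open_itv a b x0 /\ v1 x0 = v2 x0 /\ forall x, a <= x <= x0 -> u1 x = u2 x.
Proof.
  intros Hv.
  assert (br1 := pf_rise _ _ _ _ _ _ _ _ _ _ pf1). assert (br2 := pf_rise _ _ _ _ _ _ _ _ _ _ pf2).
  assert (Hb := beta_gt_1 p q hq hpq).
  assert (Hb1 := br_beta _ _ _ _ _ _ _ br1). assert (Hb2 := br_beta _ _ _ _ _ _ _ br2).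
  set (V1 := fun s => v1 (r1 s)) in *. set (V2 := fun s => v2 (r2 s)) in *.
  assert (Hr10 := pf_r_0 _ _ _ _ _ _ _ _ _ _ pf1). assert (Hr20 := pf_r_0 _ _ _ _ _ _ _ _ _ _ pf2).
  assert (Hva := pf_va _ _ _ _ _ _ _ _ _ _ pf1).
  assert (cr1 := pf_cr_0 _ _ _ _ _ _ _ _ _ _ pf1). assert (cr2 := pf_cr_0 _ _ _ _ _ _ _ _ _ _ pf2).
  assert (cV1 : continuous V1 0).
  { apply (continuous_comp r1 v1); [ exact cr1 | apply (es_cv _ _ _ _ _ _ _ sol1) ]. }
  assert (cV2 : continuous V2 0).
  { apply (continuous_comp r2 v2); [ exact cr2 | apply (es_cv _ _ _ _ _ _ _ sol2) ]. }
  assert (HV10 : V1 0 = v1 a) by (unfold V1; now rewrite Hr10).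
  assert (HV20 : V2 0 = v1 a) by (unfold V2; now rewrite Hr20, Hv).
  set (al := v1 a) in *.
  destruct (continuous_pos_locally (fun s => V1 s - al / 2) 0) as [e1 [He1 G1]]; [ ctn | lra | ].
  destruct (continuous_pos_locally (fun s => V2 s - al / 2) 0) as [e2 [He2 G2]]; [ ctn | lra | ].
  (* At most 1 for [f <= 0], and small enough for both slopes to exceed [al / 2]. *)
  set (s0 := Rmin 1 (Rmin (e1 / 2) (e2 / 2))).
  assert (Hs0 : 0 < s0 /\ s0 <= 1 /\ s0 < e1 /\ s0 < e2).
  { unfold s0. generalize (Rmin_l 1 (Rmin (e1/2) (e2/2))) (Rmin_r 1 (Rmin (e1/2) (e2/2)))
      (Rmin_l (e1/2) (e2/2)) (Rmin_r (e1/2) (e2/2)). intros.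
    split; [ | lra ]. repeat apply Rmin_glb_lt; lra. }
  assert (Hagree : forall s, 0 < s <= s0 -> r1 s = r2 s /\ V1 s = V2 s).
  { intros s Hs.
    assert (HN : (r1 s - r2 s) ^ 2 + (V1 s - V2 s) ^ 2 <= 0).
    (* The constant bounds [/ (V1 V2)] by slopes at least [al / 2] and [d / (r1 r2)] by radii at
       least [a]. *)
    { apply (gronwall (fun s => (r1 s - r2 s) ^ 2 + (V1 s - V2 s) ^ 2)
        (fun s => 2 * (r1 s - r2 s) * (/ V1 s - / V2 s) + 2 * (V1 s - V2 s) *
           ((- (d / r1 s) - f s / V1 s) - (- (d / r2 s) - f s / V2 s)))
        (/ (al / 2 * (al / 2)) + d / (a * a)) 0 s).
      - lra.
      - intros x Hx. destruct (Req_dec x 0) as [->|]; [ ctn | ].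
        assert (continuous r1 x) by (apply (br_cr _ _ _ _ _ _ _ br1); lra).
        assert (continuous r2 x) by (apply (br_cr _ _ _ _ _ _ _ br2); lra).
        assert (continuous V1 x) by (apply (br_cV _ _ _ _ _ _ _ br1); lra).
        assert (continuous V2 x) by (apply (br_cV _ _ _ _ _ _ _ br2); lra).
        ctn.
      - intros x Hx.
        assert (D1 := br_dr _ _ _ _ _ _ _ br1 x ltac:(lra)).
        assert (D2 := br_dr _ _ _ _ _ _ _ br2 x ltac:(lra)).
        assert (D3 := br_dV _ _ _ _ _ _ _ br1 x ltac:(lra)).
        assert (D4 := br_dV _ _ _ _ _ _ _ br2 x ltac:(lra)).
        eapply derive_val; [ dv | ]. simpl pred. simpl (INR 2). cbv beta. ring.
      - intros x Hx.
        assert (HV1 : al / 2 < V1 x) by (assert (H := G1 x ltac:(apply Rabs_def1; lra)); lra).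
        assert (HV2 : al / 2 < V2 x) by (assert (H := G2 x ltac:(apply Rabs_def1; lra)); lra).
        assert (HR1 : a <= r1 x) by (apply (pf_u_r _ _ _ _ _ _ _ _ _ _ pf1); lra).
        assert (HR2 : a <= r2 x) by (apply (pf_u_r _ _ _ _ _ _ _ _ _ _ pf2); lra).
        assert (Hf : f x <= 0).
        { unfold nonlin. replace p with (q + (p - q)) by ring. rewrite rpow_plus by lra.
          assert (P1 := rpow_pos x q ltac:(lra)).
          assert (P2 := rpow_le x 1 (p - q) ltac:(lra) ltac:(lra) ltac:(lra)).
          rewrite rpow_1_l in P2. nra. }
        assert (Hd := d_ge_1 k).
        assert (I1 : 0 < / (V1 x * V2 x) <= / (al / 2 * (al / 2))).
        { split; [ apply Rinv_0_lt_compat; nra | apply Rinv_le_contravar; nra ]. }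
        assert (I2 : 0 < / (r1 x * r2 x) <= / (a * a)).
        { split; [ apply Rinv_0_lt_compat; nra | apply Rinv_le_contravar; nra ]. }
        set (A := r1 x - r2 x). set (C := V1 x - V2 x).
        replace (2 * A * (/ V1 x - / V2 x) + 2 * C *
           ((- (d / r1 x) - f x / V1 x) - (- (d / r2 x) - f x / V2 x)))
          with (- (2 * A * C) * / (V1 x * V2 x) + d * (2 * A * C) * / (r1 x * r2 x)
                + 2 * f x * C ^ 2 * / (V1 x * V2 x)) by (unfold A, C; field; lra).
        assert (S1 : 2 * A * C <= A ^ 2 + C ^ 2) by (generalize (pow2_ge_0 (A - C)); nra).
        assert (S2 : - (2 * A * C) <= A ^ 2 + C ^ 2) by (generalize (pow2_ge_0 (A + C)); nra).
        assert (S3 : 0 <= A ^ 2 + C ^ 2) by (generalize (pow2_ge_0 A) (pow2_ge_0 C); lra).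
        assert (B1 : - (2 * A * C) * / (V1 x * V2 x) <= (A ^ 2 + C ^ 2) * / (al / 2 * (al / 2))).
        { apply Rle_trans with ((A ^ 2 + C ^ 2) * / (V1 x * V2 x));
            [ apply Rmult_le_compat_r | apply Rmult_le_compat_l ]; lra. }
        assert (B2 : d * (2 * A * C) * / (r1 x * r2 x) <= d * (A ^ 2 + C ^ 2) * / (a * a)).
        { apply Rle_trans with (d * (A ^ 2 + C ^ 2) * / (r1 x * r2 x)).
          - apply Rmult_le_compat_r; [ lra | ]. apply Rmult_le_compat_l; lra.
          - apply Rmult_le_compat_l; [ | lra ]. apply Rmult_le_pos; lra. }
        assert (B3 : 2 * f x * C ^ 2 * / (V1 x * V2 x) <= 0).
        { assert (0 <= C ^ 2 * / (V1 x * V2 x)) by (apply Rmult_le_pos; [ apply pow2_ge_0 | lra ]).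
          nra. }
        unfold Rdiv. lra.
      - rewrite Hr10, Hr20, HV10, HV20. ring. }
    assert (P1 := pow2_ge_0 (r1 s - r2 s)). assert (P2 := pow2_ge_0 (V1 s - V2 s)).
    split; nra. }
  assert (Hx0 := pf_u_r _ _ _ _ _ _ _ _ _ _ pf1 s0 ltac:(lra)).
  assert (Hu1a : u1 a = 0) by (apply (es_left _ _ _ _ _ _ _ sol1); lra).
  assert (Hax0 : a < r1 s0).
  { destruct (Req_dec a (r1 s0)) as [E|]; [ rewrite <- E in Hx0; lra | lra ]. }
  assert (Hm1 := pf_m _ _ _ _ _ _ _ _ _ _ pf1).
  exists (r1 s0). split; [ exact Hax0 | split; [ | split ] ].
  - split; [ exact Hax0 | ]. destruct Hm1 as [_ Hm1].
    destruct b as [b'| |]; simpl in *; try lra; trivial.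
  - destruct (Hagree s0 ltac:(lra)) as [E1 E2]. unfold V1, V2 in E2. now rewrite <- E1 in E2.
  - intros x Hx.
    assert (Hs : 0 <= u1 x <= s0).
    { split.
      - destruct (Req_dec a x) as [<-|]; [ lra | left ].
        apply (es_pos _ _ _ _ _ _ _ sol1). split; [ lra | ]. destruct Hm1 as [_ Hm1].
        destruct b as [b'| |]; simpl in *; try lra; trivial.
      - rewrite <- (proj2 Hx0).
        destruct (Req_dec x (r1 s0)) as [->|]; [ lra | left ].
        apply (lt_of_deriv u1 v1 x (r1 s0)); [ lra | | | ].
        + intros; apply (es_cu _ _ _ _ _ _ _ sol1).
        + intros z Hz. apply (es_du _ _ _ _ _ _ _ sol1). split; [ lra | ]. destruct Hm1 as [_ Hm1].
          destruct b as [b'| |]; simpl in *; try lra; trivial.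
        + intros z Hz. apply (pf_v_pos _ _ _ _ _ _ _ _ _ _ pf1). lra. }
    assert (Ex : r1 (u1 x) = x) by (apply (pf_r_u _ _ _ _ _ _ _ _ _ _ pf1); lra).
    destruct (Req_dec (u1 x) 0) as [E0|E0].
    + rewrite E0, Hr10 in Ex. subst x. rewrite E0. symmetry.
      apply (es_left _ _ _ _ _ _ _ sol2). lra.
    + destruct (Hagree (u1 x) ltac:(lra)) as [E1 _]. rewrite Ex in E1.
      rewrite E1 at 2. symmetry. apply (pf_u_r _ _ _ _ _ _ _ _ _ _ pf2). lra.
Qed.

(** From [x0] on both solutions have a positive minimum on the compact interval up to [x]; there [f]
    is Lipschitz and the usual Gronwall argument applies. *)
Lemma same_slope_same_solution : v1 a = v2 a -> forall x, open_itv a b x -> u1 x = u2 x.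
Proof.
  intros Hv x Hx. destruct (agree_near_start Hv) as [x0 [Hax0 [Hx0 [Ev Eu]]]].
  destruct (Rle_lt_dec x x0) as [Hle|Hlt].
  { destruct Hx. apply Eu. lra. }
  assert (Hin : forall z, x0 <= z <= x -> open_itv a b z).
  { intros z Hz. split; [ lra | ]. destruct Hx as [_ Hx]. destruct b; simpl in *; try lra; trivial. }
  assert (cu1 := es_cu _ _ _ _ _ _ _ sol1). assert (cu2 := es_cu _ _ _ _ _ _ _ sol2).
  assert (cv1 := es_cv _ _ _ _ _ _ _ sol1). assert (cv2 := es_cv _ _ _ _ _ _ _ sol2).
  destruct (continuity_ab_min (fun z => Rmin (u1 z) (u2 z)) x0 x) as [y1 [Y1 Y1']]; [ lra | | ].
  { intros z _. apply continuity_pt_filterlim, (cont_Rmin u1 u2); auto. }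
  destruct (continuity_ab_maj (fun z => Rmax (u1 z) (u2 z)) x0 x) as [y2 [Y2 Y2']]; [ lra | | ].
  { intros z _. apply continuity_pt_filterlim, (cont_Rmax u1 u2); auto. }
  set (lo := Rmin (u1 y1) (u2 y1)) in *. set (hi := Rmax (u1 y2) (u2 y2)) in *.
  assert (Hlo : 0 < lo).
  { apply Rmin_glb_lt; [ apply (es_pos _ _ _ _ _ _ _ sol1) | apply (es_pos _ _ _ _ _ _ _ sol2) ]; auto. }
  destruct (nonlin_lipschitz p q lo hi hq hpq Hlo) as [L [HL HLip]].
  assert (HN : (u1 x - u2 x) ^ 2 + (v1 x - v2 x) ^ 2 <= 0).
  { apply (gronwall (fun s => (u1 s - u2 s) ^ 2 + (v1 s - v2 s) ^ 2)
      (fun s => 2 * (u1 s - u2 s) * (v1 s - v2 s) + 2 * (v1 s - v2 s) *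
         ((- (d / s) * v1 s - f (u1 s)) - (- (d / s) * v2 s - f (u2 s)))) (1 + L) x0 x).
    - lra.
    - intros z _. assert (G1 := cu1 z). assert (G2 := cu2 z). assert (G3 := cv1 z). assert (G4 := cv2 z). ctn.
    - intros z Hz. assert (Hz' := Hin z ltac:(lra)).
      assert (D1 := es_du _ _ _ _ _ _ _ sol1 z Hz'). assert (D2 := es_du _ _ _ _ _ _ _ sol2 z Hz').
      assert (D3 := es_dv _ _ _ _ _ _ _ sol1 z Hz'). assert (D4 := es_dv _ _ _ _ _ _ _ sol2 z Hz').
      eapply derive_val; [ dv | ]. simpl pred. simpl (INR 2). cbv beta. ring.
    - intros z Hz.
      assert (Hl := Y1 z ltac:(lra)). assert (Hh := Y2 z ltac:(lra)). simpl in Hl, Hh.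
      assert (Z1 := Rmin_l (u1 z) (u2 z)). assert (Z2 := Rmin_r (u1 z) (u2 z)).
      assert (Z3 := Rmax_l (u1 z) (u2 z)). assert (Z4 := Rmax_r (u1 z) (u2 z)).
      assert (Hf := HLip (u1 z) (u2 z) ltac:(unfold lo, hi in *; lra) ltac:(unfold lo, hi in *; lra)).
      set (A := u1 z - u2 z) in *. set (C := v1 z - v2 z).
      replace (2 * A * C + 2 * C * ((- (d / z) * v1 z - f (u1 z)) - (- (d / z) * v2 z - f (u2 z))))
        with (2 * A * C - 2 * (d / z) * C ^ 2 - 2 * C * (f (u1 z) - f (u2 z)))
        by (unfold C; ring).
      assert (Hd := d_ge_1 k).
      assert (B1 : 0 <= d / z * C ^ 2).
      { apply Rmult_le_pos; [ | apply pow2_ge_0 ]. apply Rlt_le, Rdiv_lt_0_compat; lra. }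
      assert (B2 : - (2 * C * (f (u1 z) - f (u2 z))) <= L * (A ^ 2 + C ^ 2)).
      { apply Rle_trans with (2 * (Rabs C * Rabs (f (u1 z) - f (u2 z)))).
        - rewrite <- Rabs_mult. generalize (Rle_abs (- (C * (f (u1 z) - f (u2 z))))).
          rewrite Rabs_Ropp. lra.
        - apply Rle_trans with (2 * (Rabs C * (L * Rabs A))).
          + apply Rmult_le_compat_l; [ lra | ]. apply Rmult_le_compat_l; [ apply Rabs_pos | exact Hf ].
          + rewrite <- (pow2_abs A), <- (pow2_abs C).
            generalize (pow2_ge_0 (Rabs A - Rabs C)). nra. }
      assert (B3 : 2 * A * C <= A ^ 2 + C ^ 2) by (generalize (pow2_ge_0 (A - C)); nra).
      lra.
    - rewrite Ev, (Eu x0) by lra. ring. }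
  assert (P1 := pow2_ge_0 (u1 x - u2 x)). assert (P2 := pow2_ge_0 (v1 x - v2 x)). nra.
Qed.

Context (hsub : subcritical p q (INR k + 2)).

Lemma slope_comparison : v1 a < v2 a ->
  u1 m1 < u2 m2 /\ (forall s, 0 <= s < u1 m1 -> v1 (r1 s) < v2 (r2 s)) /\
  (forall s, 0 < s <= u1 m1 -> r2 s < r1 s) /\
  (forall s, 0 < s < u1 m1 -> v2 (t2 s) < v1 (t1 s)) /\
  exists e, 0 < e /\ forall s, 0 < s <= beta ->
    scaled_speed p q t1 (fun s => v1 (t1 s)) s + e
      <= scaled_speed p q t2 (fun s => v2 (t2 s)) s.
Proof.
  intros Hv.
  assert (br1 := pf_rise _ _ _ _ _ _ _ _ _ _ pf1). assert (br2 := pf_rise _ _ _ _ _ _ _ _ _ _ pf2).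
  assert (bt1 := pf_fall _ _ _ _ _ _ _ _ _ _ pf1). assert (bt2 := pf_fall _ _ _ _ _ _ _ _ _ _ pf2).
  assert (Hr10 := pf_r_0 _ _ _ _ _ _ _ _ _ _ pf1). assert (Hr20 := pf_r_0 _ _ _ _ _ _ _ _ _ _ pf2).
  assert (Hva := pf_va _ _ _ _ _ _ _ _ _ _ pf1).
  assert (cr1 := pf_cr_0 _ _ _ _ _ _ _ _ _ _ pf1). assert (cr2 := pf_cr_0 _ _ _ _ _ _ _ _ _ _ pf2).
  destruct (rising_comparison k p q hq hpq a (u1 m1) (u2 m2) r1 (fun s => v1 (r1 s)) r2 (fun s => v2 (r2 s)))
    as [HM [HV [Hr Hw]]]; auto.
  { apply (continuous_comp r1 v1); [ exact cr1 | apply (es_cv _ _ _ _ _ _ _ sol1) ]. }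
  { apply (continuous_comp r2 v2); [ exact cr2 | apply (es_cv _ _ _ _ _ _ _ sol2) ]. }
  { now rewrite Hr10. }
  { now rewrite Hr10, Hr20. }
  assert (Htop := rising_pohozaev k p q hq hpq hsub _ _ _ _ _ _ br1 br2 HM HV Hr Hw).
  assert (Hb := beta_gt_1 p q hq hpq). assert (Hb1 := br_beta _ _ _ _ _ _ _ br1).
  (* Rising and falling branch of [u2] meet at its maximum, where the slope is 0 and [pohozaev] is
     the radial energy. Hence its value at height [u1 m1] is on the falling branch at least that on
     the rising one. *)
  assert (J1 := pohozaev_monotone k p q hq hpq hsub _ _ _ _ br2 (u1 m1) (u2 m2) ltac:(lra) ltac:(lra) ltac:(lra)).
  assert (J2 := pohozaev_monotone k p q hq hpq hsub _ _ _ _ bt2 (u1 m1) (u2 m2) ltac:(lra) ltac:(lra) ltac:(lra)).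
  rewrite (pohozaev_top _ _ _ _ _ _ _ br2) in J1. rewrite (pohozaev_top _ _ _ _ _ _ _ bt2) in J2.
  assert (E2 : radial_energy k p q t2 (fun s => v2 (t2 s)) (u2 m2)
             = radial_energy k p q r2 (fun s => v2 (r2 s)) (u2 m2)).
  { unfold radial_energy.
    now rewrite (pf_t_top _ _ _ _ _ _ _ _ _ _ pf2), (pf_r_top _ _ _ _ _ _ _ _ _ _ pf2). }
  assert (E1 : radial_energy k p q t1 (fun s => v1 (t1 s)) (u1 m1)
             = radial_energy k p q r1 (fun s => v1 (r1 s)) (u1 m1)).
  { unfold radial_energy.
    now rewrite (pf_t_top _ _ _ _ _ _ _ _ _ _ pf1), (pf_r_top _ _ _ _ _ _ _ _ _ _ pf1). }
  destruct (falling_comparison k p q hq hpq hsub (u1 m1) (u2 m2) t1 (fun s => v1 (t1 s)) t2 (fun s => v2 (t2 s)))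
    as [Hf1 Hf2]; auto.
  lra.
Qed.

End Pair.

Lemma no_slow_exterior_decay k p q a u v m r t e :
  0 < q -> q < p ->
  extended_solution k p q a p_infty u v -> profile k p q a p_infty u v m r t ->
  0 < e -> (forall s, 0 < s <= zero_of_prim p q -> e <= scaled_speed p q t (fun s => v (t s)) s) ->
  False.
Proof.
  intros hq hpq sol pf He Hsp.
  set (beta := zero_of_prim p q) in *.
  assert (Hb := beta_gt_1 p q hq hpq). fold beta in Hb.
  assert (Hb1 := br_beta _ _ _ _ _ _ _ (pf_fall _ _ _ _ _ _ _ _ _ _ pf)). fold beta in Hb1.
  assert (Hm := pf_m _ _ _ _ _ _ _ _ _ _ pf). destruct Hm as [Ham _].
  assert (Ha := es_a _ _ _ _ _ _ _ sol).
  destruct (pf_u_t _ _ _ _ _ _ _ _ _ _ pf beta ltac:(lra)) as [Hx1 [_ Hx2]].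
  set (x0 := t beta) in *.
  assert (Hpos : forall x, x0 <= x -> 0 < u x).
  { intros x Hx. apply (es_pos _ _ _ _ _ _ _ sol). split; simpl; [ lra | trivial ]. }
  assert (Hdec : forall x, x0 <= x -> u x <= beta).
  { intros x Hx. rewrite <- Hx2. apply Ropp_le_cancel.
    apply (le_of_deriv (fun x => - u x) (fun x => - v x)).
    - exact Hx.
    - intros z _. apply cont_opp, (es_cu _ _ _ _ _ _ _ sol).
    - intros z Hz. apply d_opp, (es_du _ _ _ _ _ _ _ sol). split; simpl; [ lra | trivial ].
    - intros z Hz. assert (v z < 0); [ | lra ].
      apply (pf_v_neg _ _ _ _ _ _ _ _ _ _ pf); simpl; [ lra | trivial ]. }
  assert (Hv : forall x, x0 <= x -> e <= - (x * v x)).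
  { intros x Hx. assert (Hs : 0 < u x <= beta) by (split; auto).
    assert (H := Hsp (u x) Hs). unfold scaled_speed in H.
    rewrite (pf_t_u _ _ _ _ _ _ _ _ _ _ pf x ltac:(lra) I) in H.
    assert (HF : prim p q (u x) <= 0) by (apply prim_le_0; auto; fold beta; lra).
    (* Below [beta] the potential is nonpositive, so the scaled speed is at most [x * |v x|]. *)
    assert (Hsq : sqrt (v x ^ 2 + 2 * prim p q (u x)) <= Rabs (v x)).
    { rewrite <- sqrt_Rsqr_abs. apply sqrt_le_1_alt. unfold Rsqr. simpl. lra. }
    assert (Hvx : v x <= 0).
    { destruct (Req_dec x m) as [->|].
      - rewrite (pf_vm _ _ _ _ _ _ _ _ _ _ pf). lra.
      - left. apply (pf_v_neg _ _ _ _ _ _ _ _ _ _ pf); simpl; [ lra | trivial ]. }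
    rewrite Rabs_left1 in Hsq by exact Hvx.
    assert (x * sqrt (v x ^ 2 + 2 * prim p q (u x)) <= x * - v x)
      by (apply Rmult_le_compat_l; lra). lra. }
  (* Chosen so that [e * ln (x1 / x0) = u x0 + 1], more than the height available at [x0]. *)
  set (x1 := x0 * exp ((u x0 + 1) / e)).
  assert (Hx0p : 0 < x0) by lra.
  assert (Hexp : 1 < exp ((u x0 + 1) / e)).
  { assert (H : 0 < (u x0 + 1) / e) by (apply Rdiv_lt_0_compat; [ rewrite Hx2; lra | exact He ]).
    apply exp_increasing in H. now rewrite exp_0 in H. }
  assert (Hx01 : x0 < x1) by (unfold x1; nra).
  assert (H : - (u x0 + e * ln x0) <= - (u x1 + e * ln x1)).
  { apply (le_of_deriv (fun x => - (u x + e * ln x)) (fun x => - (v x + e * / x))); [ lra | | | ].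
    - intros x Hx. ctn; [ apply (es_cu _ _ _ _ _ _ _ sol) | ].
      apply (cont_derive ln x (/ x)). apply is_derive_Reals, derivable_pt_lim_ln. lra.
    - intros x Hx.
      assert (D1 : is_derive u x (v x)).
      { apply (es_du _ _ _ _ _ _ _ sol). split; simpl; [ lra | trivial ]. }
      assert (D2 : is_derive ln x (/ x)) by (apply is_derive_Reals, derivable_pt_lim_ln; lra).
      eapply derive_val; [ dv | ]. cbv beta. ring.
    - intros x Hx. specialize (Hv x ltac:(lra)).
      apply Rmult_le_reg_l with x; [ lra | ].
      replace (x * - (v x + e * / x)) with (- (x * v x) - e) by (field; lra). lra. }
  unfold x1 in H at 2. rewrite ln_mult, ln_exp in H by (try apply exp_pos; exact Hx0p).
  replace (e * (ln x0 + (u x0 + 1) / e)) with (e * ln x0 + u x0 + 1) in H by (field; lra).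
  specialize (Hpos x1 ltac:(lra)). lra.
Qed.

(** * Ordered solutions in an annulus *)

Lemma nonlin_factor p q s : 0 < s -> nonlin p q s = s * (rpow s (p - 1) - rpow s (q - 1)).
Proof.
  intros Hs. unfold nonlin.
  replace p with (1 + (p - 1)) at 1 by ring. replace q with (1 + (q - 1)) at 1 by ring.
  rewrite !rpow_plus, rpow_1_r by exact Hs. ring.
Qed.

Lemma nonlin_ratio_lt p q s t : q <= 1 -> 1 < p -> 0 < s -> s < t ->
  t * nonlin p q s < s * nonlin p q t.
Proof.
  intros Hq Hp Hs Hst. rewrite !nonlin_factor by lra.
  assert (H1 := rpow_lt s t (p - 1) ltac:(lra) Hst ltac:(lra)).
  assert (H2 : rpow t (q - 1) <= rpow s (q - 1)).
  { rewrite !rpow_eq by lra.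
    assert (H := ln_increasing s t Hs Hst).
    destruct (Req_dec q 1) as [->|]; [ rewrite Rminus_diag, !Rmult_0_l; lra | ].
    left. apply exp_increasing. nra. }
  replace (t * (s * (rpow s (p - 1) - rpow s (q - 1)))) with ((s * t) * (rpow s (p - 1) - rpow s (q - 1))) by ring.
  replace (s * (t * (rpow t (p - 1) - rpow t (q - 1)))) with ((s * t) * (rpow t (p - 1) - rpow t (q - 1))) by ring.
  apply Rmult_lt_compat_l; [ nra | lra ].
Qed.

(** For [q > 1] the quotient [f(s)/s = s^(q-1) (s^(p-q) - 1)] first decreases from 0. It is negative
    below 1 and increasing above 1, so a value taken above 1 exceeds all earlier ones. *)
Lemma nonlin_ratio_lt_above_1 p q s t : 1 <= q -> q < p -> 1 < t -> 0 < s -> s < t ->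
  t * nonlin p q s < s * nonlin p q t.
Proof.
  intros Hq Hp Ht Hs Hst.
  assert (H : rpow s (p - 1) - rpow s (q - 1) < rpow t (p - 1) - rpow t (q - 1)).
  { replace (p - 1) with ((q - 1) + (p - q)) by ring. rewrite !rpow_plus by lra.
    assert (G1 := rpow_lt 1 t (p - q) ltac:(lra) ltac:(lra) ltac:(lra)). rewrite rpow_1_l in G1.
    assert (G2 := rpow_pos t (q - 1) ltac:(lra)). assert (G3 := rpow_pos s (q - 1) ltac:(lra)).
    assert (G4 := rpow_lt s t (p - q) ltac:(lra) ltac:(lra) ltac:(lra)).
    assert (G5 := rpow_le s t (q - 1) ltac:(lra) ltac:(lra) ltac:(lra)).
    destruct (Rle_lt_dec 1 (rpow s (p - q))); nra. }
  rewrite !nonlin_factor by lra.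
  replace (t * (s * (rpow s (p - 1) - rpow s (q - 1)))) with ((s * t) * (rpow s (p - 1) - rpow s (q - 1))) by ring.
  replace (s * (t * (rpow t (p - 1) - rpow t (q - 1)))) with ((s * t) * (rpow t (p - 1) - rpow t (q - 1))) by ring.
  apply Rmult_lt_compat_l; [ nra | lra ].
Qed.

Section Finite.
Context (k : nat) (p q : R) (hq : 0 < q) (hpq : q < p).

Local Notation d := (INR k + 1).
Local Notation f := (nonlin p q).
Local Notation F := (prim p q).
Local Notation beta := (zero_of_prim p q).
Local Notation wt x := (x ^ S k).

Context (a b : R) (u1 v1 u2 v2 : R -> R).
Context (sol1 : extended_solution k p q a b u1 v1) (sol2 : extended_solution k p q a b u2 v2).
Context (m1 : R) (r1 t1 : R -> R) (pf1 : profile k p q a b u1 v1 m1 r1 t1).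
Context (m2 : R) (r2 t2 : R -> R) (pf2 : profile k p q a b u2 v2 m2 r2 t2).

Let Ha : 0 < a := es_a _ _ _ _ _ _ _ sol1.
Let cu1 := es_cu _ _ _ _ _ _ _ sol1.
Let cu2 := es_cu _ _ _ _ _ _ _ sol2.
Let cv1 := es_cv _ _ _ _ _ _ _ sol1.
Let cv2 := es_cv _ _ _ _ _ _ _ sol2.

Lemma end_slope_nonpos (u v : R -> R) m r t :
  profile k p q a b u v m r t -> (forall x, continuous v x) -> v b <= 0.
Proof.
  intros pf Hc. destruct (Rle_lt_dec (v b) 0) as [|Hn]; [ assumption | exfalso ].
  destruct (continuous_pos_locally v b (Hc b) Hn) as [e [He Hloc]].
  assert (Hm := pf_m _ _ _ _ _ _ _ _ _ _ pf). destruct Hm as [_ Hm]. simpl in Hm.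
  set (y := Rmax (b - e / 2) ((m + b) / 2)).
  assert (b - e < y < b /\ m < y).
  { unfold y. generalize (Rmax_l (b - e / 2) ((m + b) / 2)) (Rmax_r (b - e / 2) ((m + b) / 2)).
    intros; repeat split; try lra. apply Rmax_lub_lt; lra. }
  assert (0 < v y) by (apply Hloc, Rabs_def1; lra).
  assert (v y < 0); [ | lra ]. apply (pf_v_neg _ _ _ _ _ _ _ _ _ _ pf); simpl; lra.
Qed.

Context (HM : u1 m1 < u2 m2).
Context (HVr : forall s, 0 <= s < u1 m1 -> v1 (r1 s) < v2 (r2 s)).
Context (Hr : forall s, 0 < s <= u1 m1 -> r2 s < r1 s).
Context (HVt : forall s, 0 < s < u1 m1 -> v2 (t2 s) < v1 (t1 s)).

Let Hb := beta_gt_1 p q hq hpq.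
Let HM1 : beta < u1 m1 := br_beta _ _ _ _ _ _ _ (pf_rise _ _ _ _ _ _ _ _ _ _ pf1).

Let Hm1 : a < m1 < b.
Proof. exact (pf_m _ _ _ _ _ _ _ _ _ _ pf1). Qed.
Let Hm2 : a < m2 < b.
Proof. exact (pf_m _ _ _ _ _ _ _ _ _ _ pf2). Qed.

Lemma falling_radii s : 0 < s <= u1 m1 -> t1 s < t2 s.
Proof.
  intros Hs.
  assert (bt1 := pf_fall _ _ _ _ _ _ _ _ _ _ pf1). assert (bt2 := pf_fall _ _ _ _ _ _ _ _ _ _ pf2).
  destruct (pf_t_0 _ _ _ _ _ _ _ _ _ _ pf1) as [E1 C1].
  destruct (pf_t_0 _ _ _ _ _ _ _ _ _ _ pf2) as [E2 C2].
  assert (t2 0 - t1 0 < t2 s - t1 s); [ | lra ].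
  apply (lt_of_deriv (fun s => t2 s - t1 s) (fun s => / v2 (t2 s) - / v1 (t1 s))); [ lra | | | ].
  - intros x Hx. destruct (Req_dec x 0) as [->|]; [ now apply cont_minus | ].
    apply cont_minus; [ apply (br_cr _ _ _ _ _ _ _ bt2) | apply (br_cr _ _ _ _ _ _ _ bt1) ]; lra.
  - intros x Hx.
    apply d_minus; [ apply (br_dr _ _ _ _ _ _ _ bt2) | apply (br_dr _ _ _ _ _ _ _ bt1) ]; lra.
  - intros x Hx. specialize (HVt x ltac:(lra)).
    assert (H1 := br_V _ _ _ _ _ _ _ bt1 x ltac:(lra)). simpl in H1.
    assert (H : / - v2 (t2 x) < / - v1 (t1 x)) by (apply Rinv_lt_contravar; nra).
    rewrite !Rinv_opp in H. lra.
Qed.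

Lemma between_radii s x : 0 < s <= u2 m2 -> r2 s < x < t2 s -> s < u2 x.
Proof.
  intros Hs Hx.
  destruct (pf_u_r _ _ _ _ _ _ _ _ _ _ pf2 s ltac:(lra)) as [Hr1 Hr2].
  destruct (pf_u_t _ _ _ _ _ _ _ _ _ _ pf2 s Hs) as [Ht1 [Ht2 Ht3]]. simpl in Ht2.
  destruct (Rle_lt_dec x m2) as [Hxm|Hxm].
  - rewrite <- Hr2. apply (lt_of_deriv u2 v2 (r2 s) x); [ lra | auto | | ].
    + intros z Hz. apply (es_du _ _ _ _ _ _ _ sol2). split; simpl; lra.
    + intros z Hz. apply (pf_v_pos _ _ _ _ _ _ _ _ _ _ pf2). lra.
  - rewrite <- Ht3. apply Ropp_lt_cancel.
    apply (lt_of_deriv (fun x => - u2 x) (fun x => - v2 x)); [ lra | | | ].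
    + intros z _. now apply cont_opp.
    + intros z Hz. apply d_opp, (es_du _ _ _ _ _ _ _ sol2). split; simpl; lra.
    + intros z Hz. assert (v2 z < 0); [ | lra ].
      apply (pf_v_neg _ _ _ _ _ _ _ _ _ _ pf2); simpl; lra.
Qed.

Lemma u1_le_max x : a < x < b -> 0 < u1 x <= u1 m1.
Proof.
  intros Hx. split; [ apply (es_pos _ _ _ _ _ _ _ sol1); now split | ].
  destruct (Rle_lt_dec x m1) as [Hxm|Hxm].
  - apply (le_of_deriv u1 v1); [ lra | auto | | ].
    + intros z Hz. apply (es_du _ _ _ _ _ _ _ sol1). split; simpl; lra.
    + intros z Hz. left. apply (pf_v_pos _ _ _ _ _ _ _ _ _ _ pf1). lra.
  - apply Ropp_le_cancel.
    apply (le_of_deriv (fun x => - u1 x) (fun x => - v1 x)); [ lra | | | ].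
    + intros z _. now apply cont_opp.
    + intros z Hz. apply d_opp, (es_du _ _ _ _ _ _ _ sol1). split; simpl; lra.
    + intros z Hz. assert (v1 z < 0); [ | lra ].
      apply (pf_v_neg _ _ _ _ _ _ _ _ _ _ pf1); simpl; lra.
Qed.

(** At the height [u1 x] the radii satisfy [r2 < r1] and [t1 < t2]. So [x] lies strictly between the
    two points where [u2] has this height. *)
Lemma solutions_ordered x : a < x < b -> u1 x < u2 x.
Proof.
  intros Hx. assert (Hu := u1_le_max x Hx).
  apply between_radii; [ lra | ].
  assert (H1 := Hr (u1 x) Hu). assert (H2 := falling_radii (u1 x) Hu).
  destruct (pf_u_r _ _ _ _ _ _ _ _ _ _ pf1 (u1 x) ltac:(lra)) as [G1 _].
  destruct (pf_u_t _ _ _ _ _ _ _ _ _ _ pf1 (u1 x) Hu) as [G2 _].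
  split.
  - destruct (Rle_lt_dec x m1) as [Hxm|Hxm]; [ | lra ].
    rewrite (pf_r_u _ _ _ _ _ _ _ _ _ _ pf1 x ltac:(lra)) in H1. exact H1.
  - destruct (Rle_lt_dec m1 x) as [Hxm|Hxm]; [ | lra ].
    rewrite (pf_t_u _ _ _ _ _ _ _ _ _ _ pf1 x ltac:(lra) ltac:(simpl; lra)) in H2. exact H2.
Qed.

Let wronskian x := wt x * (u1 x * v2 x - v1 x * u2 x).

Let wronskian_derive x : a < x < b ->
  is_derive wronskian x (- (wt x * (u1 x * f (u2 x) - u2 x * f (u1 x)))).
Proof.
  intros Hx.
  assert (D1 := es_du _ _ _ _ _ _ _ sol1 x Hx). assert (D2 := es_du _ _ _ _ _ _ _ sol2 x Hx).
  assert (D3 := es_dv _ _ _ _ _ _ _ sol1 x Hx). assert (D4 := es_dv _ _ _ _ _ _ _ sol2 x Hx).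
  assert (D5 := wt_derive k (fun x => x) x 1 ltac:(lra) (d_id x)).
  unfold wronskian. eapply derive_val; [ dv | ]. cbv beta.
  generalize (wt x); intros w. field. lra.
Qed.

Let wronskian_continuous x : continuous wronskian x.
Proof.
  unfold wronskian. assert (G1 := cu1 x). assert (G2 := cu2 x). assert (G3 := cv1 x). assert (G4 := cv2 x). ctn.
Qed.

Let wronskian_a : wronskian a = 0.
Proof.
  unfold wronskian. rewrite (es_left _ _ _ _ _ _ _ sol1), (es_left _ _ _ _ _ _ _ sol2) by lra. ring.
Qed.

Lemma no_ordered_pair_sublinear : q <= 1 -> 1 < p -> False.
Proof.
  intros Hq Hp.
  assert (Hab := es_ab _ _ _ _ _ _ _ sol1). simpl in Hab.
  assert (H : - wronskian a < - wronskian b).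
  { apply (lt_of_deriv (fun x => - wronskian x)
      (fun x => - - (wt x * (u1 x * f (u2 x) - u2 x * f (u1 x))))); [ exact Hab | | | ].
    - intros x _. now apply cont_opp.
    - intros x Hx. now apply d_opp, wronskian_derive.
    - intros x Hx. rewrite Ropp_involutive.
      apply Rmult_lt_0_compat; [ apply wt_pos; lra | ].
      assert (H1 := u1_le_max x Hx). assert (H2 := solutions_ordered x Hx).
      assert (H3 := nonlin_ratio_lt p q (u1 x) (u2 x) Hq Hp ltac:(lra) H2). lra. }
  rewrite wronskian_a in H. unfold wronskian in H.
  rewrite (es_right _ _ _ _ _ _ _ sol1), (es_right _ _ _ _ _ _ _ sol2) in H by lra.
  rewrite Rmult_0_l, Rmult_0_r, Rminus_diag, Rmult_0_r in H. lra.
Qed.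

(** [sigma x] is the radius at which the second solution has the height
    [u1 x].  Matching equal heights turns both terms of the Wronskian identity
    into integrals of the same quotient [f(s)/s], with ordered weights. *)
Lemma rising_max_order : 1 <= q -> ~ m1 < m2.
Proof.
  intros Hq Hm.
  (* The quotient [f(s)/s] is at most [c] for heights up to [u1 m1] and larger than [c] above.
     Subtracting [c] in [psi] therefore gives both parts of the estimate their sign. *)
  set (c := f (u1 m1) / u1 m1).
  set (psi := fun x => wt x * (u1 x * f (u2 x) - c * (u1 x * u2 x))).
  assert (Hcpsi : forall x, continuous psi x).
  { intros x. unfold psi. assert (G1 := cu1 x). assert (G2 := cu2 x).
    assert (G3 : continuous (fun x => f (u2 x)) x).
    { apply (continuous_comp u2 f); [ exact G2 | now apply nonlin_continuous ]. }
    ctn. }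
  set (Psi := fun x => RInt psi a x).
  assert (HPsi : forall x, is_derive Psi x (psi x)).
  { intros x. apply (is_derive_RInt psi Psi a x); [ | apply Hcpsi ].
    apply filter_forall. intros y. apply (RInt_correct psi a y).
    apply (ex_RInt_continuous psi a y). intros; apply Hcpsi. }
  set (sigma := fun x => r2 (u1 x)).
  assert (br2 := pf_rise _ _ _ _ _ _ _ _ _ _ pf2).
  assert (Hu1a : u1 a = 0) by (apply (es_left _ _ _ _ _ _ _ sol1); lra).
  assert (Hu1 : forall x, a < x < m1 -> 0 < u1 x < u1 m1).
  { intros x Hx. split; [ apply u1_le_max; lra | ].
    apply (lt_of_deriv u1 v1); [ lra | auto | | ].
    - intros z Hz. apply (es_du _ _ _ _ _ _ _ sol1). split; simpl; lra.
    - intros z Hz. apply (pf_v_pos _ _ _ _ _ _ _ _ _ _ pf1). lra. }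
  assert (Hsa : sigma a = a) by (unfold sigma; rewrite Hu1a; apply (pf_r_0 _ _ _ _ _ _ _ _ _ _ pf2)).
  assert (Hcs : forall x, a <= x <= m1 -> continuous sigma x).
  { intros x Hx. apply (continuous_comp u1 r2); [ apply cu1 | ].
    destruct (Req_dec x a) as [->|Hxa].
    - rewrite Hu1a. apply (pf_cr_0 _ _ _ _ _ _ _ _ _ _ pf2).
    - apply (br_cr _ _ _ _ _ _ _ br2). destruct (u1_le_max x ltac:(lra)). lra. }
  assert (HK : forall x, a < x < m1 -> is_derive (fun x => - wronskian x - (Psi x - Psi (sigma x))) x
     (- - (wt x * (u1 x * f (u2 x) - u2 x * f (u1 x)))
        - (psi x - v1 x * / v2 (sigma x) * psi (sigma x)))).
  { intros x Hx.
    assert (D1 := wronskian_derive x ltac:(lra)). assert (D2 := HPsi x).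
    assert (D3 : is_derive sigma x (v1 x * / v2 (sigma x))).
    { apply (is_derive_comp r2 u1).
      - specialize (Hu1 x Hx). apply (br_dr _ _ _ _ _ _ _ br2). lra.
      - apply (es_du _ _ _ _ _ _ _ sol1). split; simpl; lra. }
    assert (D4 : is_derive (fun x => Psi (sigma x)) x (v1 x * / v2 (sigma x) * psi (sigma x))).
    { apply (is_derive_comp Psi sigma); [ apply HPsi | exact D3 ]. }
    dv. }
  (* This quantity is 0 at [a], so [- wronskian m1] is at least the integral of [psi] from
     [sigma m1] to [m1], which turns out positive. But [m1 < m2] would make [wronskian m1]
     nonnegative. *)
  assert (HK0 : - wronskian a - (Psi a - Psi (sigma a))
             <= - wronskian m1 - (Psi m1 - Psi (sigma m1))).
  { apply (le_of_deriv (fun x => - wronskian x - (Psi x - Psi (sigma x))) _ a m1 ltac:(lra)) with (2 := HK).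
    - intros x Hx. apply cont_minus; [ apply cont_opp, wronskian_continuous | ].
      apply cont_minus.
      + apply (cont_derive _ _ _ (HPsi x)).
      + apply (continuous_comp sigma Psi); [ now apply Hcs | apply (cont_derive _ _ _ (HPsi _)) ].
    - intros x Hx. specialize (Hu1 x Hx).
      assert (H1 := Hr (u1 x) ltac:(lra)).
      rewrite (pf_r_u _ _ _ _ _ _ _ _ _ _ pf1 x ltac:(lra)) in H1.
      destruct (pf_u_r _ _ _ _ _ _ _ _ _ _ pf2 (u1 x) ltac:(lra)) as [H2 E].
      assert (H3 := HVr (u1 x) ltac:(lra)).
      rewrite (pf_r_u _ _ _ _ _ _ _ _ _ _ pf1 x ltac:(lra)) in H3.
      assert (H4 := pf_v_pos _ _ _ _ _ _ _ _ _ _ pf1 x Hx).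
      fold (sigma x) in H1, H2, H3, E.
      assert (H5 := solutions_ordered x ltac:(lra)).
      assert (H6 : 0 <= u1 (sigma x) <= u1 x).
      { split.
        - destruct (Req_dec (sigma x) a) as [->|]; [ lra | ]. left. apply u1_le_max. lra.
        - apply (le_of_deriv u1 v1); [ lra | auto | | ].
          + intros z Hz. apply (es_du _ _ _ _ _ _ _ sol1). split; simpl; lra.
          + intros z Hz. left. apply (pf_v_pos _ _ _ _ _ _ _ _ _ _ pf1). lra. }
      assert (H7 : 0 < v1 x * / v2 (sigma x) <= 1).
      { split.
        - apply Rmult_lt_0_compat; [ exact H4 | apply Rinv_0_lt_compat; lra ].
        - apply Rmult_le_reg_r with (v2 (sigma x)); [ lra | ].
          rewrite Rmult_assoc, Rinv_l; lra. }
      assert (H8 : f (u1 x) <= c * u1 x).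
      { assert (G := nonlin_ratio_lt_above_1 p q (u1 x) (u1 m1) Hq hpq ltac:(lra) ltac:(lra) ltac:(lra)).
        unfold c. apply Rmult_le_reg_l with (u1 m1); [ lra | ].
        replace (u1 m1 * (f (u1 m1) / u1 m1 * u1 x)) with (u1 x * f (u1 m1)) by (field; lra). lra. }
      assert (H9 := wt_le k (sigma x) x ltac:(lra) ltac:(lra)).
      assert (H10 := wt_pos k (sigma x) ltac:(lra)).
      (* Since [u2 (sigma x) = u1 x], the rate factors: [c * u1 x - f (u1 x)] times a difference of
         ordered weights. *)
      unfold psi. rewrite E. set (y := v1 x * / v2 (sigma x)) in *.
      replace (_ - _) with ((c * u1 x - f (u1 x)) * (wt x * u2 x - wt (sigma x) * u1 (sigma x) * y))
        by ring.
      apply Rmult_le_pos; [ lra | ].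
      assert (wt (sigma x) * u1 (sigma x) * y <= wt x * u2 x * 1).
      { apply Rmult_le_compat; try lra.
        - apply Rmult_le_pos; lra.
        - apply Rmult_le_compat; lra. }
      lra. }
  assert (Hsm : sigma m1 < m1).
  { unfold sigma. assert (H := Hr (u1 m1) ltac:(lra)).
    rewrite (pf_r_u _ _ _ _ _ _ _ _ _ _ pf1 m1 ltac:(lra)) in H. exact H. }
  assert (Hsm' : a <= sigma m1) by (apply (pf_u_r _ _ _ _ _ _ _ _ _ _ pf2); lra).
  (* Between these radii [u2] exceeds [u1 m1], hence [f (u2 x) > c * u2 x]. *)
  assert (HP : Psi (sigma m1) < Psi m1).
  { apply (lt_of_deriv Psi psi); [ exact Hsm | | auto | ].
    - intros x _. apply (cont_derive _ _ _ (HPsi x)).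
    - intros x Hx. unfold psi. specialize (Hu1 x ltac:(lra)).
      assert (H1 : u1 m1 < u2 x).
      { apply between_radii; [ lra | ]. split; [ apply Hx | ].
        assert (H := falling_radii (u1 m1) ltac:(lra)).
        rewrite (pf_t_top _ _ _ _ _ _ _ _ _ _ pf1) in H. lra. }
      assert (G := nonlin_ratio_lt_above_1 p q (u1 m1) (u2 x) Hq hpq ltac:(lra) ltac:(lra) ltac:(lra)).
      assert (H2 : c * u2 x < f (u2 x)).
      { unfold c. apply Rmult_lt_reg_l with (u1 m1); [ lra | ].
        replace (u1 m1 * (f (u1 m1) / u1 m1 * u2 x)) with (u2 x * f (u1 m1)) by (field; lra). lra. }
      apply Rmult_lt_0_compat; [ apply wt_pos; lra | ].
      replace (u1 x * f (u2 x) - c * (u1 x * u2 x)) with (u1 x * (f (u2 x) - c * u2 x)) by ring.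
      apply Rmult_lt_0_compat; lra. }
  assert (HW : 0 <= wronskian m1).
  { unfold wronskian. rewrite (pf_vm _ _ _ _ _ _ _ _ _ _ pf1).
    assert (0 < v2 m1) by (apply (pf_v_pos _ _ _ _ _ _ _ _ _ _ pf2); lra).
    assert (0 < wt m1) by (apply wt_pos; lra).
    apply Rmult_le_pos; nra. }
  rewrite wronskian_a, Hsa in HK0. lra.
Qed.

End Finite.

(** * The falling branch in Emden-Fowler variables *)

(** Emden-Fowler variables centred at the outer radius [b]; [x] is the
    distance to [b]. *)
Definition log_slope (b : R) (u v : R -> R) (x : R) : R := x * - v (b - x) / u (b - x).

Definition rescaled (b c : R) (u : R -> R) (x : R) : R := u (b - x) * rpow x c.

Section OneSolution.
Context (k : nat) (p q : R) (hq : 1 <= q) (hpq : q < p).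

Local Notation d := (INR k + 1).
Local Notation f := (nonlin p q).
Local Notation c := (2 / (p - 1)).

Let hq0 : 0 < q.
Proof. lra. Qed.

Let c_pos : 0 < c.
Proof. apply Rdiv_lt_0_compat; lra. Qed.

Context (a b : R) (u v : R -> R) (sol : extended_solution k p q a b u v).
Context (m : R) (r t : R -> R) (pf : profile k p q a b u v m r t).

Local Notation th := (log_slope b u v).
Local Notation z := (rescaled b c u).

Let Ha : 0 < a := es_a _ _ _ _ _ _ _ sol.
Let cu := es_cu _ _ _ _ _ _ _ sol.
Let cv := es_cv _ _ _ _ _ _ _ sol.
Let Hm : a < m < b.
Proof. exact (pf_m _ _ _ _ _ _ _ _ _ _ pf). Qed.

(** A Hopf lemma at [b]. Because [q >= 1], [|f u| <= C0 * u] for bounded [u], so [v b = 0] would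
    make [u^2 + v^2] vanish back to [m] by Gronwall. *)
Lemma end_slope_neg : v b < 0.
Proof.
  assert (H0 := end_slope_nonpos k p q a b u v m r t pf cv).
  destruct (Req_dec (v b) 0) as [E|]; [ exfalso | lra ].
  set (M := u m). set (C0 := rpow M (p - 1) + rpow M (q - 1)).
  assert (HC0 : 0 <= C0) by (unfold C0; generalize (rpow_nonneg M (p - 1)) (rpow_nonneg M (q - 1)); lra).
  assert (HuM : forall x, m < x < b -> 0 < u x <= M).
  { intros x Hx. split; [ apply (es_pos _ _ _ _ _ _ _ sol); split; simpl; lra | ].
    apply Ropp_le_cancel. apply (le_of_deriv (fun x => - u x) (fun x => - v x)); [ lra | | | ].
    - intros y _. now apply cont_opp.
    - intros y Hy. apply d_opp, (es_du _ _ _ _ _ _ _ sol). split; simpl; lra.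
    - intros y Hy. assert (v y < 0); [ | lra ].
      apply (pf_v_neg _ _ _ _ _ _ _ _ _ _ pf); simpl; lra. }
  assert (HM : 0 < M) by (apply (es_pos _ _ _ _ _ _ _ sol); split; simpl; lra).
  assert (HN : u m ^ 2 + v m ^ 2 <= 0).
  { apply (gronwall_left (fun x => u x ^ 2 + v x ^ 2)
      (fun x => 2 * u x * v x + 2 * v x * (- (d / x) * v x - f (u x)))
      (1 + 2 * (d / m) + C0) m b).
    - lra.
    - intros x _. assert (G1 := cu x). assert (G2 := cv x). ctn.
    - intros x Hx. assert (Hx' : open_itv a b x) by (split; simpl; lra).
      assert (D1 := es_du _ _ _ _ _ _ _ sol x Hx'). assert (D2 := es_dv _ _ _ _ _ _ _ sol x Hx').
      eapply derive_val; [ dv | ]. simpl pred. simpl (INR 2). cbv beta. ring.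
    - intros x Hx. specialize (HuM x Hx).
      assert (Hf : Rabs (f (u x)) <= C0 * u x).
      { rewrite nonlin_factor, Rabs_mult, Rabs_right, Rmult_comm by lra.
        apply Rmult_le_compat_r; [ lra | ].
        assert (G1 := rpow_le (u x) M (p - 1) ltac:(lra) ltac:(lra) ltac:(lra)).
        assert (G2 := rpow_le (u x) M (q - 1) ltac:(lra) ltac:(lra) ltac:(lra)).
        assert (G3 := rpow_nonneg (u x) (p - 1)). assert (G4 := rpow_nonneg (u x) (q - 1)).
        unfold C0. apply Rabs_le. lra. }
      assert (Hd := d_ge_1 k).
      assert (B1 : d / x * v x ^ 2 <= d / m * v x ^ 2).
      { apply Rmult_le_compat_r; [ apply pow2_ge_0 | ].
        apply Rmult_le_compat_l; [ lra | ]. apply Rinv_le_contravar; lra. }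
      assert (B2 : 2 * v x * f (u x) <= C0 * (u x ^ 2 + v x ^ 2)).
      { apply Rle_trans with (2 * (Rabs (v x) * Rabs (f (u x)))).
        - rewrite <- Rabs_mult. generalize (Rle_abs (v x * f (u x))). lra.
        - apply Rle_trans with (2 * (Rabs (v x) * (C0 * u x))).
          + apply Rmult_le_compat_l; [ lra | ]. apply Rmult_le_compat_l; [ apply Rabs_pos | exact Hf ].
          + rewrite <- (pow2_abs (v x)).
            replace (C0 * (u x ^ 2 + Rabs (v x) ^ 2) ) with
              (2 * (Rabs (v x) * (C0 * u x)) + C0 * (u x - Rabs (v x)) ^ 2) by ring.
            assert (0 <= C0 * (u x - Rabs (v x)) ^ 2) by (apply Rmult_le_pos; [ lra | apply pow2_ge_0 ]).
            lra. }
      assert (B3 : - (2 * u x * v x) <= u x ^ 2 + v x ^ 2) by (generalize (pow2_ge_0 (u x + v x)); nra).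
      assert (B4 : 0 <= d / m * u x ^ 2).
      { apply Rmult_le_pos; [ apply Rlt_le, Rdiv_lt_0_compat; lra | apply pow2_ge_0 ]. }
      nra.
    - rewrite (es_right _ _ _ _ _ _ _ sol), E by lra. ring. }
  fold M in HN. assert (0 <= v m ^ 2) by apply pow2_ge_0. nra.
Qed.

Lemma u_near_end_pos x : 0 < x < b - a -> 0 < u (b - x).
Proof. intros Hx. apply (es_pos _ _ _ _ _ _ _ sol). split; simpl; lra. Qed.

Lemma u_reflect_derive x : 0 < x < b - a -> is_derive (fun x => u (b - x)) x (- v (b - x)).
Proof.
  intros Hx. apply (derive_val _ _ (-1 * v (b - x))); [ | ring ].
  apply (is_derive_comp u (fun x => b - x)).
  - apply (es_du _ _ _ _ _ _ _ sol). split; simpl; lra.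
  - eapply derive_val; [ dv | ring ].
Qed.

Lemma v_reflect_derive x : 0 < x < b - a ->
  is_derive (fun x => - v (b - x)) x (d / (b - x) * - v (b - x) - f (u (b - x))).
Proof.
  intros Hx.
  apply (derive_val _ _ (- (-1 * (- (d / (b - x)) * v (b - x) - f (u (b - x)))))); [ | ring ].
  apply d_opp. apply (is_derive_comp v (fun x => b - x)).
  - apply (es_dv _ _ _ _ _ _ _ sol). split; simpl; lra.
  - eapply derive_val; [ dv | ring ].
Qed.

(** The derivative of the logarithmic slope with respect to [ln x]: an autonomous part, the drag
    from the first-order term, and the forcing by [f]. *)
Definition log_slope_rate (x : R) : R :=
  th x * (1 - th x) + th x * (d * x / (b - x)) - x ^ 2 * (f (u (b - x)) / u (b - x)).

Lemma log_slope_derive x : 0 < x < b - a -> is_derive th x (log_slope_rate x / x).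
Proof.
  intros Hx. assert (D1 := u_reflect_derive x Hx). assert (D2 := v_reflect_derive x Hx).
  assert (Hu := u_near_end_pos x Hx).
  unfold log_slope_rate, log_slope.
  eapply derive_val.
  - unfold Rdiv. apply (d_mult (fun x => x * - v (b - x)) (fun x => / u (b - x))).
    + apply (d_mult (fun x => x)); [ apply d_id | exact D2 ].
    + apply (d_inv (fun x => u (b - x))); [ lra | exact D1 ].
  - cbv beta. field. lra.
Qed.

Lemma rescaled_derive x : 0 < x < b - a -> is_derive z x (z x * (th x + c) / x).
Proof.
  intros Hx. assert (D1 := u_reflect_derive x Hx). assert (D2 := rpow_derive x c (proj1 Hx)).
  assert (Hu := u_near_end_pos x Hx).
  unfold rescaled, log_slope.
  eapply derive_val; [ apply (d_mult (fun x => u (b - x)) (fun x => rpow x c)); [ exact D1 | exact D2 ] | ].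
  cbv beta. replace (rpow x c) with (rpow x (c - 1) * x).
  - field. lra.
  - rewrite <- (rpow_1_r x (proj1 Hx)) at 2. rewrite <- rpow_plus by lra. f_equal. ring.
Qed.

Lemma rescaled_continuous x : continuous z x.
Proof.
  unfold rescaled. apply cont_mult; [ | now apply rpow_continuous ].
  apply (continuous_comp (fun x => b - x) u); [ ctn | apply cu ].
Qed.

Lemma log_slope_continuous x : 0 < x < b - a -> continuous th x.
Proof. intros Hx. apply (cont_derive _ _ _ (log_slope_derive x Hx)). Qed.

Lemma log_slope_pos x : 0 < x < b - m -> 0 < th x.
Proof.
  intros Hx. unfold log_slope. apply Rdiv_lt_0_compat; [ | apply u_near_end_pos; lra ].
  assert (v (b - x) < 0) by (apply (pf_v_neg _ _ _ _ _ _ _ _ _ _ pf); simpl; lra). nra.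
Qed.

Lemma rescaled_pos x : 0 < x < b - a -> 0 < z x.
Proof. intros Hx. apply Rmult_lt_0_compat; [ now apply u_near_end_pos | apply rpow_pos; lra ]. Qed.

(** As [c * (p - 1) = 2], the first term is a function of [z] alone. The radius enters only through
    the second, with an exponent that is positive because [q < p]; so at equal [z] the forcing is
    larger for smaller [x]. *)
Lemma forcing_rescaled x : 0 < x < b - a ->
  x ^ 2 * (f (u (b - x)) / u (b - x))
    = rpow (z x) (p - 1) - rpow (z x) (q - 1) * rpow x (2 - c * (q - 1)).
Proof.
  intros Hx. assert (Hu := u_near_end_pos x Hx).
  assert (Hc : c * (p - 1) = 2) by (field; lra).
  unfold rescaled. rewrite !rpow_mult_l, !rpow_mult by (try apply rpow_pos; lra).
  rewrite nonlin_factor, Hc by exact Hu.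
  assert (E2 : rpow x 2 = x ^ 2).
  { replace 2 with (1 + 1) at 1 by ring. rewrite rpow_plus, rpow_1_r by lra. ring. }
  assert (E3 : rpow x (c * (q - 1)) * rpow x (2 - c * (q - 1)) = x ^ 2).
  { rewrite <- rpow_plus, <- E2 by lra. f_equal. ring. }
  rewrite Rmult_assoc, E3, E2. field. lra.
Qed.

(** By the mean value theorem [u (b - x)] is [x] times a slope near [b], so the logarithmic slope is
    a quotient of two slopes close to [v b], which is nonzero by [end_slope_neg]. *)
Lemma log_slope_near_end e : 0 < e <= 1 ->
  exists x0, 0 < x0 < b - m /\ forall x, 0 < x < x0 -> Rabs (th x - 1) <= e.
Proof.
  intros He. assert (Hv := end_slope_neg). set (al := - v b).
  assert (Hal : 0 < al) by (unfold al; lra).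
  assert (Hp : 0 < e / 4 * al) by nra.
  assert (Hcy : continuous (fun x => - v (b - x)) 0).
  { apply cont_opp, (continuous_comp (fun x => b - x) v); [ ctn | apply cv ]. }
  apply filterlim_locally with (eps := mkposreal _ Hp) in Hcy. destruct Hcy as [x1 Hx1].
  set (x0 := Rmin x1 ((b - m) / 2)).
  assert (Hx0 : 0 < x0 < b - m /\ x0 <= x1).
  { unfold x0. generalize (Rmin_l x1 ((b - m) / 2)) (Rmin_r x1 ((b - m) / 2)).
    intros; repeat split; try lra. apply Rmin_glb_lt; [ apply cond_pos | lra ]. }
  exists x0. split; [ tauto | ]. intros x Hx.
  assert (HY : forall y, 0 < y <= x -> Rabs (- v (b - y) - al) < e / 4 * al).
  { intros y Hy. unfold al. rewrite <- (Rminus_0_r b) at 2.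
    apply Hx1. change (Rabs (y - 0) < x1). rewrite Rminus_0_r, Rabs_right; lra. }
  destruct (mean_value (fun x => u (b - x)) (fun x => - v (b - x)) 0 x) as [y [Hy E]]; [ lra | | | ].
  { intros y _. apply (continuous_comp (fun x => b - x) u); [ ctn | apply cu ]. }
  { intros y Hy. apply u_reflect_derive. lra. }
  rewrite Rminus_0_r, (es_right _ _ _ _ _ _ _ sol b), !Rminus_0_r in E by lra.
  assert (H1 := HY x ltac:(lra)). assert (H2 := HY y ltac:(lra)).
  apply Rabs_def2 in H1. apply Rabs_def2 in H2.
  unfold log_slope. rewrite E.
  set (A := - v (b - x)) in *. set (C := - v (b - y)) in *.
  assert (HC : 3 / 4 * al <= C) by nra.
  replace (x * A / (C * x) - 1) with ((A - C) / C) by (field; lra).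
  unfold Rdiv. rewrite Rabs_mult, Rabs_inv, (Rabs_right C) by lra.
  apply Rmult_le_reg_r with C; [ lra | ]. rewrite Rmult_assoc, Rinv_l, Rmult_1_r by lra.
  apply Rabs_le. nra.
Qed.

End OneSolution.

(** Cross-multiplied form of the fact that
    [y |-> (y (1 + A - y) - B) / (y + c)] decreases near [y = 1]. *)
Lemma autonomous_rate_decreasing c A B y1 y2 :
  0 < c -> A <= 1 / 4 -> B <= 1 / 4 -> 3 / 4 <= y1 -> y1 <= y2 ->
  (y2 * (1 - y2) + y2 * A - B) * (y1 + c) <= (y1 * (1 - y1) + y1 * A - B) * (y2 + c).
Proof.
  intros Hc HA HB H1 H2.
  assert (E : (y1 * (1 - y1) + y1 * A - B) * (y2 + c) - (y2 * (1 - y2) + y2 * A - B) * (y1 + c)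
    = (y2 - y1) * (y1 * y2 - B + c * (y1 + y2 - 1 - A))) by ring.
  assert (0 <= (y2 - y1) * (y1 * y2 - B + c * (y1 + y2 - 1 - A))); [ | lra ].
  apply Rmult_le_pos; [ lra | ]. assert (0 <= c * (y1 + y2 - 1 - A)) by (apply Rmult_le_pos; lra).
  nra.
Qed.

Section FallingOrder.
Context (k : nat) (p q : R) (hq : 1 <= q) (hpq : q < p).

Local Notation d := (INR k + 1).
Local Notation f := (nonlin p q).
Local Notation c := (2 / (p - 1)).

Context (a b : R) (u1 v1 u2 v2 : R -> R).
Context (sol1 : extended_solution k p q a b u1 v1) (sol2 : extended_solution k p q a b u2 v2).
Context (m1 : R) (r1 t1 : R -> R) (pf1 : profile k p q a b u1 v1 m1 r1 t1).
Context (m2 : R) (r2 t2 : R -> R) (pf2 : profile k p q a b u2 v2 m2 r2 t2).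
Context (HM : u1 m1 < u2 m2) (Hord : forall x, a < x < b -> u1 x < u2 x).

Let hp : 1 < p.
Proof. lra. Qed.
Let c_pos : 0 < c.
Proof. apply Rdiv_lt_0_compat; lra. Qed.

Local Notation th1 := (log_slope b u1 v1).
Local Notation th2 := (log_slope b u2 v2).
Local Notation z1 := (rescaled b c u1).
Local Notation z2 := (rescaled b c u2).

(** With [c = 2 / (p - 1)] the equation for the logarithmic slope at a given
    value of [z = u x^c] depends on [x] monotonically.  [sigma] matches equal
    values of [z]; if [m2 <= m1], then the logarithmic slopes are ordered at the
    maximum of [u1] and stay so down to [b], where both tend to 1. *)
Lemma falling_max_order : m1 < m2.
Proof.
  destruct (Rlt_le_dec m1 m2) as [|Hn]; [ assumption | exfalso ].
  assert (Hm1 : a < m1 < b) by exact (pf_m _ _ _ _ _ _ _ _ _ _ pf1).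
  assert (Hm2 : a < m2 < b) by exact (pf_m _ _ _ _ _ _ _ _ _ _ pf2).
  assert (Ha := es_a _ _ _ _ _ _ _ sol1).
  set (e1 := b - m1). set (e2 := b - m2).
  assert (He : 0 < e1 <= e2 /\ e2 < b - a) by (unfold e1, e2; lra).
  assert (Hz1c := rescaled_continuous k p q hq hpq a b u1 v1 sol1).
  assert (Hz2c := rescaled_continuous k p q hq hpq a b u2 v2 sol2).
  assert (Hz2' : forall x, 0 < x < e2 -> 0 < z2 x * (th2 x + c) / x).
  { intros x Hx. apply Rdiv_lt_0_compat; [ | lra ]. apply Rmult_lt_0_compat.
    - apply (rescaled_pos k p q a b u2 v2 sol2). lra.
    - assert (H := log_slope_pos k p q a b u2 v2 sol2 m2 r2 t2 pf2 x ltac:(unfold e2 in *; lra)). lra. }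
  assert (Hz2d : forall x, 0 < x < e2 -> is_derive z2 x (z2 x * (th2 x + c) / x)).
  { intros x Hx. apply (rescaled_derive k p q hq hpq a b u2 v2 sol2). lra. }
  assert (Hz1' : forall x, 0 < x < e1 -> 0 < z1 x * (th1 x + c) / x).
  { intros x Hx. apply Rdiv_lt_0_compat; [ | lra ]. apply Rmult_lt_0_compat.
    - apply (rescaled_pos k p q a b u1 v1 sol1). lra.
    - assert (H := log_slope_pos k p q a b u1 v1 sol1 m1 r1 t1 pf1 x ltac:(unfold e1 in *; lra)). lra. }
  assert (Hz1d : forall x, 0 < x < e1 -> is_derive z1 x (z1 x * (th1 x + c) / x)).
  { intros x Hx. apply (rescaled_derive k p q hq hpq a b u1 v1 sol1). lra. }
  assert (Hz1mono : forall x, 0 < x <= e1 -> z1 x <= z1 e1).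
  { intros x Hx. apply (le_of_deriv z1 (fun x => z1 x * (th1 x + c) / x)); [ lra | auto | | ].
    - intros y Hy. apply Hz1d. lra.
    - intros y Hy. left. apply Hz1'. lra. }
  (* For [x <= 0] the function [z2] is 0 by the default value of [rpow], as required here. *)
  destruct (increasing_inverse z2 (fun x => z2 x * (th2 x + c) / x) 0 e2) as [S [S1 [S2 S3]]]; auto.
  { lra. }
  { intros x Hx. unfold rescaled. rewrite rpow_neg by exact Hx. ring. }
  (* This is where [m2 <= m1] enters: [e1 <= e2] and the higher second maximum ensure that [z2]
     takes all values of [z1] before [e2]. *)
  assert (Hend : z1 e1 < z2 e2).
  { unfold rescaled, e1 at 1, e2 at 1.
    replace (b - (b - m1)) with m1 by ring. replace (b - (b - m2)) with m2 by ring.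
    assert (H1 := rpow_le e1 e2 c ltac:(lra) ltac:(lra) ltac:(lra)).
    assert (H2 := rpow_pos e1 c ltac:(lra)).
    assert (0 < u1 m1) by (apply (es_pos _ _ _ _ _ _ _ sol1); split; simpl; lra). nra. }
  assert (Hz1pos : forall x, 0 < x <= e1 -> 0 < z1 x).
  { intros x Hx. apply (rescaled_pos k p q a b u1 v1 sol1). lra. }
  set (sigma := fun x => S (z1 x)).
  assert (Hsz : forall x, 0 < x <= e1 -> z2 (sigma x) = z1 x).
  { intros x Hx. apply S2. specialize (Hz1mono x Hx). specialize (Hz1pos x Hx). lra. }
  assert (Hs2 : forall x, 0 < x <= e1 -> 0 < sigma x < e2).
  { intros x Hx. apply S3. specialize (Hz1mono x Hx). specialize (Hz1pos x Hx). lra. }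
  (* From [u1 < u2] follows [z1 < z2] at equal [x], so [z2] reaches a given value earlier. *)
  assert (Hsx : forall x, 0 < x <= e1 -> sigma x < x).
  { intros x Hx. destruct (Rlt_le_dec (sigma x) x) as [|Hle]; [ assumption | exfalso ].
    assert (H1 : z2 x <= z2 (sigma x)).
    { apply (le_of_deriv z2 (fun x => z2 x * (th2 x + c) / x)); [ lra | auto | | ].
      - intros y Hy. specialize (Hs2 x Hx). apply Hz2d. lra.
      - intros y Hy. specialize (Hs2 x Hx). left. apply Hz2'. lra. }
    rewrite Hsz in H1 by exact Hx. unfold rescaled in H1.
    assert (H2 := Hord (b - x) ltac:(lra)). assert (H3 := rpow_pos x c ltac:(lra)). nra. }
  assert (Hscont : forall x, 0 < x <= e1 -> continuous sigma x).
  { intros x Hx. apply (continuous_comp z1 S); [ apply Hz1c | ].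
    apply S2. specialize (Hz1mono x Hx). specialize (Hz1pos x Hx). lra. }
  assert (Hth1 : forall x, 0 < x < e1 -> 0 < th1 x).
  { intros x Hx. apply (log_slope_pos k p q a b u1 v1 sol1 m1 r1 t1 pf1). unfold e1 in *. lra. }
  assert (Hth2 : forall x, 0 < x < e2 -> 0 < th2 x).
  { intros x Hx. apply (log_slope_pos k p q a b u2 v2 sol2 m2 r2 t2 pf2). unfold e2 in *. lra. }
  assert (Hsd : forall x, 0 < x < e1 ->
    is_derive sigma x (sigma x * (th1 x + c) / (x * (th2 (sigma x) + c)))).
  { intros x Hx. specialize (Hs2 x ltac:(lra)). specialize (Hth2 _ Hs2). specialize (Hth1 _ Hx).
    assert (E := Hsz x ltac:(lra)). assert (Hzp := Hz1pos x ltac:(lra)).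
    apply (derive_val _ _ ((z1 x * (th1 x + c) / x) * / (z2 (sigma x) * (th2 (sigma x) + c) / sigma x))).
    - apply (is_derive_comp S z1); [ | now apply Hz1d ].
      apply S3. specialize (Hz1mono x ltac:(lra)). lra.
    - rewrite E. field. repeat split; try lra. nra. }
  set (rate1 := log_slope_rate k p q b u1 v1). set (rate2 := log_slope_rate k p q b u2 v2).
  set (h := fun x => th2 (sigma x) - th1 x).
  assert (Hhc : forall x, 0 < x <= e1 -> continuous h x).
  { intros x Hx. apply cont_minus.
    - apply (continuous_comp sigma th2); [ now apply Hscont | ].
      apply (log_slope_continuous k p q a b u2 v2 sol2). specialize (Hs2 x Hx). lra.
    - apply (log_slope_continuous k p q a b u1 v1 sol1). lra. }
  assert (Hhd : forall x, 0 < x < e1 -> is_derive h x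
    ((rate2 (sigma x) * (th1 x + c) - rate1 x * (th2 (sigma x) + c)) / (x * (th2 (sigma x) + c)))).
  { intros x Hx. specialize (Hs2 x ltac:(lra)). specialize (Hth2 _ Hs2).
    eapply derive_val.
    - apply d_minus.
      + apply (is_derive_comp th2 sigma); [ | now apply Hsd ].
        apply (log_slope_derive k p q a b u2 v2 sol2). lra.
      + apply (log_slope_derive k p q a b u1 v1 sol1). lra.
    - fold rate1 rate2.
      change (scal (sigma x * (th1 x + c) / (x * (th2 (sigma x) + c))) (rate2 (sigma x) / sigma x))
        with ((sigma x * (th1 x + c) / (x * (th2 (sigma x) + c))) * (rate2 (sigma x) / sigma x)).
      field. repeat split; try lra; nra. }
  assert (Hdrag : forall x, 0 < x <= e1 -> d * sigma x / (b - sigma x) < d * x / (b - x)).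
  { intros x Hx. specialize (Hs2 x Hx). specialize (Hsx x Hx). assert (Hd := d_ge_1 k).
    unfold Rdiv. rewrite !Rmult_assoc. apply Rmult_lt_compat_l; [ lra | ].
    assert (/ (b - sigma x) < / (b - x)) by (apply Rinv_lt_contravar; nra).
    assert (0 < / (b - sigma x)) by (apply Rinv_0_lt_compat; lra). nra. }
  assert (Hforce : forall x, 0 < x <= e1 ->
    x ^ 2 * (f (u1 (b - x)) / u1 (b - x))
      < sigma x ^ 2 * (f (u2 (b - sigma x)) / u2 (b - sigma x))).
  { intros x Hx. specialize (Hs2 x Hx). specialize (Hsx x Hx).
    rewrite (forcing_rescaled k p q hq hpq a b u1 v1 sol1) by lra.
    rewrite (forcing_rescaled k p q hq hpq a b u2 v2 sol2) by lra.
    rewrite Hsz by exact Hx.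
    assert (Hkap : 0 < 2 - c * (q - 1)).
    { replace (2 - c * (q - 1)) with (c * (p - q)) by (field; lra). apply Rmult_lt_0_compat; lra. }
    assert (H1 := rpow_lt (sigma x) x (2 - c * (q - 1)) ltac:(lra) Hsx Hkap).
    assert (H2 := rpow_pos (z1 x) (q - 1) (Hz1pos x Hx)). nra. }
  (* At [e1], the maximum of [u1], [th1] is 0 and [th2 (sigma e1) > 0]. Where the slopes agree the
     autonomous parts agree as well, while at [sigma y < y] the drag is smaller and the forcing
     larger; so [h' < 0], although [h] is positive to the right. *)
  assert (Hh : forall x, 0 < x <= e1 -> 0 < h x).
  { apply first_crossing_left; [ exact Hhc | | ].
    - unfold h. specialize (Hs2 e1 ltac:(lra)). specialize (Hth2 _ Hs2).
      assert (E : th1 e1 = 0).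
      { unfold log_slope, e1. replace (b - (b - m1)) with m1 by ring.
        rewrite (pf_vm _ _ _ _ _ _ _ _ _ _ pf1). unfold Rdiv. ring. }
      lra.
    - intros y Hy E Hpos.
      assert (H := derive_nonneg_at_zero h y e1 _ ltac:(lra) E ltac:(intros; apply Hpos; lra) (Hhd y Hy)).
      assert (G1 := Hdrag y ltac:(lra)). assert (G2 := Hforce y ltac:(lra)).
      assert (G3 := Hth1 y Hy).
      assert (E' : th2 (sigma y) = th1 y) by (unfold h in E; lra).
      assert (Hrate : rate2 (sigma y) < rate1 y).
      { unfold rate1, rate2, log_slope_rate. rewrite E'. nra. }
      rewrite E' in H.
      assert (0 < (rate1 y * (th1 y + c) - rate2 (sigma y) * (th1 y + c)) / (y * (th1 y + c))).
      { apply Rdiv_lt_0_compat; [ nra | apply Rmult_lt_0_compat; lra ]. }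
      unfold Rdiv in *. lra. }
  (* The thresholds [x1] to [x4] secure the hypotheses of [autonomous_rate_decreasing]: slopes
     within 1/4 of 1, [u1 < 1] (which with [x < 1/2] bounds the forcing by 1/4), and drag below
     1/4. *)
  destruct (log_slope_near_end k p q hq hpq a b u1 v1 sol1 m1 r1 t1 pf1 (1 / 4) ltac:(lra)) as [x1 [Hx1 N1]].
  destruct (log_slope_near_end k p q hq hpq a b u2 v2 sol2 m2 r2 t2 pf2 (1 / 4) ltac:(lra)) as [x2 [Hx2 N2]].
  destruct (continuous_pos_locally (fun x => 1 - u1 (b - x)) 0) as [x3 [Hx3 N3]].
  { apply cont_minus; [ ctn | ]. apply (continuous_comp (fun x => b - x) u1); [ ctn | apply (es_cu _ _ _ _ _ _ _ sol1) ]. }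
  { rewrite Rminus_0_r, (es_right _ _ _ _ _ _ _ sol1) by lra. lra. }
  destruct (continuous_pos_locally (fun x => 1 / 4 - d * x / (b - x)) 0) as [x4 [Hx4 N4]].
  { apply cont_minus; [ ctn | ].
    apply (cont_mult (fun x => d * x) (fun x => / (b - x))).
    - apply (cont_mult (fun _ => d) (fun x => x)); ctn.
    - apply (cont_inv (fun x => b - x)); [ apply (cont_minus (fun _ => b) (fun x => x)); ctn | lra ]. }
  { unfold Rdiv. rewrite Rmult_0_r, Rmult_0_l. lra. }
  set (x0 := Rmin (Rmin x1 x2) (Rmin (Rmin x3 x4) (1 / 2)) / 2).
  assert (Hx0 : 0 < x0 /\ x0 < x1 /\ x0 < x2 /\ x0 < x3 /\ x0 < x4 /\ x0 < 1 / 2).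
  { unfold x0.
    assert (M1 := Rmin_l (Rmin x1 x2) (Rmin (Rmin x3 x4) (1 / 2))).
    assert (M2 := Rmin_r (Rmin x1 x2) (Rmin (Rmin x3 x4) (1 / 2))).
    assert (M3 := Rmin_l x1 x2). assert (M4 := Rmin_r x1 x2).
    assert (M5 := Rmin_l (Rmin x3 x4) (1 / 2)). assert (M6 := Rmin_r (Rmin x3 x4) (1 / 2)).
    assert (M7 := Rmin_l x3 x4). assert (M8 := Rmin_r x3 x4).
    assert (0 < Rmin (Rmin x1 x2) (Rmin (Rmin x3 x4) (1 / 2))).
    { repeat apply Rmin_glb_lt; lra. }
    lra. }
  assert (Hx0e : x0 < e1) by (unfold e1; lra).
  (* Near [b] the gap does not shrink as [x] decreases: once drag and forcing at [sigma y] are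
     replaced by those at [y], both rates are values of one function, which decreases relative to
     [th + c]. *)
  assert (Hmono : forall x, 0 < x <= x0 -> h x0 <= h x).
  { intros x Hx. apply Ropp_le_cancel.
    apply (le_of_deriv (fun x => - h x) (fun x => - ((rate2 (sigma x) * (th1 x + c)
       - rate1 x * (th2 (sigma x) + c)) / (x * (th2 (sigma x) + c)))) x x0); [ lra | | | ].
    - intros y Hy. apply cont_opp, Hhc. lra.
    - intros y Hy. apply d_opp, Hhd. lra.
    - intros y Hy.
      assert (G1 := Hdrag y ltac:(lra)). assert (G2 := Hforce y ltac:(lra)).
      assert (G3 := Hs2 y ltac:(lra)). assert (G4 := Hsx y ltac:(lra)).
      assert (G5 := Hh y ltac:(lra)). unfold h in G5.
      assert (T1 := N1 y ltac:(lra)). assert (T2 := N2 (sigma y) ltac:(lra)).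
      assert (T1' := Rabs_le_between (th1 y - 1) (1 / 4)). apply T1' in T1. clear T1'.
      assert (T3 := N3 y ltac:(apply Rabs_def1; lra)). assert (T4 := N4 y ltac:(apply Rabs_def1; lra)).
      assert (HB : y ^ 2 * (f (u1 (b - y)) / u1 (b - y)) <= 1 / 4).
      { assert (Hu := u_near_end_pos k p q a b u1 v1 sol1 y ltac:(lra)).
        rewrite nonlin_factor by exact Hu.
        replace (u1 (b - y) * (rpow (u1 (b - y)) (p - 1) - rpow (u1 (b - y)) (q - 1)) / u1 (b - y))
          with (rpow (u1 (b - y)) (p - 1) - rpow (u1 (b - y)) (q - 1)) by (field; lra).
        assert (P1 := rpow_le (u1 (b - y)) 1 (p - 1) ltac:(lra) ltac:(lra) ltac:(lra)).
        rewrite rpow_1_l in P1. assert (P2 := rpow_nonneg (u1 (b - y)) (q - 1)).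
        assert (y ^ 2 <= 1 / 4) by nra. assert (0 <= y ^ 2) by apply pow2_ge_0. nra. }
      assert (HR := autonomous_rate_decreasing c (d * y / (b - y))
        (y ^ 2 * (f (u1 (b - y)) / u1 (b - y))) (th1 y) (th2 (sigma y))
        c_pos ltac:(lra) HB ltac:(lra) ltac:(lra)).
      assert (HR2 : rate2 (sigma y) * (th1 y + c) <= (th2 (sigma y) * (1 - th2 (sigma y))
         + th2 (sigma y) * (d * y / (b - y)) - y ^ 2 * (f (u1 (b - y)) / u1 (b - y))) * (th1 y + c)).
      { apply Rmult_le_compat_r; [ lra | ]. unfold rate2, log_slope_rate.
        assert (th2 (sigma y) * (d * sigma y / (b - sigma y)) <= th2 (sigma y) * (d * y / (b - y)))
          by (apply Rmult_le_compat_l; lra). lra. }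
      replace (- _) with ((rate1 y * (th2 (sigma y) + c) - rate2 (sigma y) * (th1 y + c))
         / (y * (th2 (sigma y) + c))) by (field; repeat split; try lra; nra).
      apply Rmult_le_pos; [ unfold rate1, log_slope_rate; lra | ].
      left. apply Rinv_0_lt_compat, Rmult_lt_0_compat; lra. }
  assert (H0 := Hh x0 ltac:(lra)).
  (* Slopes within [e] of 1 give [h x <= 2 * e < h x0], against the lower bound just found. *)
  set (e := Rmin 1 (h x0 / 3)).
  assert (He' : 0 < e <= 1 /\ e <= h x0 / 3).
  { unfold e. generalize (Rmin_l 1 (h x0 / 3)) (Rmin_r 1 (h x0 / 3)). intros.
    repeat split; try lra. apply Rmin_glb_lt; lra. }
  destruct (log_slope_near_end k p q hq hpq a b u1 v1 sol1 m1 r1 t1 pf1 e ltac:(lra)) as [x5 [Hx5 N5]].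
  destruct (log_slope_near_end k p q hq hpq a b u2 v2 sol2 m2 r2 t2 pf2 e ltac:(lra)) as [x6 [Hx6 N6]].
  set (x := Rmin x0 (Rmin x5 x6) / 2).
  assert (Hx : 0 < x < x0 /\ x < x5 /\ x < x6).
  { unfold x. generalize (Rmin_l x0 (Rmin x5 x6)) (Rmin_r x0 (Rmin x5 x6)) (Rmin_l x5 x6) (Rmin_r x5 x6).
    intros. assert (0 < Rmin x0 (Rmin x5 x6)) by (repeat apply Rmin_glb_lt; lra). lra. }
  specialize (Hmono x ltac:(lra)).
  assert (Hsx' := Hsx x ltac:(lra)). assert (Hs2' := Hs2 x ltac:(lra)).
  assert (T1 := N5 x ltac:(lra)). assert (T2 := N6 (sigma x) ltac:(lra)).
  apply Rabs_le_between in T1. apply Rabs_le_between in T2.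
  unfold h at 2 in Hmono. lra.
Qed.

End FallingOrder.

(** * Uniqueness *)

Section Uniqueness.
Context (k : nat) (p q : R) (hq : 0 < q) (hpq : q < p)
  (hsub : subcritical p q (INR k + 2)).

Lemma exterior_slope_not_lt (a : R) (u1 v1 u2 v2 : R -> R) :
  extended_solution k p q a p_infty u1 v1 -> extended_solution k p q a p_infty u2 v2 ->
  ~ v1 a < v2 a.
Proof.
  intros sol1 sol2 Hv.
  destruct (exists_profile k p q hq hpq _ _ _ _ sol1) as [m1 [r1 [t1 pf1]]].
  destruct (exists_profile k p q hq hpq _ _ _ _ sol2) as [m2 [r2 [t2 pf2]]].
  destruct (slope_comparison k p q hq hpq a p_infty u1 v1 u2 v2 sol1 sol2
              m1 r1 t1 pf1 m2 r2 t2 pf2 hsub Hv) as [_ [_ [_ [_ [e [He Hs]]]]]].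
  apply (no_slow_exterior_decay k p q a u2 v2 m2 r2 t2 e hq hpq sol2 pf2 He).
  intros s Hss. specialize (Hs s Hss).
  assert (Hb := br_beta _ _ _ _ _ _ _ (pf_fall _ _ _ _ _ _ _ _ _ _ pf1)).
  assert (Hr := br_r _ _ _ _ _ _ _ (pf_fall _ _ _ _ _ _ _ _ _ _ pf1) s ltac:(lra)).
  assert (0 <= scaled_speed p q t1 (fun s => v1 (t1 s)) s).
  { apply Rmult_le_pos; [ lra | apply sqrt_pos ]. }
  lra.
Qed.

Lemma annulus_slope_not_lt (a b : R) (u1 v1 u2 v2 : R -> R) : 1 < p ->
  extended_solution k p q a b u1 v1 -> extended_solution k p q a b u2 v2 ->
  ~ v1 a < v2 a.
Proof.
  intros Hp sol1 sol2 Hv.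
  destruct (exists_profile k p q hq hpq _ _ _ _ sol1) as [m1 [r1 [t1 pf1]]].
  destruct (exists_profile k p q hq hpq _ _ _ _ sol2) as [m2 [r2 [t2 pf2]]].
  destruct (slope_comparison k p q hq hpq a b u1 v1 u2 v2 sol1 sol2
              m1 r1 t1 pf1 m2 r2 t2 pf2 hsub Hv) as [HM [HVr [Hr [HVt [e [He Hs]]]]]].
  destruct (Rle_lt_dec q 1) as [Hq|Hq].
  - exact (no_ordered_pair_sublinear k p q a b u1 v1 u2 v2 sol1 sol2
             m1 r1 t1 pf1 m2 r2 t2 pf2 HM Hr HVt Hq Hp).
  - apply (rising_max_order k p q hq hpq a b u1 v1 u2 v2 sol1 sol2
             m1 r1 t1 pf1 m2 r2 t2 pf2 HM HVr Hr HVt); [ lra | ].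
    apply (falling_max_order k p q ltac:(lra) hpq a b u1 v1 u2 v2 sol1 sol2
             m1 r1 t1 pf1 m2 r2 t2 pf2 HM).
    exact (solutions_ordered k p q a b u1 v1 u2 v2 sol1 sol2
             m1 r1 t1 pf1 m2 r2 t2 pf2 HM Hr HVt).
Qed.

Lemma extended_solution_unique (a : R) (b : Rbar) (u1 v1 u2 v2 : R -> R) :
  extended_solution k p q a b u1 v1 -> extended_solution k p q a b u2 v2 ->
  v1 a = v2 a -> forall x, closed_itv a b x -> u1 x = u2 x.
Proof.
  intros sol1 sol2 Hv x [Hx1 Hx2].
  destruct (exists_profile k p q hq hpq _ _ _ _ sol1) as [m1 [r1 [t1 pf1]]].
  destruct (exists_profile k p q hq hpq _ _ _ _ sol2) as [m2 [r2 [t2 pf2]]].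
  destruct (Req_dec x a) as [->|Hxa].
  { rewrite (es_left _ _ _ _ _ _ _ sol1), (es_left _ _ _ _ _ _ _ sol2); lra. }
  destruct (Rbar_le_lt_or_eq_dec _ _ Hx2) as [Hx|Hx].
  - apply (same_slope_same_solution k p q hq hpq a b u1 v1 u2 v2 sol1 sol2
             m1 r1 t1 pf1 m2 r2 t2 pf2 Hv). split; [ lra | exact Hx ].
  - assert (R1 := es_right _ _ _ _ _ _ _ sol1). assert (R2 := es_right _ _ _ _ _ _ _ sol2).
    destruct b as [b'| |]; try discriminate. injection Hx as ->. rewrite R1, R2; lra.
Qed.

End Uniqueness.

Theorem corollary1p2 (n : nat) (p q : R) (hn : (2 <= n)%nat)
  (hq : 0 < q) (hpq : q < p)
  (hcond : cond_i n p q \/ cond_ii n p q \/ cond_iii n p q) :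
  (forall a : R, 0 < a ->
     at_most_one_on (closed_itv a p_infty)
       (exterior_solution n (nonlin p q) a)) /\
  (1 < p ->
   forall a b : R, 0 < a -> a < b ->
     at_most_one_on (closed_itv a b)
       (annulus_solution n (nonlin p q) a b)).
Proof.
  assert (hsub := cond_subcritical n p q hn hq hpq hcond).
  destruct n as [|[|k]]; try lia. clear hcond hn.
  rewrite !S_INR in hsub. replace (INR k + 1 + 1) with (INR k + 2) in hsub by ring.
  split.
  - intros a Ha w1 w2 [S1 [Z1 L1]] [S2 [Z2 L2]] x Hx.
    destruct (extend_solution k p q a p_infty w1 Ha I S1 Z1 L1) as [u1 [v1 [sol1 E1]]].
    destruct (extend_solution k p q a p_infty w2 Ha I S2 Z2 L2) as [u2 [v2 [sol2 E2]]].
    rewrite <- E1, <- E2 by exact Hx.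
    apply (extended_solution_unique k p q hq hpq a p_infty u1 v1 u2 v2 sol1 sol2); [ | exact Hx ].
    assert (N1 := exterior_slope_not_lt k p q hq hpq hsub a u1 v1 u2 v2 sol1 sol2).
    assert (N2 := exterior_slope_not_lt k p q hq hpq hsub a u2 v2 u1 v1 sol2 sol1). lra.
  - intros Hp a b Ha Hab w1 w2 [S1 [Z1 L1]] [S2 [Z2 L2]] x Hx.
    destruct (extend_solution k p q a b w1 Ha Hab S1 Z1 L1) as [u1 [v1 [sol1 E1]]].
    destruct (extend_solution k p q a b w2 Ha Hab S2 Z2 L2) as [u2 [v2 [sol2 E2]]].
    rewrite <- E1, <- E2 by exact Hx.
    apply (extended_solution_unique k p q hq hpq a b u1 v1 u2 v2 sol1 sol2); [ | exact Hx ].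
    assert (N1 := annulus_slope_not_lt k p q hq hpq hsub a b u1 v1 u2 v2 Hp sol1 sol2).
    assert (N2 := annulus_slope_not_lt k p q hq hpq hsub a b u2 v2 u1 v1 Hp sol2 sol1). lra.
Qed.
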